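(* Let $\Delta_T>0$ be in one of the three regimes: (a) $\Delta_T\to0$; (b) $\Delta_T\to\Delta_\infty\in(0,\infty)$; (c) $\Delta_T\to\infty$, $T/\Delta_T\to\infty$ and $T/\Delta_T^{5/4}=o\big((\log(T/\Delta_T))^{-1/4}\big)$. Define $$\widehat\vartheta^{OS}_{T,\Delta_T}=\widehat\vartheta^{QV}_{T,\Delta_T}-\frac{\sum_{i=1}^{\lfloor T/\Delta_T\rfloor}\partial_\vartheta\log f_{\Delta_T}\big(\widehat\vartheta^{QV}_{T,\Delta_T},X_{i\Delta_T}-X_{(i-1)\Delta_T}\big)}{\sum_{i=1}^{\lfloor T/\Delta_T\rfloor}\partial^2_\vartheta\log f_{\Delta_T}\big(\widehat\vartheta^{QV}_{T,\Delta_T},X_{i\Delta_T}-X_{(i-1)\Delta_T}\big)},$$ where $\widehat\vartheta^{QV}_{T,\Delta_T}=\frac1T\sum_{i=1}^{\lfloor T/\Delta_T\rfloor}(X_{i\Delta_T}-X_{(i-1)\Delta_T})^2$. Then for every $\vartheta\in\Theta$, $$I_{T,\Delta_T}(\vartheta)^{1/2}\big(\widehat\vartheta^{OS}_{T,\Delta_T}-\vartheta\big)\to\mathcal N(0,1)$$ in distribution under $\mathbb P^{T,\Delta_T}_\vartheta$, where $I_{T,\Delta_T}(\vartheta)=T/\vartheta$ in regime (a), $I_{T,\Delta_T}(\vartheta)=T\Delta_\infty\varphi(\vartheta,\Delta_\infty)$ in regime (b), and $I_{T,\Delta_T}(\vartheta)=\frac{T\Delta_T^{-1}}{2\vartheta^2}$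 in regime (c).
   Context: Under $\mathbb P_\vartheta=\mathbb P^{T,\Delta}_\vartheta$, $X_t=\sum_{i=1}^{N_t}\varepsilon_i$ ($X_0=0$), with $(N_t)$ homogeneous Poisson of intensity $\vartheta\in\Theta\subseteq(0,\infty)$ ($\Theta$ open) and $\varepsilon_i$ i.i.d., independent of $(N_t)$, $\mathbb P(\varepsilon_i=\pm1)=1/2$; one observes $X_{i\Delta}$, $i=0,\dots,\lfloor T/\Delta\rfloor$. $f_\Delta(\vartheta,k)=\mathbb P_\vartheta(X_\Delta=k)=e^{-\vartheta\Delta}\mathcal I_{|k|}(\vartheta\Delta)$, with $\mathcal I_\nu(x)=\sum_{m\ge0}\frac{(x/2)^{2m+\nu}}{m!\,\Gamma(\nu+m+1)}$. $h_\Delta(\vartheta,k)=\mathcal I_{|k|+1}(\vartheta\Delta)/\mathcal I_{|k|}(\vartheta\Delta)$, $\varphi(\vartheta,\Delta)=\mathbb E_\vartheta\big[\big(h_\Delta(\vartheta,X_\Delta)+(\vartheta\Delta)^{-1}|X_\Delta|-1\big)^2\big]$. *)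

(* Defs.v *)
From Stdlib Require Import Reals Lra Lia ZArith List ClassicalEpsilon.
Import ListNotations.
Open Scope R_scope.

Definition lim (u : nat -> R) : R :=
  epsilon (inhabits 0) (fun l => Un_cv u l).

(* Modified Bessel function of the first kind, integer order nu:
   I_nu(x) = sum_{m>=0} (x/2)^(2m+nu) / (m! Gamma(nu+m+1)),  Gamma(nu+m+1) = (nu+m)! *)
Definition Bessel_I (nu : nat) (x : R) : R :=
  lim (fun M => sum_f_R0 (fun m => (x / 2) ^ (2 * m + nu)
                     / (INR (fact m) * INR (fact (nu + m)))) M).

(* f_Delta(theta, k) = P_theta(X_Delta = k) = e^{-theta Delta} I_{|k|}(theta Delta) *)
Definition fD (D th : R) (k : Z) : R :=
  exp (- (th * D)) * Bessel_I (Z.abs_nat k) (th * D).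

Definition hD (D th : R) (k : Z) : R :=
  Bessel_I (S (Z.abs_nat k)) (th * D) / Bessel_I (Z.abs_nat k) (th * D).

Definition Zbox (M : nat) : list Z :=
  map (fun j => (Z.of_nat j - Z.of_nat M)%Z) (seq 0 (2 * M + 1)).

Definition sumL (l : list R) : R := fold_right Rplus 0 l.

(* phi(theta, Delta) = E_theta[(h_Delta(theta,X_Delta) + |X_Delta|/(theta Delta) - 1)^2] *)
Definition phiD (th D : R) : R :=
  lim (fun M => sumL (map (fun k => fD D th k *
          (hD D th k + IZR (Z.abs k) / (th * D) - 1) ^ 2) (Zbox M))).

Definition deriv (g : R -> R) (x : R) : R :=
  epsilon (inhabits 0) (fun l => derivable_pt_lim g x l).

Definition dlogf (D th : R) (k : Z) : R := deriv (fun t => ln (fD D t k)) th.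
Definition d2logf (D th : R) (k : Z) : R :=
  deriv (fun t => deriv (fun s => ln (fD D s k)) t) th.

(* Estimators, as functions of the list Y of increments X_{iD} - X_{(i-1)D}. *)
Definition QV (T : R) (Y : list Z) : R :=
  / T * sumL (map (fun y => (IZR y) ^ 2) Y).

Definition OS (D T : R) (Y : list Z) : R :=
  QV T Y - sumL (map (fun y => dlogf D (QV T Y) y) Y)
           / sumL (map (fun y => d2logf D (QV T Y) y) Y).

Definition nobs (T D : R) : nat := Z.to_nat (Int_part (T / D)).

Fixpoint boxsum (n M : nat) (g : list Z -> R) : R :=
  match n with
  | O => g nil
  | S n' => sumL (map (fun k => boxsum n' M (fun l => g (k :: l))) (Zbox M))
  end.

Definition prodf (D th : R) (Y : list Z) : R :=
  fold_right Rmult 1 (map (fD D th) Y).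

(* Under P_theta^{T,D}, the n = floor(T/D) increments are i.i.d. with pmf f_D(theta,.).
   prob_le D th n S x = P_theta( S(increments) <= x ). *)
Definition prob_le (D th : R) (n : nat) (Sx : list Z -> R) (x : R) : R :=
  lim (fun M => boxsum n M (fun Y => prodf D th Y * (if Rle_dec (Sx Y) x then 1 else 0))).

Definition gauss_density (t : R) : R := exp (- (t ^ 2) / 2) / sqrt (2 * PI).
Definition Rint (g : R -> R) (a b : R) : R :=
  epsilon (inhabits 0) (fun v => exists pr : Riemann_integrable g a b, RiemannInt pr = v).
Definition Phi (x : R) : R := lim (fun m => Rint gauss_density (- INR m) x).

Definition lim_infty (g : R -> R) (l : R) : Prop :=
  forall eps, eps > 0 -> exists T0, forall T, T >= T0 -> Rabs (g T - l) < eps.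
Definition to_infty (g : R -> R) : Prop :=
  forall A, exists T0, forall T, T >= T0 -> g T > A.

Definition conv_std_normal (D : R -> R) (th : R) (I : R -> R) : Prop :=
  forall x, lim_infty
    (fun T => prob_le (D T) th (nobs T (D T))
                (fun Y => sqrt (I T) * (OS (D T) T Y - th)) x)
    (Phi x).

(* Main.v *)
(** Write [l = theta Delta].  The increments have mass function [exp(-l) I_|k|(l)]; the three-term recurrence
    of the Bessel functions turns into a Stein identity that gives the moments, and the score
    [I_k'(l)/I_k(l) - 1] solves a Riccati equation, which bounds it and its derivatives uniformly in [k] and [l].
    Sums of i.i.d. terms are compared with the explicit solution [Phi(y / sqrt tau)] of the heat equation by
    Lindeberg's replacement.

    In regimes (a) and (b), [l] is bounded and [n l -> oo]: QV is [sqrt(n l)]-consistent, so one Newton step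
    leaves the normalised score at the true parameter plus a Taylor remainder that tends to [0].

    In regime (c), [l -> oo], and Debye-type sub- and supersolutions of the Riccati equation give the score
    [(k^2/s - 1)/(2s) + O((1 + (k^2/s)^2)/s^2)].  At [s = QV Delta] the leading terms cancel in the sum, by the
    definition of QV, so that the step moves QV by [O(1/n + 1/Delta) = o(n^(-1/2))], and QV itself satisfies the
    central limit theorem.

    Expectations are finite sums over the box [[-M, M]^n]; limits are taken along [M -> oo], then [T -> oo]. *)

(* The limits, derivatives and integrals of the statement are choice operators, so each one is
   identified by a convergence proof before use. A box carries mass below one, and the truncated
   increments are not exactly centred; these defects, multiplied by powers of [n], vanish because
   [T], hence [n], stays fixed while [M -> oo].

   Regimes (a) and (b) share one proof. The right clock is the expected number of jumps [n l], not
   [n]: the information about [theta'/theta] is [n l q] with [q = l phi], and [q] tends to [1] in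
   (a), to a positive constant in (b). Moments must be [O(l)] as [l -> 0]; they are, because the
   increments are integers and so [|k| <= k^2].

   In (c) that route breaks: the Lipschitz bound available for the normalised second derivative
   grows like [l^3]. The numerator of the Newton step is therefore estimated directly, and the
   denominator is only kept away from [0], for which a one-sided bound is enough. The rate condition
   yields [T/Delta <= Delta] eventually, so that a displacement [O(1/Delta)] is small against
   [n^(-1/2)]. *)
From Coquelicot Require Import Coquelicot.
Require Import Defs.
From Stdlib Require Import Reals ZArith List ClassicalEpsilon FunctionalExtensionality Lra Lia Psatz.
Open Scope R_scope.

(** * Gaussian integral *)

(* Coquelicot's lemmas leave equations in the carriers of algebraic structures, on which [field] fails. *)
Ltac eq_in_R := simpl; match goal with |- @eq _ ?a ?b => change (@eq R a b) end.

Lemma le_div (a b c : R) : 0 < c -> a * c <= b -> a <= b / c.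
Proof. intros H. apply Rle_div_r, H. Qed.

Lemma div_le (a b c : R) : 0 < c -> a <= b * c -> a / c <= b.
Proof. intros H. apply Rle_div_l, H. Qed.

Lemma div_nonneg (a b : R) : 0 <= a -> 0 < b -> 0 <= a / b.
Proof. intros Ha Hb. apply le_div; lra. Qed.

Lemma inv_nonneg (a : R) : 0 < a -> 0 <= / a.
Proof. intros H. left. apply Rinv_0_lt_compat, H. Qed.

Ltac pos := solve [ lra | assumption
  | lazymatch goal with
    | |- 0 <= _ + _ => apply Rplus_le_le_0_compat; pos
    | |- 0 <= _ * _ => apply Rmult_le_pos; pos
    | |- 0 < _ * _ => apply Rmult_lt_0_compat; pos
    | |- 0 <= _ / _ => apply div_nonneg; pos
    | |- 0 < _ / _ => apply Rdiv_lt_0_compat; pos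
    | |- 0 <= / _ => apply inv_nonneg; pos
    | |- 0 < / _ => apply Rinv_0_lt_compat; pos
    | |- 0 <= _ ^ _ => first [apply pow2_ge_0 | apply pow_le; pos]
    | |- 0 < _ ^ _ => apply pow_lt; pos
    | |- 0 <= Rabs _ => apply Rabs_pos
    | |- 0 <= INR _ => apply pos_INR
    | |- 0 < exp _ => apply exp_pos
    end ].

Lemma lim_unique (u : nat -> R) (l : R) : Un_cv u l -> lim u = l.
Proof.
  intros H. unfold lim.
  apply (UL_sequence u); [|exact H].
  apply (epsilon_spec (inhabits 0) (fun l => Un_cv u l)). exists l; exact H.
Qed.

Lemma deriv_unique (g : R -> R) (x l : R) : is_derive g x l -> deriv g x = l.
Proof.
  intros H. apply is_derive_Reals in H. unfold deriv.
  apply (uniqueness_limite g x); [|exact H].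
  apply (epsilon_spec (inhabits 0) (fun l => derivable_pt_lim g x l)). exists l; exact H.
Qed.

Lemma derive_minus (f g : R -> R) (x a b : R) :
  is_derive f x a -> is_derive g x b -> is_derive (fun x => f x - g x) x (a - b).
Proof. intros; apply (is_derive_minus (V := R_NormedModule)); assumption. Qed.

Lemma derive_const (c x : R) : is_derive (fun _ : R => c) x 0.
Proof. apply (is_derive_const (V := R_NormedModule)). Qed.

Lemma derive_plus (f g : R -> R) (x a b : R) :
  is_derive f x a -> is_derive g x b -> is_derive (fun x => f x + g x) x (a + b).
Proof. intros; apply (is_derive_plus (V := R_NormedModule)); assumption. Qed.

Lemma derive_mult (f g : R -> R) (x a b : R) :
  is_derive f x a -> is_derive g x b -> is_derive (fun x => f x * g x) x (a * g x + f x * b).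
Proof. intros; apply (is_derive_mult f g); [assumption..|exact Rmult_comm]. Qed.

Lemma derive_comp (f g : R -> R) (x a b : R) :
  is_derive f (g x) a -> is_derive g x b -> is_derive (fun x => f (g x)) x (b * a).
Proof. intros; apply (is_derive_comp f g); assumption. Qed.

Lemma derive_continuous (f : R -> R) (x : R) : ex_derive f x -> continuous f x.
Proof. apply (@ex_derive_continuous R_AbsRing R_NormedModule). Qed.

Lemma mvt (f df : R -> R) (a b : R) :
  (forall x, Rmin a b <= x <= Rmax a b -> is_derive f x (df x)) ->
  exists c, Rmin a b <= c <= Rmax a b /\ f b - f a = df c * (b - a).
Proof.
  intros H. apply (MVT_gen f a b df).
  - intros x Hx; apply H; lra.
  - intros x Hx. apply continuity_pt_filterlim.
    apply derive_continuous. exists (df x); apply H; exact Hx.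
Qed.

Definition gint (t : R) : R := RInt (fun x => exp (- (x ^ 2) / 2)) 0 t.

Lemma gauss_ex_RInt (a b : R) : ex_RInt (fun x => exp (- (x ^ 2) / 2)) a b.
Proof.
  apply (@ex_RInt_continuous R_CompleteNormedModule). intros z _.
  apply derive_continuous. auto_derive; auto.
Qed.

Lemma gint_derive (t : R) : is_derive gint t (exp (- (t ^ 2) / 2)).
Proof.
  apply (is_derive_RInt (fun x => exp (- (x ^ 2) / 2)) gint 0 t).
  - apply filter_forall. intros b. apply (@RInt_correct R_CompleteNormedModule), gauss_ex_RInt.
  - apply derive_continuous. auto_derive; auto.
Qed.

Lemma gint_0 : gint 0 = 0.
Proof. apply (RInt_point (V := R_CompleteNormedModule)). Qed.

(** Auxiliary parameter integral of the one-variable evaluation of the Gaussian integral: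
    differentiated under the integral sign, it yields minus half the derivative of [gint t ^ 2]. *)
Definition gaux (t : R) : R :=
  RInt (fun x => exp (- (t ^ 2) * (1 + x ^ 2) / 2) / (1 + x ^ 2)) 0 1.

Lemma one_plus_sqr_neq0 (x : R) : 1 + x ^ 2 <> 0.
Proof. nra. Qed.

Lemma gaux_ex_RInt (t : R) :
  ex_RInt (fun x => exp (- (t ^ 2) * (1 + x ^ 2) / 2) / (1 + x ^ 2)) 0 1.
Proof.
  apply (@ex_RInt_continuous R_CompleteNormedModule). intros z _.
  apply derive_continuous. auto_derive.
  pose proof (one_plus_sqr_neq0 z). simpl in *. lra.
Qed.

Lemma gaux_derive (t : R) : is_derive gaux t (- exp (- (t ^ 2) / 2) * gint t).
Proof.
  set (f := fun t x => exp (- (t ^ 2) * (1 + x ^ 2) / 2) / (1 + x ^ 2)).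
  assert (Df : forall u v, Derive (fun z => f z v) u = - u * exp (- (u ^ 2) * (1 + v ^ 2) / 2)).
  { intros u v. apply is_derive_unique. unfold f.
    pose proof (one_plus_sqr_neq0 v) as Hn.
    auto_derive; [simpl in *; lra | simpl in *]. unfold Rdiv. field. lra. }
  assert (H : is_derive (fun t => RInt (fun x => f t x) 0 1) t
     (RInt (fun x => Derive (fun u => f u x) t) 0 1)).
  { apply (is_derive_RInt_param f 0 1 t).
    - apply filter_forall. intros x v _. unfold f. auto_derive.
      simpl in *. lra.
    - intros v _.
      apply (continuity_2d_pt_ext (fun u v => - u * exp (- (u ^ 2) * (1 + v ^ 2) / 2))).
      + intros; symmetry; apply Df.
      + assert (Hu : continuity_2d_pt (fun u _ : R => u) t v) by apply continuity_2d_pt_id1.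
        assert (Hv : continuity_2d_pt (fun _ v : R => v) t v) by apply continuity_2d_pt_id2.
        assert (Hm : continuity_2d_pt (fun u w : R => - (u * u) * (1 + w * w) * / 2) t v).
        { apply continuity_2d_pt_mult; [|apply continuity_2d_pt_const].
          apply continuity_2d_pt_mult.
          - apply continuity_2d_pt_opp, continuity_2d_pt_mult; assumption.
          - apply continuity_2d_pt_plus; [apply continuity_2d_pt_const|].
            apply continuity_2d_pt_mult; assumption. }
        apply continuity_2d_pt_mult; [apply continuity_2d_pt_opp; assumption|].
        apply (continuity_2d_pt_ext (fun u w => exp (- (u * u) * (1 + w * w) * / 2))).
        { intros x y. f_equal. field. }
        apply (continuity_1d_2d_pt_comp exp); [|assumption].
        apply derivable_continuous_pt, derivable_pt_exp.
    - apply filter_forall. intros y. apply gaux_ex_RInt. }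
  replace (- exp (- (t ^ 2) / 2) * gint t) with (RInt (fun x => Derive (fun u => f u x) t) 0 1);
    [exact H|].
  (* The factor [t] and the [+ 0] give the integrand the shape required by [RInt_comp_lin]; the
     substitution [u = t x] then produces [gint t]. *)
  rewrite (RInt_ext _ (fun x => scal (- exp (- (t ^ 2) / 2)) (scal t (exp (- ((t * x + 0) ^ 2) / 2))))).
  2:{ intros x _. rewrite Df. unfold scal; simpl; unfold mult; simpl.
      replace (- (t * (t * 1)) * (1 + x * (x * 1)) / 2)
        with (- (t * (t * 1)) / 2 + - ((t * x + 0) * ((t * x + 0) * 1)) / 2) by field.
      rewrite exp_plus. ring. }
  rewrite (RInt_scal (V := R_CompleteNormedModule)).
  2:{ apply (@ex_RInt_continuous R_CompleteNormedModule). intros z _.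
      apply derive_continuous.
      unfold scal; simpl; unfold mult; simpl. auto_derive; auto. }
  pose proof (RInt_comp_lin (V := R_CompleteNormedModule) (fun x => exp (- (x ^ 2) / 2)) t 0 0 1
    (gauss_ex_RInt _ _)) as Hl.
  transitivity (- exp (- (t ^ 2) / 2) * RInt (fun x => exp (- (x ^ 2) / 2)) (t * 0 + 0) (t * 1 + 0)).
  2:{ unfold gint. now rewrite Rmult_0_r, Rplus_0_r, Rmult_1_r, Rplus_0_r. }
  rewrite <- Hl. reflexivity.
Qed.

(** The derivatives of the two terms cancel, so the sum equals its value at [0], where [gaux]
    integrates [1 / (1 + x^2)] to [PI / 4]. *)
Lemma gint_gaux (t : R) : gint t ^ 2 + 2 * gaux t = PI / 2.
Proof.
  assert (H0 : gint 0 ^ 2 + 2 * gaux 0 = PI / 2).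
  { rewrite gint_0. unfold gaux.
    rewrite (RInt_ext _ (fun x => / (1 + x ^ 2))).
    2:{ intros x _. replace (- 0 ^ 2 * (1 + x ^ 2) / 2) with 0 by field.
        rewrite exp_0. apply Rmult_1_l. }
    rewrite (is_RInt_unique _ 0 1 (atan 1 - atan 0)).
    - rewrite atan_1, atan_0. field.
    - apply (is_RInt_derive atan (fun x => / (1 + x ^ 2))).
      + intros x _. apply is_derive_Reals.
        exact (derivable_pt_lim_atan x).
      + intros x _. apply derive_continuous. auto_derive.
        pose proof (one_plus_sqr_neq0 x). simpl in *. lra. }
  rewrite <- H0.
  destruct (mvt (fun t => gint t ^ 2 + 2 * gaux t) (fun _ => 0) 0 t) as [c [_ Hc]].
  - intros x _. pose proof (gint_derive x) as H1. pose proof (gaux_derive x) as H2.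
    evar_last.
    { apply derive_plus.
      - apply (is_derive_pow gint 2 x _ H1).
      - apply (is_derive_scal gaux x 2 _ H2). }
    unfold plus; simpl. ring.
  - lra.
Qed.

Lemma gaux_bounds (t : R) : 0 <= gaux t <= exp (- (t ^ 2) / 2).
Proof.
  assert (E : forall c : R, RInt (V := R_CompleteNormedModule) (fun _ : R => c) 0 1 = c).
  { intros c. rewrite (RInt_const (V := R_CompleteNormedModule)).
    unfold scal; simpl; unfold mult; simpl. ring. }
  assert (Ec : forall c : R, ex_RInt (V := R_NormedModule) (fun _ : R => c) 0 1)
    by (intros; apply (ex_RInt_const (V := R_CompleteNormedModule))).
  assert (P : forall x, 1 <= 1 + x ^ 2) by (intros; nra).
  split; unfold gaux.
  - apply Rle_trans with (RInt (V := R_CompleteNormedModule) (fun _ => 0) 0 1); [right; symmetry; apply E|].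
    apply RInt_le; [lra|apply Ec|apply gaux_ex_RInt|].
    intros x _. apply Rle_div_r; [specialize (P x); lra|]. rewrite Rmult_0_l.
    left; apply exp_pos.
  - apply Rle_trans with (RInt (V := R_CompleteNormedModule) (fun _ => exp (- (t ^ 2) / 2)) 0 1);
      [|right; apply E].
    apply RInt_le; [lra|apply gaux_ex_RInt|apply Ec|].
    intros x _. apply Rle_div_l; [specialize (P x); lra|].
    apply Rle_trans with (exp (- t ^ 2 / 2) * 1).
    + rewrite Rmult_1_r. assert (- t ^ 2 * (1 + x ^ 2) / 2 <= - t ^ 2 / 2) by nra.
      destruct H as [H|H]; [left; apply exp_increasing; exact H|right; f_equal; exact H].
    + apply Rmult_le_compat_l; [left; apply exp_pos|apply P].
Qed.

Lemma gint_sqr_lower (t : R) : PI / 2 - 2 * exp (- (t ^ 2) / 2) <= gint t ^ 2 <= PI / 2.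
Proof. pose proof (gint_gaux t). pose proof (gaux_bounds t). lra. Qed.

Lemma gint_incr (a b : R) : a <= b -> gint a <= gint b.
Proof.
  intros H. destruct (mvt gint (fun t => exp (- (t ^ 2) / 2)) a b) as [c [_ Hc]].
  - intros; apply gint_derive.
  - pose proof (exp_pos (- (c ^ 2) / 2)). nra.
Qed.

Lemma gint_odd (t : R) : gint (- t) = - gint t.
Proof.
  destruct (mvt (fun t => gint (- t) + gint t) (fun _ => 0) 0 t) as [c [_ Hc]].
  - intros x _. evar_last.
    { apply derive_plus.
      - apply (derive_comp gint Ropp x); [apply gint_derive|].
        apply (is_derive_opp (V := R_NormedModule)), is_derive_id.
      - apply gint_derive. }
    unfold plus, scal, opp, one; simpl; unfold mult; simpl.
    replace (- x * (- x * 1)) with (x * (x * 1)) by ring. ring.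
  - rewrite Ropp_0, gint_0 in Hc. lra.
Qed.

Definition half_gauss : R := sqrt (PI / 2).

Lemma half_gauss_pos : 0 < half_gauss.
Proof. apply sqrt_lt_R0. pose proof PI_RGT_0. lra. Qed.

Lemma half_gauss_sqr : half_gauss ^ 2 = PI / 2.
Proof. unfold half_gauss. apply pow2_sqrt. pose proof PI_RGT_0. lra. Qed.

Lemma sqrt_2PI : sqrt (2 * PI) = 2 * half_gauss.
Proof.
  pose proof half_gauss_pos.
  replace (2 * PI) with ((2 * half_gauss) ^ 2) by (rewrite Rpow_mult_distr, half_gauss_sqr; field).
  apply sqrt_pow2. lra.
Qed.

(** Since [half_gauss^2 - gint^2] is at most [2 exp(-t^2/2)], dividing by
    [half_gauss + gint >= half_gauss] transfers the decay to the difference. *)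
Lemma gint_near (t : R) : 0 <= t -> half_gauss - 2 / half_gauss * exp (- (t ^ 2) / 2) <= gint t <= half_gauss.
Proof.
  intros Ht. pose proof half_gauss_pos as HG. pose proof (gint_sqr_lower t) as H.
  rewrite <- half_gauss_sqr in H.
  assert (0 <= gint t) by (rewrite <- gint_0; apply gint_incr; exact Ht).
  assert (gint t <= half_gauss) by nra. split; [|assumption].
  assert (half_gauss * (half_gauss - gint t) <= 2 * exp (- t ^ 2 / 2)) by nra.
  assert (half_gauss - gint t <= 2 / half_gauss * exp (- t ^ 2 / 2)); [|lra].
  replace (2 / half_gauss * exp (- t ^ 2 / 2)) with (2 * exp (- t ^ 2 / 2) / half_gauss) by (field; lra).
  apply Rle_div_r; lra.
Qed.

Lemma gint_lim : is_lim gint p_infty half_gauss.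
Proof.
  apply is_lim_le_le_loc with (fun t => half_gauss - 2 / half_gauss * / (1 + t)) (fun _ => half_gauss).
  (* From [t > 2] on, [exp (t^2/2) >= 1 + t^2/2 >= 1 + t]. *)
  - exists 2. intros t Ht. destruct (gint_near t) as [H1 H2]; [lra|].
    split; [|exact H2]. eapply Rle_trans; [|exact H1].
    pose proof half_gauss_pos. assert (0 < 2 / half_gauss) by pos.
    assert (exp (- t ^ 2 / 2) <= / (1 + t)); [|nra].
    replace (- t ^ 2 / 2) with (- (t ^ 2 / 2)) by field. rewrite exp_Ropp.
    apply Rinv_le_contravar; [lra|]. apply Rle_trans with (1 + t ^ 2 / 2); [nra|].
    left. apply exp_ineq1. nra.
  - evar_last.
    { apply is_lim_minus'; [apply is_lim_const|].
      apply (is_lim_scal_l (fun t => / (1 + t)) (2 / half_gauss) p_infty 0).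
      replace (Finite 0) with (Rbar_inv p_infty) by reflexivity.
      apply is_lim_inv; [|discriminate].
      apply is_lim_plus with 1 p_infty; [apply is_lim_const|apply is_lim_id|reflexivity]. }
    f_equal. ring.
  - apply is_lim_const.
Qed.

Lemma Rint_RInt (g : R -> R) (a b : R) :
  (forall x, continuous g x) -> Rint g a b = RInt g a b.
Proof.
  intros Hc.
  assert (Hex : ex_RInt g a b) by (apply (@ex_RInt_continuous R_CompleteNormedModule); auto).
  unfold Rint.
  assert (He : exists v, exists pr : Riemann_integrable g a b, RiemannInt pr = v).
  { exists (RiemannInt (ex_RInt_Reals_0 _ _ _ Hex)). eexists; reflexivity. }
  destruct (epsilon_spec (inhabits 0) _ He) as [pr Hpr].
  rewrite <- Hpr. symmetry. apply RInt_Reals.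
Qed.

(** Closed form behind all later facts on [Phi]: the choice operators for the integral and for the
    limit are resolved here once. *)
Lemma Phi_gint (x : R) : Phi x = 1 / 2 + gint x / (2 * half_gauss).
Proof.
  pose proof half_gauss_pos as HG. apply lim_unique.
  assert (E : forall m, Rint gauss_density (- INR m) x = gint (INR m) / (2 * half_gauss) + gint x / (2 * half_gauss)).
  { intros m. rewrite Rint_RInt.
    2:{ intros y. unfold gauss_density. rewrite sqrt_2PI.
        apply derive_continuous. auto_derive. lra. }
    apply is_RInt_unique. unfold gauss_density. rewrite sqrt_2PI.
    evar_last.
    { apply (is_RInt_derive (fun x => gint x / (2 * half_gauss))).
      - intros y _. apply (is_derive_ext (fun x => scal (/ (2 * half_gauss)) (gint x))).
        { intros; unfold scal; simpl; unfold mult; simpl; field; lra. }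
        evar_last. { apply (is_derive_scal gint y). apply gint_derive. }
        rewrite Rmult_comm. reflexivity.
      - intros y _. apply derive_continuous. auto_derive. lra. }
    unfold minus, plus, opp; simpl. rewrite gint_odd. field. lra. }
  apply is_lim_seq_Reals.
  apply is_lim_seq_ext with (fun m => gint (INR m) / (2 * half_gauss) + gint x / (2 * half_gauss)).
  { intros; symmetry; apply E. }
  apply is_lim_seq_plus' with (u := fun m => gint (INR m) / (2 * half_gauss)); [|apply is_lim_seq_const].
  replace (1 / 2) with (half_gauss * / (2 * half_gauss)) by (field; lra).
  apply is_lim_seq_mult'; [|apply is_lim_seq_const].
  apply (is_lim_comp_seq gint INR p_infty half_gauss); [apply gint_lim| |apply is_lim_seq_INR].
  exists 0%nat. discriminate.
Qed.

Lemma Phi_derive (x : R) : is_derive Phi x (gauss_density x).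
Proof.
  pose proof half_gauss_pos as HG.
  apply (is_derive_ext (fun x => 1 / 2 + / (2 * half_gauss) * gint x)).
  { intros t. rewrite Phi_gint. simpl. field; lra. }
  evar_last.
  { apply derive_plus; [apply derive_const|].
    apply (is_derive_scal gint x (/ (2 * half_gauss))), gint_derive. }
  unfold gauss_density. rewrite sqrt_2PI. field. lra.
Qed.

Lemma Phi_incr (a b : R) : a <= b -> Phi a <= Phi b.
Proof.
  intros H. rewrite !Phi_gint. pose proof (gint_incr a b H). pose proof half_gauss_pos.
  assert (gint a / (2 * half_gauss) <= gint b / (2 * half_gauss)); [|lra].
  apply Rmult_le_compat_r; [pos|assumption].
Qed.

Lemma Phi_opp (x : R) : Phi (- x) = 1 - Phi x.
Proof. rewrite !Phi_gint, gint_odd. pose proof half_gauss_pos. field. lra. Qed.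

Lemma Phi_lim_p : is_lim Phi p_infty 1.
Proof.
  pose proof half_gauss_pos.
  apply is_lim_ext with (fun x => 1 / 2 + / (2 * half_gauss) * gint x).
  { intros y. rewrite Phi_gint. field; lra. }
  evar_last.
  { apply is_lim_plus'; [apply is_lim_const|].
    apply (is_lim_scal_l gint (/ (2 * half_gauss)) p_infty half_gauss), gint_lim. }
  f_equal. field; lra.
Qed.

Lemma Phi_bounds (x : R) : 0 <= Phi x <= 1.
Proof.
  assert (A : forall x, Phi x <= 1).
  { intros y. apply Rnot_lt_le. intros Hy.
    destruct (Phi_lim_p (fun z => z < Phi y)) as [K HK].
    { exists (mkposreal (Phi y - 1) ltac:(lra)). intros z Hz.
      apply Rabs_lt_between' in Hz. simpl in Hz. lra. }
    specialize (HK (Rmax (K + 1) y)).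
    assert (Phi y <= Phi (Rmax (K + 1) y)) by apply Phi_incr, Rmax_r.
    pose proof (Rmax_l (K + 1) y). specialize (HK ltac:(lra)). lra. }
  split; [|apply A].
  pose proof (A (- x)). rewrite Phi_opp in H. lra.
Qed.

(** * Bessel functions *)

Definition bcoef (nu m : nat) : R := / (INR (fact m) * INR (fact (nu + m))).

Lemma fact_pos (n : nat) : 0 < INR (fact n).
Proof. apply lt_0_INR, lt_O_fact. Qed.

Lemma bcoef_pos (nu m : nat) : 0 < bcoef nu m.
Proof. apply Rinv_0_lt_compat, Rmult_lt_0_compat; apply fact_pos. Qed.

Lemma bcoef_S (nu m : nat) : INR (S m) * bcoef nu (S m) = bcoef (S nu) m.
Proof.
  unfold bcoef. replace (nu + S m)%nat with (S nu + m)%nat by lia.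
  rewrite fact_simpl, mult_INR. pose proof (fact_pos m). pose proof (fact_pos (S nu + m)).
  pose proof (lt_0_INR (S m) ltac:(lia)). field. repeat split; lra.
Qed.

Lemma bcoef_S' (nu m : nat) : INR (S nu + m) * bcoef (S nu) m = bcoef nu m.
Proof.
  unfold bcoef. change (S nu + m)%nat with (S (nu + m)).
  rewrite fact_simpl, mult_INR. pose proof (fact_pos m). pose proof (fact_pos (nu + m)).
  pose proof (lt_0_INR (S (nu + m)) ltac:(lia)). field. repeat split; lra.
Qed.

Lemma bcoef_radius (nu : nat) : CV_radius (bcoef nu) = p_infty.
Proof.
  apply CV_radius_infinite_DAlembert.
  - intros n. pose proof (bcoef_pos nu n). lra.
  - apply is_lim_seq_le_le with (fun _ => 0) (fun n => / INR (S n)).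
    + intros n.
      assert (E : bcoef nu (S n) / bcoef nu n = / INR (S n) * / INR (S nu + n)).
      { rewrite <- (bcoef_S' nu n). rewrite <- (bcoef_S nu n).
        pose proof (bcoef_pos nu (S n)). pose proof (lt_0_INR (S n) ltac:(lia)).
        pose proof (lt_0_INR (S nu + n) ltac:(lia)). field. repeat split; lra. }
      assert (P : 0 < / INR (S n)) by (apply Rinv_0_lt_compat, lt_0_INR; lia).
      assert (Q : 0 < / INR (S nu + n)) by (apply Rinv_0_lt_compat, lt_0_INR; lia).
      assert (Q1 : / INR (S nu + n) <= 1).
      { rewrite <- Rinv_1. apply Rinv_le_contravar; [lra|].
        rewrite plus_INR, S_INR. pose proof (pos_INR nu). pose proof (pos_INR n). lra. }
      rewrite E, Rabs_pos_eq; nra.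
    + apply is_lim_seq_const.
    + apply (is_lim_seq_incr_1 (fun n => / INR n)).
      replace (Finite 0) with (Rbar_inv p_infty) by reflexivity.
      apply is_lim_seq_inv; [apply is_lim_seq_INR|discriminate].
Qed.

Lemma bcoef_ex (nu : nat) (y : R) : ex_pseries (bcoef nu) y.
Proof. apply CV_radius_inside. rewrite bcoef_radius. exact I. Qed.

(** The entire function left when [(x/2)^nu] is factored out of the Bessel function, with
    [y = (x/2)^2]. In this variable differentiation just raises the index. *)
Definition bseries (nu : nat) (y : R) : R := PSeries (bcoef nu) y.

Lemma bseries_derive (nu : nat) (y : R) : is_derive (bseries nu) y (bseries (S nu) y).
Proof.
  unfold bseries. rewrite <- (PSeries_ext (PS_derive (bcoef nu))).
  - apply is_derive_PSeries. rewrite bcoef_radius. exact I.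
  - intros m. unfold PS_derive. apply bcoef_S.
Qed.

(** Coefficientwise, [bcoef nu m = (nu + 1 + m) bcoef (nu + 1) m]; the part with the factor [m] is
    the coefficient of index [m - 1] of the series of index [nu + 2], hence the factor [y]. *)
Lemma bseries_rec (nu : nat) (y : R) : bseries nu y = INR (S nu) * bseries (S nu) y + y * bseries (S (S nu)) y.
Proof.
  unfold bseries. rewrite <- PSeries_incr_1, <- PSeries_scal.
  rewrite <- PSeries_plus.
  - apply PSeries_ext. intros m. unfold PS_plus, PS_scal, PS_incr_1, scal, plus; simpl.
    unfold mult; simpl. rewrite <- (bcoef_S' nu m). destruct m as [|m].
    + rewrite Nat.add_0_r. change (match nu with 0%nat => 1 | S _ => INR nu + 1 end) with (INR (S nu)).
      unfold zero; simpl. ring.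
    + rewrite <- (bcoef_S (S nu) m).
      change (match nu with 0%nat => 1 | S _ => INR nu + 1 end) with (INR (S nu)).
      rewrite plus_INR. ring.
  - apply (ex_pseries_scal (V := R_NormedModule)); [apply Rmult_comm|apply bcoef_ex].
  - apply ex_pseries_incr_1, bcoef_ex.
Qed.

Lemma Bessel_cv (nu : nat) (x : R) :
  Un_cv (fun M => sum_f_R0 (fun m => (x / 2) ^ (2 * m + nu)
                     / (INR (fact m) * INR (fact (nu + m)))) M)
    ((x / 2) ^ nu * bseries nu ((x / 2) ^ 2)).
Proof.
  apply is_lim_seq_Reals.
  pose proof (PSeries_correct _ _ (bcoef_ex nu ((x / 2) ^ 2))) as H.
  unfold is_pseries, is_series in H.
  apply (is_lim_seq_scal_l _ ((x / 2) ^ nu) (bseries nu ((x / 2) ^ 2))) in H.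
  eapply is_lim_seq_ext; [|exact H].
  intros M. cbv beta. rewrite sum_n_Reals. rewrite scal_sum. apply sum_eq.
  intros m _. rewrite pow_n_pow. change (scal (((x / 2) ^ 2) ^ m) (bcoef nu m)) with (((x / 2) ^ 2) ^ m * bcoef nu m).
  rewrite pow_add, (pow_mult (x / 2)). unfold bcoef, Rdiv. ring.
Qed.

Lemma Bessel_bseries (nu : nat) (x : R) : Bessel_I nu x = (x / 2) ^ nu * bseries nu ((x / 2) ^ 2).
Proof. apply lim_unique, Bessel_cv. Qed.

Lemma Bessel_pos (nu : nat) (x : R) : 0 < x -> 0 < Bessel_I nu x.
Proof.
  intros Hx. set (t := fun m => (x / 2) ^ (2 * m + nu) / (INR (fact m) * INR (fact (nu + m)))).
  assert (Ht : forall m, 0 < t m).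
  { intros m. apply Rdiv_lt_0_compat; [pos|].
    apply Rmult_lt_0_compat; apply fact_pos. }
  apply Rlt_le_trans with (t 0%nat); [apply Ht|].
  assert (Hle : Rbar_le (t 0%nat) (Bessel_I nu x)); [|exact Hle].
  apply (is_lim_seq_le (fun _ => t 0%nat) (sum_f_R0 t)).
  - intros M. induction M; simpl; [lra|]. pose proof (Ht (S M)). lra.
  - apply is_lim_seq_const.
  - apply is_lim_seq_Reals. rewrite Bessel_bseries. apply Bessel_cv.
Qed.

Lemma Bessel_00 : Bessel_I 0 0 = 1.
Proof.
  rewrite Bessel_bseries. replace ((0 / 2) ^ 2) with 0 by field. unfold bseries. rewrite PSeries_0.
  unfold bcoef. simpl. field.
Qed.

Lemma Bessel_S0 (nu : nat) : Bessel_I (S nu) 0 = 0.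
Proof. rewrite Bessel_bseries. simpl. unfold Rdiv. ring. Qed.

Lemma Bessel_nonneg (nu : nat) (x : R) : 0 <= x -> 0 <= Bessel_I nu x.
Proof.
  intros [H|<-]; [left; apply Bessel_pos, H|].
  destruct nu; [rewrite Bessel_00; lra|rewrite Bessel_S0; lra].
Qed.

Lemma Bessel_rec (nu : nat) (x : R) :
  x * Bessel_I nu x = 2 * INR (S nu) * Bessel_I (S nu) x + x * Bessel_I (S (S nu)) x.
Proof.
  rewrite !Bessel_bseries, (bseries_rec nu). simpl pow.
  unfold Rdiv. field.
Qed.

(** Written with [pred nu] instead of a division by [x], it stays valid at [0]; the mass of a box is
    followed from [s = 0] onwards. *)
Lemma Bessel_derive_aux (nu : nat) (x : R) :
  is_derive (Bessel_I nu) x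
    (INR nu / 2 * (x / 2) ^ (pred nu) * bseries nu ((x / 2) ^ 2) + Bessel_I (S nu) x).
Proof.
  apply (is_derive_ext (fun x => (x / 2) ^ nu * bseries nu ((x / 2) ^ 2))).
  { intros; symmetry; apply Bessel_bseries. }
  evar_last.
  { apply (derive_mult (fun x => (x / 2) ^ nu) (fun x => bseries nu ((x / 2) ^ 2))).
    - apply (is_derive_pow (fun x => x / 2)). auto_derive; [auto|reflexivity].
    - apply (derive_comp (bseries nu) (fun x => (x / 2) ^ 2)); [apply bseries_derive|].
      auto_derive; [auto|reflexivity]. }
  rewrite (Bessel_bseries (S nu)). unfold mult; simpl. field.
Qed.

Lemma Bessel_derive (nu : nat) (x : R) : 0 < x ->
  is_derive (Bessel_I nu) x (Bessel_I (S nu) x + INR nu / x * Bessel_I nu x).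
Proof.
  intros Hx. evar_last; [apply Bessel_derive_aux|].
  rewrite (Bessel_bseries nu). destruct nu; simpl pred; [simpl; field; lra|].
  simpl pow. field. lra.
Qed.

Lemma Bessel_derive_0 (x : R) : is_derive (Bessel_I 0) x (Bessel_I 1 x).
Proof. evar_last; [apply Bessel_derive_aux|]. simpl. field. Qed.

Lemma Bessel_derive_S (nu : nat) (x : R) :
  is_derive (Bessel_I (S nu)) x ((Bessel_I nu x + Bessel_I (S (S nu)) x) / 2).
Proof.
  evar_last; [apply Bessel_derive_aux|].
  rewrite (Bessel_bseries nu), (bseries_rec nu), (Bessel_bseries (S (S nu))). simpl pred. simpl pow. field.
Qed.

(** * Ratios of consecutive Bessel functions *)

Definition ratio (k : nat) (x : R) : R := Bessel_I (S k) x / Bessel_I k x.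

Lemma ratio_pos (k : nat) (x : R) : 0 < x -> 0 < ratio k x.
Proof. intros H. apply Rdiv_lt_0_compat; apply Bessel_pos, H. Qed.

Lemma ratio_rec (k : nat) (x : R) : 0 < x -> ratio k x * (x * ratio (S k) x + 2 * INR (S k)) = x.
Proof.
  intros H. pose proof (Bessel_pos k x H) as A. pose proof (Bessel_pos (S k) x H) as B.
  pose proof (Bessel_rec k x) as E.
  unfold ratio. apply Rmult_eq_reg_r with (Bessel_I k x); [|lra]. rewrite E. field. lra.
Qed.

(** The quotient rule produces [I_{k+2}], and the three-term recurrence eliminates it, which closes
    the equation in [ratio k] alone. *)
Lemma ratio_derive (k : nat) (x : R) : 0 < x ->
  is_derive (ratio k) x (1 - (2 * INR k + 1) / x * ratio k x - ratio k x ^ 2).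
Proof.
  intros H. pose proof (Bessel_pos k x H) as A.
  pose proof (Bessel_rec k x) as E.
  evar_last.
  { apply (is_derive_div (Bessel_I (S k)) (Bessel_I k)); [apply Bessel_derive, H|apply Bessel_derive, H|lra]. }
  unfold ratio.
  assert (E2 : Bessel_I (S (S k)) x = Bessel_I k x - 2 * INR (S k) / x * Bessel_I (S k) x).
  { apply Rmult_eq_reg_l with x; [|lra].
    replace (x * Bessel_I (S (S k)) x) with (x * Bessel_I k x - 2 * INR (S k) * Bessel_I (S k) x) by lra.
    field. lra. }
  rewrite E2, S_INR. field. lra.
Qed.

Lemma ratio_le_lin (k : nat) (x : R) : 0 < x -> ratio k x <= x / (2 * INR (S k)).
Proof.
  intros H. pose proof (ratio_rec k x H) as E. pose proof (ratio_pos k x H). pose proof (ratio_pos (S k) x H).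
  pose proof (lt_0_INR (S k) ltac:(lia)) as Hk. apply (Rle_div_r (ratio k x)); [lra|].
  assert (0 < ratio k x * (x * ratio (S k) x)) by pos.
  lra.
Qed.

(* The square of the negative part of [d] has derivative [2 min(d,0) d' <= 0]. *)
Lemma barrier (d dd : R -> R) (a : R) :
  (forall x, a <= x -> is_derive d x (dd x)) -> 0 <= d a ->
  (forall x, a <= x -> d x < 0 -> 0 <= dd x) ->
  forall x, a <= x -> 0 <= d x.
Proof.
  intros Hd Ha Hb x Hx.
  set (m := fun y => Rmin y 0 ^ 2).
  assert (Hm : forall y, is_derive m y (2 * Rmin y 0)).
  { intros y. destruct (Rtotal_order y 0) as [Hy|[Hy|Hy]].
    - apply (is_derive_ext_loc (fun y => y ^ 2)).
      + exists (mkposreal (- y) ltac:(lra)). intros z Hz. apply Rabs_lt_between' in Hz.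
        simpl in Hz. unfold m. rewrite Rmin_left by lra. reflexivity.
      + rewrite Rmin_left by lra. auto_derive; [auto|ring].
    - subst y. rewrite Rmin_left, Rmult_0_r by lra. apply is_derive_Reals.
      intros eps Heps. exists (mkposreal eps Heps). intros h Hh Hhe. simpl in Hhe.
      unfold m. rewrite Rplus_0_l, (Rmin_left 0 0) by lra.
      replace ((Rmin h 0 ^ 2 - 0 ^ 2) / h - 0) with (Rmin h 0 * (Rmin h 0 / h)) by (field; lra).
      rewrite Rabs_mult. apply Rle_lt_trans with (Rabs h); [|exact Hhe].
      unfold Rmin; destruct (Rle_dec h 0).
      + replace (h / h) with 1 by (field; lra). rewrite Rabs_R1. lra.
      + rewrite Rabs_R0, Rmult_0_l. apply Rabs_pos.
    - apply (is_derive_ext_loc (fun y => 0)).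
      + exists (mkposreal y Hy). intros z Hz. apply Rabs_lt_between' in Hz.
        simpl in Hz. unfold m. rewrite Rmin_right by lra. simpl; ring.
      + rewrite Rmin_right by lra. rewrite Rmult_0_r. apply derive_const. }
  destruct (mvt (fun x => m (d x)) (fun x => dd x * (2 * Rmin (d x) 0)) a x) as [c [Hc E]].
  - intros z Hz. rewrite Rmin_left in Hz by lra.
    apply (derive_comp m d z); [apply Hm|apply Hd; lra].
  - rewrite Rmin_left in Hc by lra.
    assert (m (d a) = 0) by (unfold m; rewrite Rmin_right by lra; ring).
    assert (dd c * (2 * Rmin (d c) 0) <= 0).
    { unfold Rmin; destruct (Rle_dec (d c) 0) as [[Hn|Hn]|Hn].
      - pose proof (Hb c ltac:(lra) Hn). nra.
      - rewrite Hn. lra.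
      - lra. }
    assert (m (d x) <= 0) by nra.
    apply Rnot_lt_le. intros Hneg. unfold m in *. rewrite Rmin_left in H1 by lra. nra.
Qed.

(** Up to [x = 1] the linear bound suffices; beyond, the constant [1] is a barrier, since above it
    the Riccati right-hand side [1 - (2k+1) h/x - h^2] is negative. *)
Lemma ratio_le_1 (k : nat) (x : R) : 0 < x -> ratio k x <= 1.
Proof.
  intros H. destruct (Rle_dec x 1) as [H1|H1].
  - eapply Rle_trans; [apply ratio_le_lin, H|]. apply Rle_div_l; rewrite S_INR; pose proof (pos_INR k); lra.
  - cut (0 <= 1 - ratio k x); [lra|].
    apply (barrier (fun x => 1 - ratio k x)
      (fun x => - (1 - (2 * INR k + 1) / x * ratio k x - ratio k x ^ 2)) 1); [| | |lra].
    + intros y Hy. evar_last.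
      { apply derive_minus; [apply derive_const|].
        apply ratio_derive. lra. }
      ring.
    + assert (ratio k 1 <= 1); [|lra].
      eapply Rle_trans; [apply ratio_le_lin; lra|]. apply Rle_div_l; rewrite S_INR; pose proof (pos_INR k); lra.
    + intros y Hy Hn.
      assert (0 <= (2 * INR k + 1) / y * ratio k y); [|nra].
      apply Rmult_le_pos; [|left; apply ratio_pos; lra].
      pos.
Qed.

(** The right-hand side of the Riccati equation, that is, the derivative of [ratio k]. *)
Definition ratio1 (k : nat) (x : R) : R := 1 - (2 * INR k + 1) / x * ratio k x - ratio k x ^ 2.

(** The singular coefficient [(2k+1)/x] is harmless: [ratio k x <= x/(2k+2)] bounds its product with
    the ratio by [1], uniformly in [k] and [x]. *)
Lemma ratio1_bound (k : nat) (x : R) : 0 < x -> -1 <= ratio1 k x <= 1.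
Proof.
  intros H. unfold ratio1. pose proof (ratio_le_lin k x H). pose proof (ratio_pos k x H). pose proof (ratio_le_1 k x H).
  pose proof (pos_INR k).
  assert ((2 * INR k + 1) / x * ratio k x <= 1).
  { replace ((2 * INR k + 1) / x * ratio k x) with ((2 * INR k + 1) * (ratio k x / x)) by (field; lra).
    rewrite S_INR in H0.
    assert (ratio k x / x <= / (2 * (INR k + 1))).
    { apply Rle_div_l; [lra|]. rewrite Rmult_comm. exact H0. }
    apply Rle_trans with ((2 * INR k + 1) * / (2 * (INR k + 1))).
    - apply Rmult_le_compat_l; lra.
    - apply Rle_div_l; lra. }
  assert (0 <= (2 * INR k + 1) / x * ratio k x) by pos.
  nra.
Qed.

(* With [p = h_k/x = 1/(x h_{k+1} + 2k + 2)] one has [p' = h_{k+1} p - x p^2], so [|p'| <= p <= 1/(2k+2)]. *)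
Lemma ratio2_bound (k : nat) (x : R) : 0 < x ->
  exists l, is_derive (ratio1 k) x l /\ Rabs l <= 3.
Proof.
  intros H. pose proof (ratio_derive k x H) as D. fold (ratio1 k x) in D.
  exists (- (2 * INR k + 1) * ((ratio1 k x * x - ratio k x) / x ^ 2) - 2 * ratio k x * ratio1 k x). split.
  - apply (is_derive_ext_loc (fun x => 1 - (2 * INR k + 1) * (ratio k x / x) - ratio k x ^ 2)).
    { exists (mkposreal x H). intros z Hz. apply Rabs_lt_between' in Hz. simpl in Hz. unfold ratio1.
      change (1 - (2 * INR k + 1) * (ratio k z / z) - ratio k z ^ 2 = 1 - (2 * INR k + 1) / z * ratio k z - ratio k z ^ 2). field. lra. }
    evar_last.
    { apply derive_minus.
      - apply derive_minus; [apply derive_const|].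
        apply (is_derive_scal (fun x => ratio k x / x)).
        apply (is_derive_div (ratio k) (fun x => x)); [exact D|apply (is_derive_id (K := R_AbsRing))|lra].
      - apply (is_derive_pow (ratio k) 2 x _ D). }
    unfold minus, plus, opp, zero, one; simpl. field. lra.
  - pose proof (ratio1_bound k x H). pose proof (ratio_pos k x H). pose proof (ratio_le_1 k x H).
    pose proof (ratio_pos (S k) x H). pose proof (ratio_le_1 (S k) x H). pose proof (pos_INR k).
    pose proof (ratio_rec k x H) as E. rewrite S_INR in E.
    set (h := ratio k x) in *. set (g := ratio (S k) x) in *. set (p := h / x).
    assert (Hh : h = x * p) by (unfold p; field; lra).
    assert (Hp : 0 < p) by nra.
    assert (Ep : p * (x * g + 2 * (INR k + 1)) = 1) by nra.
    assert (E' : (ratio1 k x * x - h) / x ^ 2 = g * p - h * p).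
    { unfold ratio1. fold h. apply Rmult_eq_reg_r with x; [|lra].
      replace ((1 - (2 * INR k + 1) / x * h - h ^ 2) * x - h) with
        (x * (1 - 2 * (INR k + 1) * p - h ^ 2)) by (unfold p; field; lra).
      replace (1 - 2 * (INR k + 1) * p) with (p * (x * g)) by lra.
      rewrite Hh. field. lra. }
    rewrite E'.
    assert (Hp2 : (2 * INR k + 1) * p <= 1) by nra.
    set (q := (2 * INR k + 1) * p) in *.
    assert (0 <= q) by (apply Rmult_le_pos; lra).
    replace (- (2 * INR k + 1) * (g * p - h * p)) with (- q * (g - h)) by (unfold q; ring).
    assert (-1 <= q * (g - h) <= 1) by nra.
    assert (-1 <= h * ratio1 k x <= 1) by nra.
    apply Rabs_le. split; lra.
Qed.

(** * Moments of the increments *)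

(** Sum over the box [[-M, M]] of a function of [|k|]; the law of the increments is symmetric, so
    every nonzero value counts twice. *)
Fixpoint wsum (M : nat) (g : nat -> R) : R :=
  match M with O => g O | S M' => wsum M' g + 2 * g (S M') end.

Lemma wsum_ext (M : nat) (g h : nat -> R) : (forall k, g k = h k) -> wsum M g = wsum M h.
Proof. intros H. induction M; simpl; rewrite ?IHM, !H; reflexivity. Qed.

Lemma wsum_le (M : nat) (g h : nat -> R) : (forall k, g k <= h k) -> wsum M g <= wsum M h.
Proof. intros H. induction M; simpl; [apply H|]. pose proof (H (S M)). lra. Qed.

Lemma wsum_plus (M : nat) (g h : nat -> R) : wsum M (fun k => g k + h k) = wsum M g + wsum M h.
Proof. induction M; simpl; [reflexivity|]. rewrite IHM. ring. Qed.

Lemma wsum_scal (M : nat) (c : R) (g : nat -> R) : wsum M (fun k => c * g k) = c * wsum M g.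
Proof. induction M; simpl; [reflexivity|]. rewrite IHM. ring. Qed.

Lemma wsum_0 (M : nat) : wsum M (fun _ => 0) = 0.
Proof. induction M; simpl; lra. Qed.

Lemma wsum_nonneg (M : nat) (g : nat -> R) : (forall k, 0 <= g k) -> 0 <= wsum M g.
Proof. intros H. rewrite <- (wsum_0 M). apply wsum_le, H. Qed.

Lemma wsum_incr (M N : nat) (g : nat -> R) : (forall k, 0 <= g k) -> (M <= N)%nat -> wsum M g <= wsum N g.
Proof.
  intros H HMN. induction HMN; [lra|]. simpl. pose proof (H (S m)). lra.
Qed.

Lemma wsum_term (M : nat) (g : nat -> R) : (forall k, 0 <= g k) -> g M <= wsum M g.
Proof.
  intros H. destruct M; simpl; [lra|]. pose proof (H (S M)). pose proof (wsum_nonneg M g H). lra.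
Qed.

Lemma wsum_derive (M : nat) (g dg : nat -> R -> R) (x : R) :
  (forall k, is_derive (g k) x (dg k x)) ->
  is_derive (fun x => wsum M (fun k => g k x)) x (wsum M (fun k => dg k x)).
Proof.
  intros H. induction M; simpl; [apply H|].
  apply derive_plus; [exact IHM|].
  apply (is_derive_scal (g (S M))), H.
Qed.

Lemma Zbox_S (M : nat) :
  Zbox (S M) = (- Z.of_nat (S M))%Z :: Zbox M ++ Z.of_nat (S M) :: nil.
Proof.
  unfold Zbox. replace (2 * S M + 1)%nat with (S (2 * M + 1 + 1)) by lia.
  cbn [seq map]. rewrite seq_app, map_app, <- seq_shift, map_map. cbn [seq map app].
  f_equal. f_equal; [apply map_ext; intros; lia|]. f_equal. lia.
Qed.

Lemma sumL_app (l l' : list R) : sumL (l ++ l') = sumL l + sumL l'.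
Proof. unfold sumL. induction l; simpl; [ring|]. rewrite IHl. ring. Qed.

Lemma sumL_Zbox (M : nat) (g : nat -> R) :
  sumL (map (fun k => g (Z.abs_nat k)) (Zbox M)) = wsum M g.
Proof.
  induction M.
  - unfold Zbox. simpl. ring.
  - rewrite Zbox_S. cbn [map]. rewrite map_app.
    change (sumL (?a :: ?l)) with (a + sumL l). rewrite sumL_app, IHM.
    change (sumL (map ?f (?z :: nil))) with (f z + 0).
    replace (Z.abs_nat (- Z.of_nat (S M))) with (S M) by lia.
    replace (Z.abs_nat (Z.of_nat (S M))) with (S M) by lia. cbn [wsum]. ring.
Qed.

Definition pmf (k : nat) (s : R) : R := exp (- s) * Bessel_I k s.

Lemma pmf_nonneg (k : nat) (s : R) : 0 <= s -> 0 <= pmf k s.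
Proof. intros H. apply Rmult_le_pos; [left; apply exp_pos|apply Bessel_nonneg, H]. Qed.

Lemma pmf_pos (k : nat) (s : R) : 0 < s -> 0 < pmf k s.
Proof. intros H. apply Rmult_lt_0_compat; [apply exp_pos|apply Bessel_pos, H]. Qed.

Lemma pmf_rec (k : nat) (s : R) : s * pmf k s = 2 * INR (S k) * pmf (S k) s + s * pmf (S (S k)) s.
Proof.
  unfold pmf. transitivity (exp (- s) * (s * Bessel_I k s)); [ring|]. rewrite (Bessel_rec k s). ring.
Qed.

(** Forward equation of the simple random walk in continuous time at unit rate; for [k = 0] both
    neighbours have the mass [pmf 1]. Unlike the form with the score, it makes sense at [s = 0]. *)
Definition dpmf (k : nat) (s : R) : R :=
  match k with O => pmf 1 s - pmf 0 s | S j => (pmf j s + pmf (S (S j)) s) / 2 - pmf (S j) s end.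

Lemma exp_opp_derive (s : R) : is_derive (fun s => exp (- s)) s (- exp (- s)).
Proof. auto_derive; [auto|ring]. Qed.

Lemma pmf_derive (k : nat) (s : R) : is_derive (pmf k) s (dpmf k s).
Proof.
  unfold pmf. destruct k as [|k]; evar_last.
  - apply (derive_mult (fun s => exp (- s)) (Bessel_I 0));
      [apply exp_opp_derive|apply Bessel_derive_0].
  - unfold dpmf, pmf, plus, mult; simpl; field.
  - apply (derive_mult (fun s => exp (- s)) (Bessel_I (S k)));
      [apply exp_opp_derive|apply Bessel_derive_S].
  - unfold dpmf, pmf, plus, mult; simpl; field.
Qed.

(** The summands are a discrete Laplacian, so the sum telescopes to the flux through the boundary of
    the box. *)
Lemma wsum_dpmf (M : nat) (s : R) : wsum M (fun k => dpmf k s) = pmf (S M) s - pmf M s.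
Proof. induction M; simpl; [reflexivity|]. rewrite IHM. field. Qed.

Lemma pmf_decr (k : nat) (s : R) : 0 <= s -> pmf (S k) s <= pmf k s.
Proof.
  intros [H|<-].
  - pose proof (ratio_le_1 k s H). unfold ratio in H0. pose proof (Bessel_pos k s H).
    apply Rle_div_l  in H0; [|lra]. apply Rmult_le_compat_l; [left; apply exp_pos|lra].
  - unfold pmf. rewrite Bessel_S0, Rmult_0_r.
    apply Rmult_le_pos; [left; apply exp_pos|apply Bessel_nonneg; lra].
Qed.

Lemma wsum_pmf_0 (M : nat) : wsum M (fun k => pmf k 0) = 1.
Proof.
  unfold pmf. rewrite Ropp_0, exp_0.
  induction M; simpl wsum; [rewrite Bessel_00; ring|]. rewrite IHM, Bessel_S0. ring.
Qed.

(** At [s = 0] the walk sits at the origin and the box holds all the mass; afterwards mass is lost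
    only by the flux at the boundary, evaluated at an intermediate time [c]. *)
Lemma mass_mvt (M : nat) (s : R) : 0 <= s ->
  exists c, 0 <= c <= s /\ 1 - wsum M (fun k => pmf k s) = (pmf M c - pmf (S M) c) * s.
Proof.
  intros H.
  destruct (mvt (fun x => wsum M (fun k => pmf k x)) (fun x => wsum M (fun k => dpmf k x)) 0 s) as [c [Hc E]].
  - intros x _. apply (wsum_derive M pmf dpmf). intros; apply pmf_derive.
  - rewrite Rmin_left, Rmax_right in Hc by lra. exists c. split; [exact Hc|].
    rewrite wsum_pmf_0, wsum_dpmf in E. lra.
Qed.

Lemma mass_le_1 (M : nat) (s : R) : 0 <= s -> wsum M (fun k => pmf k s) <= 1.
Proof.
  intros H. destruct (mass_mvt M s H) as [c [Hc E]]. pose proof (pmf_decr M c ltac:(lra)). nra.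
Qed.

Lemma stein (g : R -> R) (M : nat) (s : R) : g 0 = 0 -> g (-1) = - g 1 ->
  wsum M (fun k => g (INR k) * INR k * pmf k s) =
  s / 2 * wsum M (fun k => (g (INR k + 1) - g (INR k - 1)) * pmf k s)
  - s * (g (INR M) * pmf (S M) s + g (INR M + 1) * pmf M s).
Proof.
  intros H0 H1. induction M.
  - simpl wsum. simpl INR. rewrite Rplus_0_l, H0. replace (0 - 1) with (-1) by ring. rewrite H1. field.
  - cbn [wsum]. rewrite IHM. pose proof (pmf_rec M s) as E. rewrite S_INR in *.
    replace (INR M + 1 - 1) with (INR M) by ring.
    assert (E2 : g (INR M + 1) * (s * pmf M s) =
       g (INR M + 1) * (2 * (INR M + 1) * pmf (S M) s + s * pmf (S (S M)) s)) by (rewrite E; reflexivity).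
    lra.
Qed.

Lemma stein_pow_le (j : nat) (M : nat) (s : R) : 0 <= s ->
  wsum M (fun k => INR k ^ (S (S (2 * j))) * pmf k s) <=
  s / 2 * wsum M (fun k => ((INR k + 1) ^ (S (2 * j)) - (INR k - 1) ^ (S (2 * j))) * pmf k s).
Proof.
  intros H. pose proof (stein (fun x => x ^ S (2 * j)) M s) as E.
  rewrite (wsum_ext M _ (fun k => INR k ^ S (2 * j) * INR k * pmf k s)).
  - rewrite E.
    + assert (0 <= s * (INR M ^ S (2 * j) * pmf (S M) s + (INR M + 1) ^ S (2 * j) * pmf M s)); [|lra].
      pose proof (pos_INR M).
      apply Rmult_le_pos; [lra|]. apply Rplus_le_le_0_compat; apply Rmult_le_pos;
        try apply pmf_nonneg; try apply pow_le; lra.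
    + simpl; ring.
    + rewrite pow_1_odd, pow1. ring.
  - intros k. rewrite <- (tech_pow_Rmult _ (S (2 * j))). ring.
Qed.

Definition moment (j M : nat) (s : R) : R := wsum M (fun k => INR k ^ j * pmf k s).

Lemma moment0 (M : nat) (s : R) : moment 0 M s = wsum M (fun k => pmf k s).
Proof. apply wsum_ext. intros; simpl; ring. Qed.

Lemma moment2_le (M : nat) (s : R) : 0 <= s -> moment 2 M s <= s.
Proof.
  intros H. pose proof (stein_pow_le 0 M s H) as E. change (S (S (2 * 0))) with 2%nat in E.
  rewrite (wsum_ext M (fun k => (_ - _) * _) (fun k => 2 * pmf k s)) in E by (intros; simpl; ring).
  rewrite wsum_scal in E. pose proof (mass_le_1 M s H). unfold moment. nra.
Qed.

Lemma moment4_le (M : nat) (s : R) : 0 <= s -> moment 4 M s <= 3 * s ^ 2 + s.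
Proof.
  intros H. pose proof (stein_pow_le 1 M s H) as E. change (S (S (2 * 1))) with 4%nat in E.
  rewrite (wsum_ext M (fun k => (_ - _) * _) (fun k => 6 * (INR k ^ 2 * pmf k s) + 2 * pmf k s)) in E
    by (intros; simpl; ring).
  rewrite wsum_plus, !wsum_scal in E. pose proof (mass_le_1 M s H). pose proof (moment2_le M s H).
  unfold moment in *. nra.
Qed.

Lemma moment6_le (M : nat) (s : R) : 0 <= s -> moment 6 M s <= 15 * s ^ 3 + 15 * s ^ 2 + s.
Proof.
  intros H. pose proof (stein_pow_le 2 M s H) as E. change (S (S (2 * 2))) with 6%nat in E.
  rewrite (wsum_ext M (fun k => (_ - _) * _)
    (fun k => 10 * (INR k ^ 4 * pmf k s) + (20 * (INR k ^ 2 * pmf k s) + 2 * pmf k s))) in E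
    by (intros; simpl; ring).
  rewrite !wsum_plus, !wsum_scal in E.
  pose proof (mass_le_1 M s H). pose proof (moment2_le M s H). pose proof (moment4_le M s H).
  unfold moment in *. eapply Rle_trans; [exact E|].
  apply Rle_trans with (s / 2 * (10 * (3 * s ^ 2 + s) + (20 * s + 2 * 1))); [|right; field].
  apply Rmult_le_compat_l; lra.
Qed.

(** Positive powers of a nonnegative integer increase with the exponent. Odd absolute moments are
    thereby bounded by even ones and remain [O(s)] as [s -> 0]. *)
Lemma moment_le_mono (i j M : nat) (s : R) : 0 <= s -> (1 <= i <= j)%nat -> moment i M s <= moment j M s.
Proof.
  intros H Hij. apply wsum_le. intros k. apply Rmult_le_compat_r; [apply pmf_nonneg, H|].
  destruct k.
  - simpl INR. rewrite !pow_i by lia. lra.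
  - apply Rle_pow; [|lia]. rewrite S_INR. pose proof (pos_INR k). lra.
Qed.

Lemma pmf_decay (M : nat) (s : R) : 0 <= s -> INR M ^ 6 * pmf M s <= 15 * s ^ 3 + 15 * s ^ 2 + s.
Proof.
  intros H. eapply Rle_trans; [|apply (moment6_le M s H)].
  apply (wsum_term M (fun k => INR k ^ 6 * pmf k s)). intros k.
  apply Rmult_le_pos; [apply pow_le, pos_INR|apply pmf_nonneg, H].
Qed.

Lemma inv_INR_lim : is_lim_seq (fun M => / INR (S M)) 0.
Proof.
  apply (is_lim_seq_incr_1 (fun n => / INR n)).
  replace (Finite 0) with (Rbar_inv p_infty) by reflexivity.
  apply is_lim_seq_inv; [apply is_lim_seq_INR|discriminate].
Qed.

Lemma lim0_of_bound (u : nat -> R) (C : R) :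
  (forall M, 0 <= u (S M) <= C / INR (S M)) -> is_lim_seq u 0.
Proof.
  intros H. apply is_lim_seq_incr_1.
  apply is_lim_seq_le_le with (fun _ => 0) (fun M => C * / INR (S M)).
  - intros M. apply H.
  - apply is_lim_seq_const.
  - replace (Finite 0) with (Rbar_mult C 0) by (simpl; f_equal; ring).
    apply is_lim_seq_scal_l, inv_INR_lim.
Qed.

Lemma pow_pmf_lim (j : nat) (s : R) : 0 <= s -> (j <= 5)%nat ->
  is_lim_seq (fun M => (INR M + 1) ^ j * pmf M s) 0.
Proof.
  (* The [32] is [2^5], from [x + 1 <= 2 x] for [x >= 1]; the sixth moment leaves one spare factor
     [1/x]. *)
  intros H Hj. apply lim0_of_bound with (32 * (15 * s ^ 3 + 15 * s ^ 2 + s)). intros M.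
  set (x := INR (S M)). assert (Hx : 1 <= x) by (unfold x; rewrite S_INR; pose proof (pos_INR M); lra).
  pose proof (pmf_nonneg (S M) s H) as Hp.
  split; [pos|].
  apply le_div; [lra|].
  apply Rle_trans with (32 * (x ^ 6 * pmf (S M) s)).
  - replace (32 * (x ^ 6 * pmf (S M) s)) with ((2 * x) ^ 5 * pmf (S M) s * x) by ring.
    apply Rmult_le_compat_r; [lra|]. apply Rmult_le_compat_r; [exact Hp|].
    apply Rle_trans with ((2 * x) ^ j); [apply pow_incr; lra|apply Rle_pow; [lra|exact Hj]].
  - apply Rmult_le_compat_l; [lra|]. apply pmf_decay, H.
Qed.

Lemma pmf_lim (s : R) : 0 <= s -> is_lim_seq (fun M => pmf M s) 0.
Proof.
  intros H. eapply is_lim_seq_ext; [|apply (pow_pmf_lim 0 s H); lia]. intros; simpl; ring.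
Qed.

Lemma stein_bdry_lim (j : nat) (s : R) : 0 <= s -> (j <= 5)%nat ->
  is_lim_seq (fun M => s * (INR M ^ j * pmf (S M) s + (INR M + 1) ^ j * pmf M s)) 0.
Proof.
  intros H Hj.
  apply is_lim_seq_le_le with (fun _ => 0) (fun M => 2 * s * ((INR M + 1) ^ j * pmf M s)).
  - intros M. pose proof (pos_INR M). pose proof (pmf_nonneg (S M) s H).
    pose proof (pmf_decr M s H).
    assert (0 <= INR M ^ j) by pos.
    assert (INR M ^ j <= (INR M + 1) ^ j) by (apply pow_incr; lra).
    assert (INR M ^ j * pmf (S M) s <= (INR M + 1) ^ j * pmf M s) by nra.
    split; [pos|].
    replace (2 * s * ((INR M + 1) ^ j * pmf M s)) with (s * (2 * ((INR M + 1) ^ j * pmf M s))) by ring.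
    apply Rmult_le_compat_l; lra.
  - apply is_lim_seq_const.
  - replace (Finite 0) with (Rbar_mult (2 * s) 0) by (simpl; f_equal; ring).
    apply is_lim_seq_scal_l, pow_pmf_lim; assumption.
Qed.

Lemma mass_lim (s : R) : 0 <= s -> is_lim_seq (fun M => moment 0 M s) 1.
Proof.
  intros H.
  apply is_lim_seq_ext with (fun M => 1 - (1 - wsum M (fun k => pmf k s))).
  { intros M. rewrite moment0. ring. }
  replace (Finite 1) with (Finite (1 - 0)) by (f_equal; ring).
  apply is_lim_seq_minus'; [apply is_lim_seq_const|].
  apply lim0_of_bound with (s * (15 * s ^ 3 + 15 * s ^ 2 + s)). intros M.
  split; [pose proof (mass_le_1 (S M) s H); lra|].
  (* The time [c] varies with [M], so the decay bound at [c] is replaced by its value at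
     [s >= c]. *)
  destruct (mass_mvt (S M) s H) as [c [Hc E]]. rewrite E.
  set (x := INR (S M)). assert (Hx : 1 <= x) by (unfold x; rewrite S_INR; pose proof (pos_INR M); lra).
  apply le_div; [lra|].
  pose proof (pmf_nonneg (S M) c ltac:(lra)). pose proof (pmf_nonneg (S (S M)) c ltac:(lra)).
  pose proof (pmf_decay (S M) c ltac:(lra)) as B. fold x in B.
  assert (x * pmf (S M) c <= x ^ 6 * pmf (S M) c).
  { apply Rmult_le_compat_r; [assumption|]. rewrite <- (pow_1 x) at 1. apply Rle_pow; [lra|lia]. }
  assert (c ^ 2 <= s ^ 2) by nra.
  assert (c ^ 3 <= s ^ 3) by nra.
  assert (x * (pmf (S M) c - pmf (S (S M)) c) <= 15 * s ^ 3 + 15 * s ^ 2 + s) by nra.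
  nra.
Qed.

Lemma moment2_lim (s : R) : 0 <= s -> is_lim_seq (fun M => moment 2 M s) s.
Proof.
  intros H.
  apply is_lim_seq_ext with (fun M => s * moment 0 M s
     - s * (INR M ^ 1 * pmf (S M) s + (INR M + 1) ^ 1 * pmf M s)).
  - intros M. unfold moment. rewrite (wsum_ext M (fun k => _ ^ 2 * _) (fun k => INR k * INR k * pmf k s))
      by (intros; ring).
    rewrite (stein (fun x => x) M s) by ring.
    rewrite (wsum_ext M (fun k => (_ - _) * _) (fun k => 2 * (INR k ^ 0 * pmf k s))) by (intros; ring).
    rewrite wsum_scal. field.
  - replace (Finite s) with (Finite (s * 1 - 0)) by (f_equal; ring).
    apply is_lim_seq_minus'; [|apply stein_bdry_lim; [assumption|lia]].
    apply (is_lim_seq_scal_l _ s 1), mass_lim, H.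
Qed.

Lemma moment4_lim (s : R) : 0 <= s -> is_lim_seq (fun M => moment 4 M s) (3 * s ^ 2 + s).
Proof.
  intros H.
  apply is_lim_seq_ext with (fun M => (3 * s * moment 2 M s + s * moment 0 M s)
     - s * (INR M ^ 3 * pmf (S M) s + (INR M + 1) ^ 3 * pmf M s)).
  - intros M. unfold moment. rewrite (wsum_ext M (fun k => _ ^ 4 * _) (fun k => INR k ^ 3 * INR k * pmf k s))
      by (intros; ring).
    rewrite (stein (fun x => x ^ 3) M s) by ring.
    rewrite (wsum_ext M (fun k => (_ - _) * _)
      (fun k => 6 * (INR k ^ 2 * pmf k s) + 2 * (INR k ^ 0 * pmf k s))) by (intros; ring).
    rewrite wsum_plus, !wsum_scal. field.
  - replace (3 * s ^ 2 + s) with (3 * s * s + s * 1 - 0) by ring.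
    apply is_lim_seq_minus'; [|apply stein_bdry_lim; [assumption|lia]].
    apply is_lim_seq_plus'.
    + apply (is_lim_seq_scal_l _ (3 * s) s), moment2_lim, H.
    + apply (is_lim_seq_scal_l _ s 1), mass_lim, H.
Qed.

(* [score] and [score1] are the first two derivatives of [s |-> log (pmf k s)]. *)
Definition score (k : nat) (s : R) : R := INR k / s + ratio k s - 1.
Definition score1 (k : nat) (s : R) : R := - INR k / s ^ 2 + ratio1 k s.

Lemma pmf_derive_score (k : nat) (s : R) : 0 < s -> is_derive (pmf k) s (pmf k s * score k s).
Proof.
  intros H. unfold pmf at 1. pose proof (Bessel_pos k s H). evar_last.
  { apply (derive_mult (fun s => exp (- s)) (Bessel_I k));
      [apply exp_opp_derive|apply Bessel_derive, H]. }
  unfold pmf, score, ratio, plus, mult; simpl. field. lra.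
Qed.

Lemma dpmf_score (k : nat) (s : R) : 0 < s -> dpmf k s = pmf k s * score k s.
Proof.
  intros H. rewrite <- (is_derive_unique _ _ _ (pmf_derive k s)).
  apply is_derive_unique, pmf_derive_score, H.
Qed.

Lemma score_derive (k : nat) (s : R) : 0 < s -> is_derive (score k) s (score1 k s).
Proof.
  intros H. unfold score. evar_last.
  { apply derive_minus; [|apply derive_const].
    apply (derive_plus (fun s => INR k / s) (ratio k)); [|apply ratio_derive, H].
    auto_derive; [lra|reflexivity]. }
  unfold score1, ratio1, minus, plus, opp, zero; simpl. field. lra.
Qed.

Lemma ln_pmf_derive (k : nat) (s : R) : 0 < s -> is_derive (fun s => ln (pmf k s)) s (score k s).
Proof.
  intros H. pose proof (pmf_pos k s H). evar_last.
  { apply (derive_comp ln (pmf k)); [apply is_derive_Reals, derivable_pt_lim_ln, H0|].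
    apply pmf_derive_score, H. }
  field. lra.
Qed.

Lemma wsum_score (M : nat) (s : R) : 0 < s -> wsum M (fun k => pmf k s * score k s) = pmf (S M) s - pmf M s.
Proof.
  intros H. rewrite <- wsum_dpmf. apply wsum_ext. intros; symmetry; apply dpmf_score, H.
Qed.

Lemma pmf_score_derive (k : nat) (s : R) : 0 < s ->
  is_derive (fun s => pmf k s * score k s) s (pmf k s * (score k s ^ 2 + score1 k s)).
Proof.
  intros H. evar_last.
  { apply (derive_mult (pmf k) (score k)); [apply pmf_derive_score, H|apply score_derive, H]. }
  ring.
Qed.

(** Both sides are derivatives of the same function of [s], by [wsum_score], so no new summation is
    done. In the limit this is the information identity [E score1 = - E score^2]. *)
Lemma wsum_score1 (M : nat) (s : R) : 0 < s ->
  wsum M (fun k => pmf k s * (score k s ^ 2 + score1 k s)) = pmf (S M) s * score (S M) s - pmf M s * score M s.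
Proof.
  intros H.
  rewrite <- (is_derive_unique (fun s => wsum M (fun k => pmf k s * score k s)) s
    (wsum M (fun k => pmf k s * (score k s ^ 2 + score1 k s)))).
  - apply is_derive_unique. apply (is_derive_ext_loc (fun s => pmf (S M) s - pmf M s)).
    + exists (mkposreal s H). intros z Hz. apply Rabs_lt_between' in Hz. simpl in Hz.
      symmetry; apply wsum_score; lra.
    + apply derive_minus; apply pmf_derive_score, H.
  - apply (wsum_derive M (fun k s => pmf k s * score k s) (fun k s => pmf k s * (score k s ^ 2 + score1 k s))).
    intros; apply pmf_score_derive, H.
Qed.

Lemma score_bound (k : nat) (s : R) : 0 < s -> -1 <= score k s - INR k / s <= 0.
Proof. intros H. unfold score. pose proof (ratio_pos k s H). pose proof (ratio_le_1 k s H). lra. Qed.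

Lemma score1_bound (k : nat) (s : R) : 0 < s -> -1 <= score1 k s + INR k / s ^ 2 <= 1.
Proof.
  intros H. unfold score1. pose proof (ratio1_bound k s H).
  replace (- INR k / s ^ 2 + ratio1 k s + INR k / s ^ 2) with (ratio1 k s) by (field; lra). lra.
Qed.

Lemma div_INR_nonneg (k : nat) (s : R) : 0 < s -> 0 <= INR k / s.
Proof. intros H. pos. Qed.

Lemma score_abs (k : nat) (s : R) : 0 < s -> Rabs (score k s) <= INR k / s + 1.
Proof.
  intros H. pose proof (score_bound k s H). pose proof (div_INR_nonneg k s H). apply Rabs_le. lra.
Qed.

Lemma score_sqr_le (k : nat) (s : R) : 0 < s -> score k s ^ 2 <= 2 * (INR k ^ 2 / s ^ 2 + 1).
Proof.
  intros H. pose proof (score_abs k s H) as A. rewrite <- pow2_abs.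
  apply Rle_trans with ((INR k / s + 1) ^ 2); [apply pow_incr; split; [apply Rabs_pos|exact A]|].
  replace (INR k ^ 2 / s ^ 2) with ((INR k / s) ^ 2) by (field; lra).
    set (x := INR k / s). pose proof (pow2_ge_0 (x - 1)). lra.
Qed.

Lemma pmf_score_lim (s : R) : 0 < s -> is_lim_seq (fun M => pmf M s * score M s) 0.
Proof.
  intros H. apply is_lim_seq_abs_0.
  apply is_lim_seq_le_le with (fun _ => 0) (fun M => (/ s + 1) * ((INR M + 1) ^ 1 * pmf M s)).
  - intros M. split; [apply Rabs_pos|]. rewrite Rabs_mult, (Rabs_pos_eq (pmf M s))
      by (apply pmf_nonneg; lra).
    pose proof (score_abs M s H). pose proof (pmf_pos M s H).
    assert (INR M / s + 1 <= (/ s + 1) * (INR M + 1)).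
    { pose proof (pos_INR M). pose proof (Rinv_0_lt_compat s H). unfold Rdiv. nra. }
    rewrite pow_1. nra.
  - apply is_lim_seq_const.
  - replace (Finite 0) with (Rbar_mult (/ s + 1) 0) by (simpl; f_equal; ring).
    apply is_lim_seq_scal_l, pow_pmf_lim; [lra|lia].
Qed.

Lemma E_score_lim (s : R) : 0 < s -> is_lim_seq (fun M => wsum M (fun k => pmf k s * score k s)) 0.
Proof.
  intros H. apply is_lim_seq_ext with (fun M => pmf (S M) s - pmf M s).
  - intros; symmetry; apply wsum_score, H.
  - replace (Finite 0) with (Finite (0 - 0)) by (f_equal; ring).
    apply is_lim_seq_minus'; [apply (is_lim_seq_incr_1 (fun M => pmf M s))|]; apply pmf_lim; lra.
Qed.

(** * Fisher information *)

Definition fisherM (M : nat) (s : R) : R := wsum M (fun k => pmf k s * score k s ^ 2).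
Definition fisher (s : R) : R := lim (fun M => fisherM M s).

Lemma pmf_score2_nonneg (k : nat) (s : R) : 0 < s -> 0 <= pmf k s * score k s ^ 2.
Proof. intros H. apply Rmult_le_pos; [left; apply pmf_pos, H|apply pow2_ge_0]. Qed.

Lemma fisherM_le (M : nat) (s : R) : 0 < s -> fisherM M s <= 2 / s + 2.
Proof.
  intros H. unfold fisherM.
  apply Rle_trans with (wsum M (fun k => 2 / s ^ 2 * (INR k ^ 2 * pmf k s) + 2 * pmf k s)).
  - apply wsum_le. intros k. pose proof (score_sqr_le k s H). pose proof (pmf_pos k s H).
    replace (2 / s ^ 2 * (INR k ^ 2 * pmf k s) + 2 * pmf k s)
      with (pmf k s * (2 * (INR k ^ 2 / s ^ 2 + 1))) by (field; lra).
    apply Rmult_le_compat_l; lra.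
  - rewrite wsum_plus, !wsum_scal. pose proof (mass_le_1 M s ltac:(lra)).
    pose proof (moment2_le M s ltac:(lra)). unfold moment in H1.
    assert (0 < 2 / s ^ 2) by pos.
    replace (2 / s) with (2 / s ^ 2 * s) by (field; lra). nra.
Qed.

Lemma fisherM_lim (s : R) : 0 < s -> is_lim_seq (fun M => fisherM M s) (fisher s).
Proof.
  intros H.
  destruct (ex_finite_lim_seq_incr (fun M => fisherM M s) (2 / s + 2)) as [l Hl].
  - intros M. unfold fisherM. simpl. pose proof (pmf_score2_nonneg (S M) s H). lra.
  - intros M. apply fisherM_le, H.
  - unfold fisher. rewrite (lim_unique _ l); [exact Hl|]. apply is_lim_seq_Reals, Hl.
Qed.

Lemma E_score1_lim (s : R) : 0 < s -> is_lim_seq (fun M => wsum M (fun k => pmf k s * score1 k s)) (- fisher s).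
Proof.
  intros H. apply is_lim_seq_ext with
    (fun M => pmf (S M) s * score (S M) s - pmf M s * score M s - fisherM M s).
  - intros M. rewrite <- wsum_score1 by exact H. unfold fisherM.
    replace (wsum M (fun k => pmf k s * (score k s ^ 2 + score1 k s)))
      with (wsum M (fun k => pmf k s * score k s ^ 2) + wsum M (fun k => pmf k s * score1 k s)); [ring|].
    rewrite <- wsum_plus. apply wsum_ext. intros; ring.
  - replace (- fisher s) with (0 - 0 - fisher s) by ring.
    apply is_lim_seq_minus'; [|apply fisherM_lim, H].
    apply is_lim_seq_minus'; [apply (is_lim_seq_incr_1 (fun M => pmf M s * score M s))|];
      apply pmf_score_lim, H.
Qed.

Lemma fisher_ge (M : nat) (s : R) : 0 < s -> fisherM M s <= fisher s.
Proof.
  intros H. assert (Hle : Rbar_le (fisherM M s) (fisher s)); [|exact Hle].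
  apply (is_lim_seq_le_loc (fun _ => fisherM M s) (fun N => fisherM N s));
    [|apply is_lim_seq_const|apply fisherM_lim, H].
  exists M. intros N HN. apply wsum_incr; [intros; apply pmf_score2_nonneg, H|exact HN].
Qed.

Lemma fisher_le (s B : R) (M0 : nat) : 0 < s -> (forall M, (M0 <= M)%nat -> fisherM M s <= B) -> fisher s <= B.
Proof.
  intros H HB. assert (Hle : Rbar_le (fisher s) B); [|exact Hle].
  apply (is_lim_seq_le_loc (fun M => fisherM M s) (fun _ => B)); [|apply fisherM_lim, H|apply is_lim_seq_const].
  exists M0. exact HB.
Qed.

Lemma fisher_pos (s : R) : 0 < s -> 0 < fisher s.
Proof.
  (* A single atom suffices: for [k >= 2 s] the score is at least [1]. *)
  intros H. destruct (INR_unbounded (2 * s)) as [k Hk].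
  apply Rlt_le_trans with (fisherM k s); [|apply fisher_ge, H].
  apply Rlt_le_trans with (pmf k s * score k s ^ 2).
  - apply Rmult_lt_0_compat; [apply pmf_pos, H|]. apply pow_lt.
    unfold score. pose proof (ratio_pos k s H). assert (2 <= INR k / s); [|lra].
    apply le_div; lra.
  - apply (wsum_term k (fun k => pmf k s * score k s ^ 2)). intros; apply pmf_score2_nonneg, H.
Qed.

(** The score is [k/s] up to an error in [[-1, 0]], so for small [s] the quantity [s E score^2] is
    close to [E k^2 / s = 1]. The difference is at most [2 E|k| + s], and [E|k| <= E k^2 <= s] for
    integers. *)
Lemma fisher_small (s : R) : 0 < s -> Rabs (s * fisher s - 1) <= 3 * s.
Proof.
  intros H.
  assert (L : is_lim_seq (fun M => Rabs (s * fisherM M s - / s * moment 2 M s)) (Rabs (s * fisher s - 1))).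
  { apply (is_lim_seq_abs _ (s * fisher s - 1)).
    replace 1 with (/ s * s) by (field; lra).
    apply is_lim_seq_minus'.
    - apply (is_lim_seq_scal_l _ s (fisher s)), fisherM_lim, H.
    - apply (is_lim_seq_scal_l _ (/ s) s), moment2_lim; lra. }
  assert (Hle : Rbar_le (Rabs (s * fisher s - 1)) (3 * s)); [|exact Hle].
  apply (is_lim_seq_le _ (fun _ => 3 * s)) with (2 := L); [|apply is_lim_seq_const].
  intros M. unfold fisherM, moment. rewrite <- !wsum_scal.
  pose proof (mass_le_1 M s ltac:(lra)) as H0. pose proof (moment2_le M s ltac:(lra)) as H2.
  pose proof (moment_le_mono 1 2 M s ltac:(lra) ltac:(lia)) as H1. unfold moment in H1, H2.
  assert (P : forall k, - (2 * (INR k ^ 1 * pmf k s) + s * pmf k s)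
     <= s * (pmf k s * score k s ^ 2) + -1 * (/ s * (INR k ^ 2 * pmf k s))
     <= 2 * (INR k ^ 1 * pmf k s) + s * pmf k s).
  { intros k. pose proof (pmf_pos k s H) as Hp. pose proof (score_bound k s H) as Hb.
    set (d := score k s - INR k / s) in *.
    replace (s * (pmf k s * score k s ^ 2) + -1 * (/ s * (INR k ^ 2 * pmf k s))) with
      (pmf k s * (2 * INR k * d + s * d ^ 2)) by (unfold d; field; lra).
    pose proof (pos_INR k). rewrite pow_1.
    assert (0 <= d ^ 2 <= 1) by nra.
    split.
    - replace (- (2 * (INR k * pmf k s) + s * pmf k s)) with (pmf k s * (- (2 * INR k) - s)) by ring.
      apply Rmult_le_compat_l; nra.
    - replace (2 * (INR k * pmf k s) + s * pmf k s) with (pmf k s * (2 * INR k + s)) by ring.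
      apply Rmult_le_compat_l; nra. }
  set (A := wsum M (fun k => s * (pmf k s * score k s ^ 2))). set (B := wsum M (fun k => / s * (INR k ^ 2 * pmf k s))).
  assert (E : A - B = wsum M (fun k => s * (pmf k s * score k s ^ 2) + -1 * (/ s * (INR k ^ 2 * pmf k s)))).
  { unfold A, B. rewrite wsum_plus, (wsum_scal M (-1)). ring. }
  rewrite E.
  assert (heat : wsum M (fun k => 2 * (INR k ^ 1 * pmf k s) + s * pmf k s) <= 3 * s).
  { rewrite wsum_plus, !wsum_scal. nra. }
  apply Rabs_le. split.
  - apply Rle_trans with (wsum M (fun k => -1 * (2 * (INR k ^ 1 * pmf k s) + s * pmf k s))).
    + rewrite wsum_scal. lra.
    + apply wsum_le. intros k. specialize (P k). lra.
  - eapply Rle_trans; [|exact heat]. apply wsum_le. intros k. apply P.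
Qed.

(** Beyond [M] one has [1 <= k^2 / M], and [E k^2 score^2] is finite by the fourth moment. The
    explicit rate is locally uniform in [s], which is what continuity of [fisher] needs. *)
Lemma fisher_tail (M : nat) (s : R) : 0 < s -> (1 <= M)%nat ->
  fisher s <= fisherM M s + 2 * (3 + / s + s) / INR M.
Proof.
  intros H HM. assert (HM1 : 1 <= INR M) by (apply (le_INR 1); exact HM).
  apply fisher_le with M; [exact H|]. intros N HN.
  assert (T : forall N, (M <= N)%nat -> fisherM N s - fisherM M s <=
     / INR M * wsum N (fun k => INR k ^ 2 * (pmf k s * score k s ^ 2))).
  { intros N' HN'. induction HN'.
    - unfold Rminus. rewrite Rplus_opp_r. apply Rmult_le_pos; [pos|].
      apply wsum_nonneg. intros k. apply Rmult_le_pos; [apply pow2_ge_0|apply pmf_score2_nonneg, H].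
    - unfold fisherM in *. cbn [wsum].
      pose proof (pmf_score2_nonneg (S m) s H).
      assert (1 <= / INR M * INR (S m) ^ 2).
      { assert (INR M <= INR (S m)) by (apply le_INR; lia).
        rewrite Rmult_comm. apply le_div; [lra|]. nra. }
      set (q := pmf (S m) s * score (S m) s ^ 2) in *. set (x := INR (S m) ^ 2) in *.
      replace (/ INR M * (wsum m (fun k => INR k ^ 2 * (pmf k s * score k s ^ 2)) + 2 * (x * q)))
        with (/ INR M * wsum m (fun k => INR k ^ 2 * (pmf k s * score k s ^ 2)) + 2 * ((/ INR M * x) * q)) by ring.
      nra. }
  specialize (T N HN).
  assert (wsum N (fun k => INR k ^ 2 * (pmf k s * score k s ^ 2)) <= 2 * (3 + / s + s)).
  { apply Rle_trans with (wsum N (fun k => 2 / s ^ 2 * (INR k ^ 4 * pmf k s) + 2 * (INR k ^ 2 * pmf k s))).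
    - apply wsum_le. intros k. pose proof (score_sqr_le k s H). pose proof (pmf_pos k s H).
      replace (2 / s ^ 2 * (INR k ^ 4 * pmf k s) + 2 * (INR k ^ 2 * pmf k s)) with
        (INR k ^ 2 * (pmf k s * (2 * (INR k ^ 2 / s ^ 2 + 1)))) by (field; lra).
      apply Rmult_le_compat_l; [apply pow2_ge_0|]. apply Rmult_le_compat_l; lra.
    - rewrite wsum_plus, !wsum_scal. pose proof (moment2_le N s ltac:(lra)). pose proof (moment4_le N s ltac:(lra)).
      unfold moment in *. replace (2 * (3 + / s + s)) with (2 / s ^ 2 * (3 * s ^ 2 + s) + 2 * s) by (field; lra).
      apply Rplus_le_compat; [|lra]. apply Rmult_le_compat_l; [|lra].
      pos. }
  assert (0 < / INR M) by pos. unfold Rdiv. nra.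
Qed.

Lemma fisherM_continuous (M : nat) (s : R) : 0 < s -> continuous (fun s => fisherM M s) s.
Proof.
  intros H. apply derive_continuous. unfold fisherM.
  exists (wsum M (fun k => (fun k s => pmf k s * score k s * score k s ^ 2
     + pmf k s * (2 * score k s * score1 k s)) k s)).
  apply (wsum_derive M (fun k s => pmf k s * score k s ^ 2)
    (fun k s => pmf k s * score k s * score k s ^ 2 + pmf k s * (2 * score k s * score1 k s))).
  intros k. evar_last.
  { apply (derive_mult (pmf k) (fun s => score k s ^ 2)); [apply pmf_derive_score, H| ].
    apply (is_derive_pow (score k) 2), score_derive, H. }
  unfold plus, mult; simpl. ring.
Qed.

Lemma fisher_continuous (s : R) : 0 < s -> continuous fisher s.
Proof.
  intros H. apply filterlim_locally. intros eps.
  (* [C] dominates the constant of [fisher_tail] for all parameters between [s/2] and [2 s]. *)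
  set (C := 2 * (3 + 2 / s + 2 * s)).
  assert (HC : 0 < C) by (unfold C; assert (0 < 2 / s) by pos; lra).
  destruct (INR_unbounded (4 * C / eps + 1)) as [M HM].
  pose proof (cond_pos eps) as He.
  assert (0 < 4 * C / eps) by pos.
  assert (HM1 : (1 <= M)%nat) by (apply INR_le; simpl; lra).
  assert (HCM : C / INR M <= eps / 4).
  { apply div_le; [lra|]. assert (C = 4 * C / eps * (eps / 4)) by (field; lra). nra. }
  assert (T : forall x, s / 2 < x < 2 * s -> 0 <= fisher x - fisherM M x <= eps / 4).
  { intros x Hx. pose proof (fisher_ge M x ltac:(lra)). pose proof (fisher_tail M x ltac:(lra) HM1).
    assert (2 * (3 + / x + x) / INR M <= C / INR M); [|lra].
    apply Rmult_le_compat_r; [pos|].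
    assert (/ x <= 2 / s); [|unfold C; lra].
    replace (2 / s) with (/ (s / 2)) by (field; lra). apply Rinv_le_contravar; lra. }
  pose proof (fisherM_continuous M s H) as Hc.
  apply filterlim_locally with (eps := mkposreal (eps / 4) ltac:(lra)) in Hc.
  assert (Hl : locally s (fun x => s / 2 < x < 2 * s)).
  { exists (mkposreal (s / 2) ltac:(lra)). intros x Hx. apply Rabs_lt_between' in Hx. simpl in Hx. lra. }
  generalize (filter_and _ _ Hc Hl). apply filter_imp. intros x [H1 H2].
  apply Rabs_lt_between' in H1. simpl in H1. pose proof (T x H2). pose proof (T s ltac:(lra)).
  apply Rabs_lt_between'. lra.
Qed.

Lemma phiD_fisher (th D : R) : phiD th D = fisher (th * D).
Proof.
  unfold phiD, fisher. f_equal. apply functional_extensionality. intros M.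
  unfold fisherM. rewrite <- sumL_Zbox. f_equal. apply map_ext. intros k.
  unfold fD, hD, pmf, score, ratio. rewrite INR_IZR_INZ, Zabs2Nat.id_abs.
  f_equal. f_equal. ring.
Qed.

(** * Lindeberg's method *)

Section SumL.
Context {A : Type}.
Implicit Types (l : list A) (f g : A -> R).

Lemma sumL_ext l f g : (forall a, f a = g a) -> sumL (map f l) = sumL (map g l).
Proof. intros H. f_equal. apply map_ext, H. Qed.

Lemma sumL_plus l f g : sumL (map (fun a => f a + g a) l) = sumL (map f l) + sumL (map g l).
Proof. induction l; simpl; [ring|]. unfold sumL in *. rewrite IHl. ring. Qed.

Lemma sumL_scal l c f : sumL (map (fun a => c * f a) l) = c * sumL (map f l).
Proof. induction l; simpl; [ring|]. unfold sumL in *. rewrite IHl. ring. Qed.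

Lemma sumL_le l f g : (forall a, f a <= g a) -> sumL (map f l) <= sumL (map g l).
Proof. intros H. induction l; simpl; [lra|]. unfold sumL in *. pose proof (H a). lra. Qed.

Lemma sumL_const l c : sumL (map (fun _ => c) l) = INR (length l) * c.
Proof.
  induction l as [|a l IH]; [simpl; ring|]. cbn [map length]. rewrite S_INR.
  change (sumL (?x :: ?y)) with (x + sumL y). rewrite IH. ring.
Qed.

Lemma sumL_abs l f : Rabs (sumL (map f l)) <= sumL (map (fun a => Rabs (f a)) l).
Proof.
  induction l as [|a l IH]; cbn [map].
  - simpl. rewrite Rabs_R0. lra.
  - change (sumL (?x :: ?y)) with (x + sumL y). eapply Rle_trans; [apply Rabs_triang|]. lra.
Qed.
End SumL.

Definition ssum (f : Z -> R) (Y : list Z) : R := sumL (map f Y).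

Lemma ssum_cons (f : Z -> R) (k : Z) (Y : list Z) : ssum f (k :: Y) = f k + ssum f Y.
Proof. reflexivity. Qed.

Lemma boxsum_ext (n M : nat) (g h : list Z -> R) :
  (forall Y, length Y = n -> g Y = h Y) -> boxsum n M g = boxsum n M h.
Proof.
  revert g h. induction n; simpl; intros g h H; [apply H; reflexivity|].
  apply sumL_ext. intros k. apply IHn. intros Y HY. apply H. simpl; congruence.
Qed.

Lemma boxsum_plus (n M : nat) (g h : list Z -> R) :
  boxsum n M (fun Y => g Y + h Y) = boxsum n M g + boxsum n M h.
Proof.
  revert g h. induction n; simpl; intros g h; [reflexivity|].
  rewrite <- sumL_plus. apply sumL_ext. intros k. apply IHn.
Qed.

Lemma boxsum_scal (n M : nat) (c : R) (g : list Z -> R) :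
  boxsum n M (fun Y => c * g Y) = c * boxsum n M g.
Proof.
  revert g. induction n; simpl; intros g; [reflexivity|].
  rewrite <- sumL_scal. apply sumL_ext. intros k. apply IHn.
Qed.

Lemma boxsum_le (n M : nat) (g h : list Z -> R) :
  (forall Y, length Y = n -> g Y <= h Y) -> boxsum n M g <= boxsum n M h.
Proof.
  revert g h. induction n; simpl; intros g h H; [apply H; reflexivity|].
  apply sumL_le. intros k. apply IHn. intros Y HY. apply H. simpl; congruence.
Qed.

Definition prodp (p : Z -> R) (Y : list Z) : R := fold_right Rmult 1 (map p Y).
(** Expectations restricted to the box, for weights of mass at most one: constants shrink by powers
    of the mass, so that identities for independent sums become inequalities. *)
Definition EZ (M : nat) (p : Z -> R) (g : Z -> R) : R := sumL (map (fun k => p k * g k) (Zbox M)).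
Definition EZn (n M : nat) (p : Z -> R) (g : list Z -> R) : R :=
  boxsum n M (fun Y => prodp p Y * g Y).

Section Expectation.
Variables (M : nat) (p : Z -> R).
Hypothesis p_nonneg : forall k, 0 <= p k.
Hypothesis p_mass : EZ M p (fun _ => 1) <= 1.

Lemma EZ_ext g h : (forall k, g k = h k) -> EZ M p g = EZ M p h.
Proof. intros H. apply sumL_ext. intros; rewrite H; reflexivity. Qed.

Lemma EZ_plus g h : EZ M p (fun k => g k + h k) = EZ M p g + EZ M p h.
Proof. unfold EZ. rewrite <- sumL_plus. apply sumL_ext. intros; ring. Qed.

Lemma EZ_scal c g : EZ M p (fun k => c * g k) = c * EZ M p g.
Proof. unfold EZ. rewrite <- sumL_scal. apply sumL_ext. intros; ring. Qed.

Lemma EZ_const c : EZ M p (fun _ => c) = c * EZ M p (fun _ => 1).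
Proof. rewrite <- EZ_scal. apply EZ_ext. intros; ring. Qed.

Lemma EZ_le g h : (forall k, g k <= h k) -> EZ M p g <= EZ M p h.
Proof. intros H. apply sumL_le. intros k. apply Rmult_le_compat_l; auto. Qed.

Lemma EZ_nonneg g : (forall k, 0 <= g k) -> 0 <= EZ M p g.
Proof.
  intros H. replace 0 with (EZ M p (fun _ => 0)) by (rewrite EZ_const; ring). apply EZ_le, H.
Qed.

Lemma EZ_abs g : Rabs (EZ M p g) <= EZ M p (fun k => Rabs (g k)).
Proof.
  eapply Rle_trans; [apply sumL_abs|]. right. apply sumL_ext. intros k.
  rewrite Rabs_mult, (Rabs_pos_eq (p k)); auto.
Qed.

Lemma EZ_dist g h c : (forall k, Rabs (g k - h k) <= c) -> Rabs (EZ M p g - EZ M p h) <= c.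
Proof.
  intros H. replace (EZ M p g - EZ M p h) with (EZ M p (fun k => g k + -1 * h k))
    by (rewrite EZ_plus, (EZ_scal (-1) h); ring).
  assert (0 <= c) by (eapply Rle_trans; [apply Rabs_pos|apply (H 0%Z)]).
  eapply Rle_trans; [apply EZ_abs|]. apply Rle_trans with (EZ M p (fun _ => c)).
  - apply EZ_le. intros k. replace (g k + -1 * h k) with (g k - h k) by ring. apply H.
  - rewrite EZ_const. nra.
Qed.

Lemma prodp_nonneg Y : 0 <= prodp p Y.
Proof. unfold prodp. induction Y; simpl; [lra|]. apply Rmult_le_pos; auto. Qed.

Lemma EZn_ext n g h : (forall Y, length Y = n -> g Y = h Y) -> EZn n M p g = EZn n M p h.
Proof. intros H. apply boxsum_ext. intros; rewrite H; auto. Qed.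

Lemma EZn_plus n g h : EZn n M p (fun Y => g Y + h Y) = EZn n M p g + EZn n M p h.
Proof. unfold EZn. rewrite <- boxsum_plus. apply boxsum_ext. intros; ring. Qed.

Lemma EZn_scal n c g : EZn n M p (fun Y => c * g Y) = c * EZn n M p g.
Proof. unfold EZn. rewrite <- boxsum_scal. apply boxsum_ext. intros; ring. Qed.

Lemma EZn_le n g h : (forall Y, length Y = n -> g Y <= h Y) -> EZn n M p g <= EZn n M p h.
Proof. intros H. apply boxsum_le. intros Y HY. apply Rmult_le_compat_l; [apply prodp_nonneg|auto]. Qed.

Lemma EZn_O g : EZn 0 M p g = g nil.
Proof. unfold EZn, prodp. simpl. ring. Qed.

Lemma EZn_S n g : EZn (S n) M p g = EZ M p (fun k => EZn n M p (fun Y => g (k :: Y))).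
Proof.
  unfold EZn, EZ. apply sumL_ext. intros k. rewrite <- boxsum_scal.
  apply boxsum_ext. intros. unfold prodp. simpl. ring.
Qed.

Lemma EZn_const n c : EZn n M p (fun _ => c) = c * EZ M p (fun _ => 1) ^ n.
Proof.
  induction n; [rewrite EZn_O; simpl; ring|].
  rewrite EZn_S. rewrite (EZ_ext _ _ (fun _ => IHn)), EZ_const. simpl. ring.
Qed.

Lemma EZ_1_nonneg : 0 <= EZ M p (fun _ => 1).
Proof. apply EZ_nonneg. intros; lra. Qed.

Lemma pow_le_1 (x : R) (n : nat) : 0 <= x <= 1 -> 0 <= x ^ n <= 1.
Proof.
  intros H. split; [pos|]. rewrite <- (pow1 n). apply pow_incr. lra.
Qed.

Lemma EZn_const_le n c : 0 <= c -> 0 <= EZn n M p (fun _ => c) <= c.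
Proof.
  intros H. rewrite EZn_const. pose proof EZ_1_nonneg.
  pose proof (pow_le_1 (EZ M p (fun _ => 1)) n ltac:(lra)). nra.
Qed.

Lemma EZn_nonneg n g : (forall Y, length Y = n -> 0 <= g Y) -> 0 <= EZn n M p g.
Proof.
  intros H. eapply Rle_trans; [apply (EZn_const_le n 0); lra|]. apply EZn_le, H.
Qed.

Lemma EZn_ssum_le n xi : (forall k, 0 <= xi k) -> 0 <= EZn n M p (ssum xi) <= INR n * EZ M p xi.
Proof.
  intros H. assert (P : forall Y, 0 <= ssum xi Y).
  { induction Y; [unfold ssum; simpl; lra|]. rewrite ssum_cons. pose proof (H a). lra. }
  split; [apply EZn_nonneg; auto|].
  pose proof (EZ_nonneg xi H) as HE.
  induction n; [rewrite EZn_O; unfold ssum; simpl; lra|].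
  rewrite EZn_S, S_INR.
  apply Rle_trans with (EZ M p (fun k => xi k + INR n * EZ M p xi)).
  - apply EZ_le. intros k.
    rewrite (EZn_ext n _ (fun Y => xi k + ssum xi Y)) by (intros; apply ssum_cons).
    rewrite EZn_plus. pose proof (EZn_const_le n (xi k) (H k)). lra.
  - rewrite EZ_plus, EZ_const. 
    assert (0 <= INR n * EZ M p xi) by pos.
    assert (INR n * EZ M p xi * EZ M p (fun _ => 1) <= INR n * EZ M p xi * 1) by nra.
    lra.
Qed.

Lemma EZn_ssum n xi : Rabs (EZn n M p (ssum xi)) <= INR n * Rabs (EZ M p xi).
Proof.
  induction n; [rewrite EZn_O; unfold ssum; simpl; rewrite Rabs_R0; lra|].
  rewrite EZn_S, S_INR.
  rewrite (EZ_ext _ (fun k => EZ M p (fun _ => 1) ^ n * xi k + EZn n M p (ssum xi))).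
  - rewrite EZ_plus, EZ_scal, (EZ_const (EZn n M p (ssum xi))). eapply Rle_trans; [apply Rabs_triang|].
    rewrite !Rabs_mult. pose proof EZ_1_nonneg as Hm. set (m := EZ M p (fun _ => 1)) in *.
    pose proof (pow_le_1 m n ltac:(lra)) as Hmn. set (mn := m ^ n) in *.
      rewrite (Rabs_pos_eq mn), (Rabs_pos_eq m) by lra.
    pose proof (Rabs_pos (EZ M p xi)). pose proof (Rabs_pos (EZn n M p (ssum xi))). nra.
  - intros k. rewrite (EZn_ext n _ (fun Y => xi k + ssum xi Y)) by (intros; apply ssum_cons).
    rewrite EZn_plus, EZn_const. ring.
Qed.

(** Truncation leaves a nonzero mean, so the cross terms survive; they are absorbed by the second
    summand, which vanishes as [M -> oo] when [xi] is centred in the limit. *)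
Lemma EZn_ssum_sqr n xi :
  EZn n M p (fun Y => ssum xi Y ^ 2) <=
  INR n * EZ M p (fun k => xi k ^ 2) + INR n ^ 2 * EZ M p xi ^ 2.
Proof.
  pose proof (EZ_nonneg (fun k => xi k ^ 2) ltac:(intros; apply pow2_ge_0)) as HV.
  induction n; [rewrite EZn_O; unfold ssum; simpl; lra|].
  rewrite EZn_S, S_INR. set (m := EZ M p (fun _ => 1)) in *.
  rewrite (EZ_ext _ (fun k => m ^ n * xi k ^ 2 + (2 * EZn n M p (ssum xi) * xi k
     + EZn n M p (fun Y => ssum xi Y ^ 2)))).
  - rewrite !EZ_plus, !EZ_scal, (EZ_const (EZn n M p (fun Y => ssum xi Y ^ 2))). fold m.
    pose proof EZ_1_nonneg as Hm. fold m in Hm. pose proof (pow_le_1 m n ltac:(lra)).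
    pose proof (EZn_ssum n xi) as HS.
    set (e := EZ M p xi) in *. set (s := EZn n M p (ssum xi)) in *.
    assert (s * e <= INR n * e ^ 2).
    { eapply Rle_trans; [apply Rle_abs|]. rewrite Rabs_mult, <- pow2_abs.
      pose proof (Rabs_pos e). nra. }
    pose proof (EZn_nonneg n (fun Y => ssum xi Y ^ 2) ltac:(intros; apply pow2_ge_0)).
    pose proof (pow2_ge_0 e). set (v := EZ M p (fun k => xi k ^ 2)) in *.
    set (b := EZn n M p (fun Y => ssum xi Y ^ 2)) in *.
    assert (m ^ n * v <= 1 * v) by nra.
    assert (b * m <= b * 1) by nra. lra.
  - intros k.
    rewrite (EZn_ext n _ (fun Y => xi k ^ 2 + (2 * xi k * ssum xi Y + ssum xi Y ^ 2)))
      by (intros; rewrite ssum_cons; ring).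
    rewrite !EZn_plus, EZn_scal, EZn_const. fold m. ring.
Qed.

Lemma EZn_markov n (Y : list Z -> R) (A : list Z -> R) c : 0 < c ->
  (forall l, length l = n -> c * A l <= Y l) -> EZn n M p A <= EZn n M p Y / c.
Proof.
  intros Hc H. apply le_div; [exact Hc|]. rewrite Rmult_comm, <- EZn_scal. apply EZn_le, H.
Qed.

End Expectation.

(** * Taylor remainders and the Gaussian solution of the heat equation *)

Section Taylor.

(** One integration by the mean value theorem, on either side of [x]. Iterated, it gives Taylor
    remainders with the constant [K], not the sharp [K / j!]. *)
Lemma growth_step (F dF : R -> R) (K x y : R) (j : nat) : 0 <= K ->
  (forall s, Rmin x y <= s <= Rmax x y -> is_derive F s (dF s)) ->
  (forall s, Rmin x y <= s <= Rmax x y -> Rabs (dF s) <= K * Rabs (s - x) ^ j) ->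
  F x = 0 -> forall s, Rmin x y <= s <= Rmax x y -> Rabs (F s) <= K * Rabs (s - x) ^ (S j).
Proof.
  intros HK HD HB H0 s Hs.
  assert (Sub : forall c, Rmin x s <= c <= Rmax x s -> Rmin x y <= c <= Rmax x y).
  { intros c. unfold Rmin, Rmax in *. repeat destruct Rle_dec; lra. }
  destruct (mvt F dF x s) as [c [Hc E]]; [intros; apply HD, Sub; assumption|].
  rewrite H0, Rminus_0_r in E. rewrite E, Rabs_mult. simpl.
  rewrite (Rmult_comm (Rabs (s - x))), <- Rmult_assoc.
  apply Rmult_le_compat_r; [apply Rabs_pos|].
  eapply Rle_trans; [apply HB, Sub, Hc|]. apply Rmult_le_compat_l; [exact HK|].
  apply pow_incr. split; [apply Rabs_pos|].
  unfold Rmin, Rmax in Hc. destruct Rle_dec; unfold Rabs; repeat destruct Rcase_abs; lra.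
Qed.

Lemma taylor2 (f f1 f2 : R -> R) (K x y : R) : 0 <= K ->
  (forall s, Rmin x y <= s <= Rmax x y ->
    is_derive f s (f1 s) /\ is_derive f1 s (f2 s) /\ Rabs (f2 s) <= K) ->
  Rabs (f y - f x - (y - x) * f1 x) <= K * Rabs (y - x) ^ 2.
Proof.
  intros HK H.
  assert (Hy : Rmin x y <= y <= Rmax x y) by (split; [apply Rmin_r|apply Rmax_r]).
  apply (growth_step (fun s => f s - f x - (s - x) * f1 x) (fun s => f1 s - f1 x) K x y 1); try assumption.
  - intros s Hs. evar_last.
    { apply (derive_minus (fun s => f s - f x) (fun s => (s - x) * f1 x) s (f1 s - 0) (f1 x)).
      - apply derive_minus; [apply (H s Hs)|apply derive_const].
      - auto_derive; [auto|ring]. }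
    ring.
  - apply (growth_step (fun s => f1 s - f1 x) f2 K x y 0); try assumption.
    + intros s Hs. evar_last.
      { apply derive_minus; [apply (H s Hs)|apply derive_const]. }
      ring.
    + intros s Hs. rewrite Rmult_1_r. apply H, Hs.
    + ring.
  - ring.
Qed.

Lemma taylor3 (f f1 f2 f3 : R -> R) (K x y : R) : 0 <= K ->
  (forall s, is_derive f s (f1 s) /\ is_derive f1 s (f2 s) /\ is_derive f2 s (f3 s) /\ Rabs (f3 s) <= K) ->
  Rabs (f y - f x - (y - x) * f1 x - (y - x) ^ 2 / 2 * f2 x) <= K * Rabs (y - x) ^ 3.
Proof.
  intros HK H.
  assert (Hy : Rmin x y <= y <= Rmax x y) by (split; [apply Rmin_r|apply Rmax_r]).
  apply (growth_step (fun s => f s - f x - (s - x) * f1 x - (s - x) ^ 2 / 2 * f2 x)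
    (fun s => f1 s - f1 x - (s - x) * f2 x) K x y 2); try assumption.
  - intros s _. evar_last.
    { apply (derive_minus (fun s => f s - f x - (s - x) * f1 x) (fun s => (s - x) ^ 2 / 2 * f2 x) s
        (f1 s - 0 - f1 x) ((s - x) * f2 x)).
      - apply (derive_minus (fun s => f s - f x) (fun s => (s - x) * f1 x)).
        + apply derive_minus; [apply H|apply derive_const].
        + auto_derive; [auto|ring].
      - apply (is_derive_ext (fun s => f2 x / 2 * (s - x) ^ 2)).
        { intros t. eq_in_R. field. }
        auto_derive; [auto|field]. }
    ring.
  - intros s Hs. eapply Rle_trans; [apply (taylor2 f1 f2 f3 K x s HK)|].
    + intros t _. split; [|split]; apply H.
    + lra.
  - field.
Qed.

End Taylor.

(* [heat tau] solves the heat equation [d/dtau heat = U''/2], so replacing one summand by the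
   corresponding increase of [tau] costs only third-order terms. *)
Definition heat (tau y : R) : R := Phi (y / sqrt tau).
Definition heat1 (tau y : R) : R := gauss_density (y / sqrt tau) / sqrt tau.
Definition heat2 (tau y : R) : R := - (y / sqrt tau) * gauss_density (y / sqrt tau) / tau.
Definition heat3 (tau y : R) : R :=
  ((y / sqrt tau) ^ 2 - 1) * gauss_density (y / sqrt tau) / (tau * sqrt tau).
Definition heat_tt (tau y : R) : R :=
  (3 * (y / sqrt tau) - (y / sqrt tau) ^ 3) * gauss_density (y / sqrt tau) / (4 * tau ^ 2).

Lemma gauss_derive (z : R) : is_derive gauss_density z (- z * gauss_density z).
Proof.
  unfold gauss_density. pose proof half_gauss_pos. rewrite sqrt_2PI.
  auto_derive; [auto|]. simpl. unfold Rdiv. field. lra.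
Qed.

Lemma sqrt_sqr (tau : R) : 0 < tau -> 0 < sqrt tau /\ sqrt tau * sqrt tau = tau.
Proof. intros H. split; [apply sqrt_lt_R0, H|apply sqrt_def; lra]. Qed.

Lemma heat_derive (tau y : R) : 0 < tau -> is_derive (heat tau) y (heat1 tau y).
Proof.
  intros H. destruct (sqrt_sqr tau H) as [Hs _]. unfold heat, heat1. evar_last.
  { apply (derive_comp Phi (fun y => y / sqrt tau)); [apply Phi_derive|].
    auto_derive; [lra|reflexivity]. }
  field. lra.
Qed.

Lemma heat1_derive (tau y : R) : 0 < tau -> is_derive (heat1 tau) y (heat2 tau y).
Proof.
  intros H. destruct (sqrt_sqr tau H) as [Hs Hq]. unfold heat1, heat2.
  apply (is_derive_ext (fun y => / sqrt tau * gauss_density (y / sqrt tau))).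
  { intros; eq_in_R; unfold Rdiv; ring. }
  evar_last.
  { apply (is_derive_scal (fun y => gauss_density (y / sqrt tau))).
    apply (derive_comp gauss_density (fun y => y / sqrt tau)); [apply gauss_derive|].
    auto_derive; [lra|reflexivity]. }
  (* The only [tau] not under a root is written as the square of its root, so that [field] works
     with [sqrt tau] alone. *)
  rewrite <- Hq at 7. field. lra.
Qed.

Lemma heat2_derive (tau y : R) : 0 < tau -> is_derive (heat2 tau) y (heat3 tau y).
Proof.
  intros H. destruct (sqrt_sqr tau H) as [Hs Hq]. unfold heat2, heat3.
  apply (is_derive_ext (fun y => - / (tau * sqrt tau) * (y * gauss_density (y / sqrt tau)))).
  { intros; eq_in_R; field; lra. }
  evar_last.
  { apply (is_derive_scal (fun y => y * gauss_density (y / sqrt tau))).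
    apply (derive_mult (fun y => y) (fun y => gauss_density (y / sqrt tau))).
    - apply (is_derive_id (K := R_AbsRing)).
    - apply (derive_comp gauss_density (fun y => y / sqrt tau)); [apply gauss_derive|].
      auto_derive; [lra|reflexivity]. }
  unfold scal, plus, one; simpl; unfold mult; simpl. field. lra.
Qed.

Lemma scaled_derive (tau y : R) : 0 < tau ->
  is_derive (fun tau => y / sqrt tau) tau (- (y / sqrt tau) / (2 * tau)).
Proof.
  intros H. destruct (sqrt_sqr tau H) as [Hs Hq]. auto_derive; [repeat split; lra|].
  rewrite <- Hq at 5. field. lra.
Qed.

Lemma heat_tau_derive (tau y : R) : 0 < tau ->
  is_derive (fun tau => heat tau y) tau (heat2 tau y / 2).
Proof.
  intros H. destruct (sqrt_sqr tau H) as [Hs Hq]. unfold heat, heat2. evar_last.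
  { apply (derive_comp Phi (fun tau => y / sqrt tau)); [apply Phi_derive|].
    apply scaled_derive, H. }
  field. lra.
Qed.

Lemma heat2_tau_derive (tau y : R) : 0 < tau ->
  is_derive (fun tau => heat2 tau y / 2) tau (heat_tt tau y).
Proof.
  intros H. destruct (sqrt_sqr tau H) as [Hs Hq].
  apply (is_derive_ext (fun tau => (- (y / sqrt tau) * gauss_density (y / sqrt tau)) * (/ (2 * tau)))).
  { intros t. eq_in_R. unfold heat2. unfold Rdiv. rewrite Rinv_mult. ring. }
  evar_last.
  { apply (derive_mult (fun tau => - (y / sqrt tau) * gauss_density (y / sqrt tau)) (fun tau => / (2 * tau))).
    - apply (derive_mult (fun tau => - (y / sqrt tau)) (fun tau => gauss_density (y / sqrt tau))).
      + apply (is_derive_opp (V := R_NormedModule)), scaled_derive, H.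
      + apply (derive_comp gauss_density (fun tau => y / sqrt tau)); [apply gauss_derive|].
        apply scaled_derive, H.
    - instantiate (1 := - / (2 * tau ^ 2)). auto_derive; [lra|field; lra]. }
  unfold heat_tt, scal, plus, opp; simpl; unfold mult; simpl.
  set (z := y / sqrt tau). field. lra.
Qed.

(** From [1 + u <= exp u] at [u = z^2/4], squared, and [sqrt (2 PI) >= 1]. It bounds the density
    times any polynomial of degree at most four, which covers the derivatives of [heat]. *)
Lemma gauss_density_bound (z : R) : 0 <= gauss_density z /\ gauss_density z * (1 + z ^ 2 / 4) ^ 2 <= 1.
Proof.
  assert (H1 : 1 <= sqrt (2 * PI)).
  { rewrite <- sqrt_1. apply sqrt_le_1_alt. pose proof PI2_1. lra. }
  assert (P : 0 < exp (- z ^ 2 / 2)) by apply exp_pos.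
  unfold gauss_density. split; [pos|].
  replace (exp (- z ^ 2 / 2) / sqrt (2 * PI) * (1 + z ^ 2 / 4) ^ 2)
    with ((exp (- z ^ 2 / 2) * (1 + z ^ 2 / 4) ^ 2) / sqrt (2 * PI)) by (field; lra).
  apply div_le; [lra|]. rewrite Rmult_1_l. eapply Rle_trans; [|exact H1].
  apply Rle_trans with (exp (- z ^ 2 / 2) * exp (z ^ 2 / 4) ^ 2).
  - apply Rmult_le_compat_l; [lra|]. apply pow_incr. pose proof (pow2_ge_0 z).
    split; [lra|]. apply exp_ineq1_le.
  - replace (exp (z ^ 2 / 4) ^ 2) with (exp (z ^ 2 / 4) * exp (z ^ 2 / 4)) by ring.
    rewrite <- !exp_plus. right. rewrite <- exp_0. f_equal. field.
Qed.

Lemma gauss_poly (z q K : R) : Rabs q <= K * (1 + z ^ 2 / 4) ^ 2 -> 0 <= K ->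
  Rabs (q * gauss_density z) <= K.
Proof.
  intros H HK. destruct (gauss_density_bound z) as [H1 H2].
  rewrite Rabs_mult, (Rabs_pos_eq (gauss_density z)) by exact H1.
  apply Rle_trans with (K * (1 + z ^ 2 / 4) ^ 2 * gauss_density z);
    [apply Rmult_le_compat_r; assumption|].
  rewrite Rmult_assoc, (Rmult_comm (_ ^ 2)). rewrite <- (Rmult_1_r K) at 2.
  apply Rmult_le_compat_l; assumption.
Qed.

(** One constant for [heat] and its four derivatives on [tau >= eps]: [(1 + 1/eps)^2] dominates the
    powers from [tau^(-1/2)] to [tau^(-2)], and [16] the polynomial factors. *)
Definition heat_bd (eps : R) : R := 16 * (1 + / eps) ^ 2.

Lemma heat_bd_bounds (eps tau : R) : 0 < eps <= tau ->
  / tau <= heat_bd eps / 16 /\ / tau ^ 2 <= heat_bd eps / 16 /\ / sqrt tau <= heat_bd eps / 16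
  /\ / (tau * sqrt tau) <= heat_bd eps / 16 /\ 1 <= heat_bd eps / 16.
Proof.
  intros H. unfold heat_bd. destruct (sqrt_sqr tau ltac:(lra)) as [Hs Hq].
  set (a := / eps).
  set (b := / sqrt tau).
  assert (E : / tau = b ^ 2) by (rewrite <- Hq, Rinv_mult; fold b; ring).
  assert (L : b ^ 2 <= a) by (rewrite <- E; apply Rinv_le_contravar; lra).
  assert (B3 : b ^ 3 <= b ^ 2 + b ^ 4) by nra.
  replace (16 * (1 + a) ^ 2 / 16) with (1 + 2 * a + a ^ 2) by field.
  replace (/ (tau * sqrt tau)) with (b ^ 3) by (rewrite Rinv_mult, E; fold b; ring).
  replace (/ tau ^ 2) with (b ^ 4) by (replace (tau ^ 2) with (tau * tau) by ring; rewrite Rinv_mult, E; ring).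
  rewrite E. repeat split; nra.
Qed.

Lemma div_bound (q d K : R) : 0 < d -> / d <= K -> forall C, Rabs q <= C -> Rabs (q / d) <= C * K.
Proof.
  intros Hd HK C HC. unfold Rdiv. pose proof (Rinv_0_lt_compat d Hd). rewrite Rabs_mult, (Rabs_pos_eq (/ d)) by lra.
  pose proof (Rabs_pos q). apply Rmult_le_compat; lra.
Qed.

Lemma heat_bounds (eps tau y : R) : 0 < eps <= tau ->
  Rabs (heat tau y) <= heat_bd eps /\ Rabs (heat1 tau y) <= heat_bd eps /\ Rabs (heat2 tau y) <= heat_bd eps
  /\ Rabs (heat3 tau y) <= heat_bd eps /\ Rabs (heat_tt tau y) <= heat_bd eps.
Proof.
  intros H. destruct (heat_bd_bounds eps tau H) as (B1 & B2 & B3 & B4 & B5).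
  destruct (sqrt_sqr tau ltac:(lra)) as [Hs _].
  set (z := y / sqrt tau). pose proof (pow2_ge_0 z) as Hz. pose proof (pow2_ge_0 (z ^ 2)) as Hz2.
  assert (HA : Rabs z ^ 2 = z ^ 2) by apply pow2_abs. pose proof (Rabs_pos z) as HA0.
  assert (P4 : (1 + z ^ 2 / 4) ^ 2 = 1 + z ^ 2 / 2 + (z ^ 2) ^ 2 / 16) by field.
  split; [|split; [|split; [|split]]].
  - unfold heat. pose proof (Phi_bounds (y / sqrt tau)). rewrite Rabs_pos_eq by lra. lra.
  - unfold heat1. fold z. replace (heat_bd eps) with (16 * (heat_bd eps / 16)) by field.
    apply div_bound; [lra|exact B3|]. rewrite <- (Rmult_1_l (gauss_density z)).
    apply gauss_poly; [|lra]. rewrite Rabs_R1, P4. lra.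
  - unfold heat2. fold z. replace (heat_bd eps) with (16 * (heat_bd eps / 16)) by field.
    apply div_bound; [lra|exact B1|]. apply gauss_poly; [|lra]. rewrite Rabs_Ropp, P4. nra.
  - unfold heat3. fold z. replace (heat_bd eps) with (16 * (heat_bd eps / 16)) by field.
    apply div_bound; [pos|exact B4|]. apply gauss_poly; [|lra].
    rewrite P4. apply Rabs_le. lra.
  (* [64] bounds the polynomial times the density, and the [4] is the one in the denominator of
     [heat_tt]; their quotient is the [16] of [heat_bd]. *)
  - unfold heat_tt. fold z. replace (heat_bd eps) with (64 * (heat_bd eps / 16) / 4) by field.
    replace ((3 * z - z ^ 3) * gauss_density z / (4 * tau ^ 2))
      with ((3 * z - z ^ 3) * gauss_density z / tau ^ 2 / 4) by (field; lra).
    unfold Rdiv at 1. rewrite Rabs_mult, (Rabs_pos_eq (/ 4)) by lra.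
    apply Rmult_le_compat_r; [lra|].
    apply div_bound; [pos|exact B2|]. apply gauss_poly; [|lra].
    rewrite P4. replace (3 * z - z ^ 3) with (z * (3 - z ^ 2)) by ring. rewrite Rabs_mult.
    assert (Rabs (3 - z ^ 2) <= 3 + z ^ 2) by (apply Rabs_le; lra).
    rewrite <- HA in *. set (t := Rabs z) in *.
    apply Rle_trans with (t * (3 + t ^ 2)); [apply Rmult_le_compat_l; assumption|].
    nra.
Qed.

Section Lindeberg.
Variables (M : nat) (p : Z -> R).
Hypothesis p_nonneg : forall k, 0 <= p k.
Hypothesis p_mass : EZ M p (fun _ => 1) <= 1.
Variables (xi : Z -> R) (h eps : R).
Hypothesis h_nonneg : 0 <= h.
Hypothesis eps_pos : 0 < eps.

(** The five costs of one replacement: lost mass, nonzero mean, mismatch of the variance with [h],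
    third moment from Taylor's formula in [y], and [h^2] from Taylor's formula in [tau]. *)
Definition lind_err : R :=
  (1 - EZ M p (fun _ => 1)) + Rabs (EZ M p xi) + Rabs (EZ M p (fun k => xi k ^ 2) - h)
  + EZ M p (fun k => Rabs (xi k) ^ 3) + h ^ 2.

(** Both terms are expanded around [(tau, y)]: the second-order term [heat2/2 * E xi^2] meets the
    time increment [h * heat2/2], and they cancel up to [E xi^2 - h]. The bound [eps <= tau] keeps
    away from the singularity at [tau = 0]. *)
Lemma lind_step (tau y : R) : eps <= tau ->
  Rabs (EZ M p (fun k => heat tau (y - xi k)) - heat (tau + h) y) <= heat_bd eps * lind_err.
Proof.
  intros Ht.
  destruct (heat_bounds eps tau y ltac:(lra)) as (B0 & B1 & B2 & _ & _).
  set (K := heat_bd eps) in *. assert (HK : 0 <= K) by (eapply Rle_trans; [apply Rabs_pos|exact B0]).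
  set (rem := fun k => heat tau (y - xi k) - heat tau y - (- xi k) * heat1 tau y - (xi k) ^ 2 / 2 * heat2 tau y).
  assert (HR : forall k, Rabs (rem k) <= K * Rabs (xi k) ^ 3).
  { intros k. pose proof (taylor3 (heat tau) (heat1 tau) (heat2 tau) (heat3 tau) K y (y - xi k) HK) as T.
    replace (y - xi k - y) with (- xi k) in T by ring.
    rewrite Rabs_Ropp in T. unfold rem.
    replace (xi k ^ 2 / 2) with ((- xi k) ^ 2 / 2) by field. apply T.
    intros s. split; [apply heat_derive; lra|]. split; [apply heat1_derive; lra|].
    split; [apply heat2_derive; lra|]. apply heat_bounds; lra. }
  assert (HT : Rabs (heat (tau + h) y - heat tau y - h * (heat2 tau y / 2)) <= K * h ^ 2).
  { pose proof (taylor2 (fun t => heat t y) (fun t => heat2 t y / 2) (fun t => heat_tt t y) K tau (tau + h) HK) as T.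
    replace (tau + h - tau) with h in T by ring. rewrite pow2_abs in T. apply T.
    intros s Hs. rewrite Rmin_left in Hs by lra.
    split; [apply heat_tau_derive; lra|]. split; [apply heat2_tau_derive; lra|apply heat_bounds; lra]. }
  assert (E : EZ M p (fun k => heat tau (y - xi k)) =
    heat tau y * EZ M p (fun _ => 1) - heat1 tau y * EZ M p xi
    + heat2 tau y / 2 * EZ M p (fun k => xi k ^ 2) + EZ M p rem).
  { rewrite (EZ_ext M p _ (fun k => heat tau y + (- heat1 tau y * xi k + (heat2 tau y / 2 * xi k ^ 2 + rem k))))
      by (intros; unfold rem; field).
    rewrite !EZ_plus, !EZ_scal, (EZ_const M p (heat tau y)). ring. }
  set (m := EZ M p (fun _ => 1)) in *. set (e := EZ M p xi) in *.
  set (v := EZ M p (fun k => xi k ^ 2)) in *. set (t3 := EZ M p (fun k => Rabs (xi k) ^ 3)).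
  assert (HRE : Rabs (EZ M p rem) <= K * t3).
  { eapply Rle_trans; [apply EZ_abs, p_nonneg|]. unfold t3. rewrite <- EZ_scal. apply EZ_le; assumption. }
  rewrite E.
  replace (heat tau y * m - heat1 tau y * e + heat2 tau y / 2 * v + EZ M p rem - heat (tau + h) y) with
    ((- (heat tau y * (1 - m)) - heat1 tau y * e) + (heat2 tau y / 2 * (v - h) + (EZ M p rem
      - (heat (tau + h) y - heat tau y - h * (heat2 tau y / 2))))) by field.
  unfold lind_err. fold m e v t3.
  assert (A1 : Rabs (heat tau y * (1 - m)) <= K * (1 - m)).
  { rewrite Rabs_mult, (Rabs_pos_eq (1 - m)) by lra. apply Rmult_le_compat_r; lra. }
  assert (A2 : Rabs (heat1 tau y * e) <= K * Rabs e).
  { rewrite Rabs_mult. apply Rmult_le_compat_r; [apply Rabs_pos|exact B1]. }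
  assert (A3 : Rabs (heat2 tau y / 2 * (v - h)) <= K * Rabs (v - h)).
  { rewrite Rabs_mult. apply Rmult_le_compat_r; [apply Rabs_pos|].
    unfold Rdiv. rewrite Rabs_mult, (Rabs_pos_eq (/ 2)) by lra. lra. }
  revert A1 A2 A3 HRE HT. generalize (heat tau y * (1 - m)) (heat1 tau y * e) (heat2 tau y / 2 * (v - h)) (EZ M p rem)
    (heat (tau + h) y - heat tau y - h * (heat2 tau y / 2)).
  intros x1 x2 x3 x4 x5 A1 A2 A3 A4 A5.
  apply Rabs_le_between in A1. apply Rabs_le_between in A2. apply Rabs_le_between in A3.
  apply Rabs_le_between in A4. apply Rabs_le_between in A5. apply Rabs_le. lra.
Qed.

(** Induction on the number of summands: with the first coordinate fixed the others are replaced,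
    then that coordinate is, so that the time runs from [tau] to [tau + n h]. *)
Lemma lindeberg (n : nat) : forall tau y, eps <= tau ->
  Rabs (EZn n M p (fun Y => heat tau (y - ssum xi Y)) - heat (tau + INR n * h) y) <= INR n * (heat_bd eps * lind_err).
Proof.
  induction n; intros tau y Ht.
  - rewrite EZn_O. unfold ssum. simpl. rewrite Rmult_0_l, Rplus_0_r, Rminus_0_r, Rminus_diag, Rabs_R0. lra.
  - rewrite EZn_S, S_INR.
    assert (0 <= INR n * h) by pos.
    pose proof (lind_step (tau + INR n * h) y ltac:(lra)) as H1.
    assert (H2 : Rabs (EZ M p (fun k => EZn n M p (fun Y => heat tau (y - ssum xi (k :: Y))))
      - EZ M p (fun k => heat (tau + INR n * h) (y - xi k))) <= INR n * (heat_bd eps * lind_err)).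
    { apply EZ_dist; try assumption. intros k.
      rewrite (EZn_ext M p n _ (fun Y => heat tau (y - xi k - ssum xi Y))).
      - apply IHn, Ht.
      - intros; f_equal. rewrite ssum_cons. ring. }
    replace (tau + (INR n + 1) * h) with (tau + INR n * h + h) by ring.
    apply Rabs_le_between in H1. apply Rabs_le_between in H2. apply Rabs_le. lra.
Qed.
End Lindeberg.

(** * Convergence in probability *)

Section Cv.
Context {I : Type} {F : (I -> Prop) -> Prop} {FF : Filter F}.

Definition cv (F : (I -> Prop) -> Prop) (g : I -> R) (l : R) : Prop :=
  forall eps, 0 < eps -> F (fun i => Rabs (g i - l) < eps).
Definition cvinf (F : (I -> Prop) -> Prop) (g : I -> R) : Prop := forall A, F (fun i => A < g i).

Lemma cv_filterlim (g : I -> R) (l : R) : cv F g l <-> filterlim g F (locally l).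
Proof.
  rewrite filterlim_locally. split.
  - intros H eps. apply (H eps), cond_pos.
  - intros H eps He. apply (H (mkposreal eps He)).
Qed.

Lemma cv_const (c : R) : cv F (fun _ => c) c.
Proof. intros eps He. apply filter_forall. intros _. rewrite Rminus_diag, Rabs_R0. exact He. Qed.

Lemma cv_ext (f g : I -> R) (l : R) : F (fun i => f i = g i) -> cv F f l -> cv F g l.
Proof.
  intros H Hf eps He. generalize (filter_and _ _ H (Hf eps He)). apply filter_imp.
  intros i [E Hi]. rewrite <- E. exact Hi.
Qed.

Lemma cv_plus (f g : I -> R) (a b : R) : cv F f a -> cv F g b -> cv F (fun i => f i + g i) (a + b).
Proof.
  rewrite !cv_filterlim. intros Hf Hg.
  eapply filterlim_comp_2; [exact Hf|exact Hg|]; apply (filterlim_plus (V := R_NormedModule)).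
Qed.

Lemma cv_mult (f g : I -> R) (a b : R) : cv F f a -> cv F g b -> cv F (fun i => f i * g i) (a * b).
Proof.
  rewrite !cv_filterlim. intros Hf Hg.
  eapply filterlim_comp_2; [exact Hf|exact Hg|]; apply (filterlim_mult (K := R_AbsRing)).
Qed.

Lemma cv_comp (f : R -> R) (g : I -> R) (l : R) :
  continuous f l -> cv F g l -> cv F (fun i => f (g i)) (f l).
Proof. rewrite !cv_filterlim. intros Hf Hg. apply (filterlim_comp _ _ _ g f F _ _ Hg Hf). Qed.

Lemma cv_scal (c : R) (g : I -> R) (l : R) : cv F g l -> cv F (fun i => c * g i) (c * l).
Proof. intros H. apply cv_mult; [apply cv_const|exact H]. Qed.

Lemma cv_minus (f g : I -> R) (a b : R) : cv F f a -> cv F g b -> cv F (fun i => f i - g i) (a - b).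
Proof.
  intros Hf Hg. replace (a - b) with (a + -1 * b) by ring.
  apply (cv_ext (fun i => f i + -1 * g i)); [apply filter_forall; intros; ring|].
  apply cv_plus; [exact Hf|apply cv_scal, Hg].
Qed.

Lemma cv_inv (g : I -> R) (l : R) : l <> 0 -> cv F g l -> cv F (fun i => / g i) (/ l).
Proof.
  intros Hl. apply (cv_comp Rinv). apply derive_continuous.
  auto_derive. exact Hl.
Qed.

Lemma cv_abs (g : I -> R) (l : R) : cv F g l -> cv F (fun i => Rabs (g i)) (Rabs l).
Proof.
  apply (cv_comp Rabs). apply continuity_pt_filterlim, Rcontinuity_abs.
Qed.

Lemma cv_squeeze (f g : I -> R) (l : R) : F (fun i => Rabs (f i - l) <= g i) -> cv F g 0 -> cv F f l.
Proof.
  intros H Hg eps He. generalize (filter_and _ _ H (Hg eps He)). apply filter_imp.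
  intros i [H1 H2]. rewrite Rminus_0_r in H2. apply Rabs_lt_between in H2. lra.
Qed.

Lemma cvinf_inv (g : I -> R) : cvinf F g -> cv F (fun i => / g i) 0.
Proof.
  intros H eps He. generalize (H (/ eps)). apply filter_imp. intros i Hi.
  pose proof (Rinv_0_lt_compat eps He). rewrite Rminus_0_r, Rabs_pos_eq by pos.
  rewrite <- (Rinv_inv eps). apply Rinv_lt_contravar; [pos|exact Hi].
Qed.

Lemma cvinf_le (f g : I -> R) : F (fun i => f i <= g i) -> cvinf F f -> cvinf F g.
Proof.
  intros H Hf A. generalize (filter_and _ _ H (Hf A)). apply filter_imp. intros i [H1 H2]. lra.
Qed.

Lemma cvinf_scal (c : R) (g : I -> R) : 0 < c -> cvinf F g -> cvinf F (fun i => c * g i).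
Proof.
  intros Hc H A. generalize (H (A / c)). apply filter_imp. intros i Hi.
  apply Rlt_div_l in Hi; [lra|exact Hc].
Qed.

Lemma cvinf_sqrt (g : I -> R) : cvinf F g -> cvinf F (fun i => sqrt (g i)).
Proof.
  intros H A. generalize (H (Rmax A 0 ^ 2)). apply filter_imp. intros i Hi.
  apply Rle_lt_trans with (Rmax A 0); [apply Rmax_l|].
  rewrite <- (sqrt_pow2 (Rmax A 0)) by apply Rmax_r. apply sqrt_lt_1_alt.
  split; [apply pow2_ge_0|exact Hi].
Qed.
End Cv.

(* Limits in [T], and iterated limits in the box radius [M] for fixed [T], then in [T]. *)
Definition FT (P : R -> Prop) : Prop := exists T0, forall T, T0 <= T -> P T.
Definition FTM (P : R * nat -> Prop) : Prop := FT (fun T => Hierarchy.eventually (fun M => P (T, M))).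

Global Instance FT_filter : Filter FT.
Proof.
  constructor.
  - exists 0. auto.
  - intros P Q [a Ha] [b Hb]. exists (Rmax a b). intros T HT.
    split; [apply Ha|apply Hb]; eapply Rle_trans; [apply Rmax_l|exact HT|apply Rmax_r|exact HT].
  - intros P Q H [a Ha]. exists a. auto.
Qed.

Global Instance FTM_filter : Filter FTM.
Proof.
  constructor.
  - exists 0. intros T _. apply filter_forall. auto.
  - intros P Q HP HQ. unfold FTM. generalize (filter_and (F := FT) _ _ HP HQ). apply filter_imp.
    intros T [H1 H2]. apply filter_and; assumption.
  - intros P Q H HP. unfold FTM in *. revert HP. apply filter_imp. intros T. apply filter_imp. auto.
Qed.

Lemma FTM_fst (P : R -> Prop) : FT P -> FTM (fun i => P (fst i)).
Proof. unfold FTM. apply filter_imp. intros T H. apply filter_forall. intros M. exact H. Qed.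

Lemma cv_fst (g : R -> R) (l : R) : cv FT g l -> cv FTM (fun i => g (fst i)) l.
Proof. intros H eps He. apply (FTM_fst (fun T => Rabs (g T - l) < eps)), H, He. Qed.

(** Replaces a truncated quantity by its untruncated value [g0]. Terms that vanish as [M -> oo] at
    fixed [T] drop out with [g0 = 0], however fast [n] grows. *)
Lemma cv_iter (g : R * nat -> R) (g0 : R -> R) (l : R) :
  FT (fun T => is_lim_seq (fun M => g (T, M)) (g0 T)) -> cv FT g0 l -> cv FTM g l.
Proof.
  intros H Hg eps He. unfold FTM. generalize (filter_and _ _ H (Hg (eps / 2) ltac:(lra))). apply filter_imp.
  intros T [H1 H2]. apply is_lim_seq_spec in H1.
  generalize (H1 (mkposreal (eps / 2) ltac:(lra))). apply filter_imp. intros M HM. simpl in HM.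
  replace (g (T, M) - l) with ((g (T, M) - g0 T) + (g0 T - l)) by ring.
  eapply Rle_lt_trans; [apply Rabs_triang|]. lra.
Qed.

Lemma lim_infty_cv (g : R -> R) (l : R) : lim_infty g l <-> cv FT g l.
Proof.
  split; intros H eps He; destruct (H eps He) as [T0 HT]; exists T0; intros T H1; apply HT; lra.
Qed.

(** * Probabilities, tightness and Slutsky's lemma on the boxes *)

Definition ind (A : Prop) : R := if excluded_middle_informative A then 1 else 0.

Lemma ind_bounds (A : Prop) : 0 <= ind A <= 1.
Proof. unfold ind. destruct excluded_middle_informative; lra. Qed.

Lemma ind_imp (A B : Prop) : (A -> B) -> ind A <= ind B.
Proof. intros H. unfold ind. repeat destruct excluded_middle_informative; try lra. tauto. Qed.

Section Prob.
Context {I : Type} {F : (I -> Prop) -> Prop} {FF : Filter F}.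
Variables (n M : I -> nat) (p : I -> Z -> R).
Hypothesis p_nonneg : forall i k, 0 <= p i k.
Hypothesis p_mass : forall i, EZ (M i) (p i) (fun _ => 1) <= 1.

Definition EE (i : I) (g : list Z -> R) : R := EZn (n i) (M i) (p i) g.
Definition Pr (i : I) (A : list Z -> Prop) : R := EE i (fun Y => ind (A Y)).

Lemma Pr_le i (A B : list Z -> Prop) :
  (forall Y, length Y = n i -> A Y -> B Y) -> Pr i A <= Pr i B.
Proof. intros H. apply EZn_le; [apply p_nonneg|]. intros Y HY. apply ind_imp, H, HY. Qed.

Lemma Pr_or i (A B C : list Z -> Prop) :
  (forall Y, length Y = n i -> C Y -> A Y \/ B Y) -> Pr i C <= Pr i A + Pr i B.
Proof.
  intros H. unfold Pr, EE. rewrite <- EZn_plus. apply EZn_le; [apply p_nonneg|]. intros Y HY.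
  specialize (H Y HY). unfold ind. repeat destruct excluded_middle_informative; try lra. tauto.
Qed.

Definition whp (A : I -> list Z -> Prop) : Prop :=
  forall d, 0 < d -> F (fun i => Pr i (fun Y => ~ A i Y) <= d).

Lemma whp_mono (A B : I -> list Z -> Prop) :
  F (fun i => forall Y, length Y = n i -> A i Y -> B i Y) -> whp A -> whp B.
Proof.
  intros H HA d Hd. generalize (filter_and _ _ H (HA d Hd)). apply filter_imp.
  intros i [H1 H2]. eapply Rle_trans; [|exact H2]. apply Pr_le. intros Y HY Hn HAY. apply Hn, H1; assumption.
Qed.

Definition small (X : I -> list Z -> R) : Prop :=
  forall eps, 0 < eps -> whp (fun i Y => Rabs (X i Y) <= eps).
Definition tight (X : I -> list Z -> R) : Prop :=
  forall d, 0 < d -> exists K, F (fun i => Pr i (fun Y => ~ Rabs (X i Y) <= K) <= d).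

Lemma markov_abs i (X : list Z -> R) (K : R) : 0 < K ->
  Pr i (fun Y => ~ Rabs (X Y) <= K) <= EE i (fun Y => Rabs (X Y)) / K.
Proof.
  intros HK. apply EZn_markov; [apply p_nonneg|exact HK|]. intros Y _. unfold ind.
  pose proof (Rabs_pos (X Y)). destruct excluded_middle_informative; lra.
Qed.

Lemma markov_sqr i (X : list Z -> R) (K : R) : 0 < K ->
  Pr i (fun Y => ~ Rabs (X Y) <= K) <= EE i (fun Y => X Y ^ 2) / K ^ 2.
Proof.
  intros HK. apply EZn_markov; [apply p_nonneg|pos|]. intros Y _. unfold ind.
  rewrite <- (pow2_abs (X Y)).
  destruct excluded_middle_informative; [|nra].
  rewrite Rmult_1_r. apply pow_incr. lra.
Qed.

Lemma small_sqr (X : I -> list Z -> R) : cv F (fun i => EE i (fun Y => X i Y ^ 2)) 0 -> small X.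
Proof.
  intros H eps He d Hd.
  assert (Hde : 0 < d * eps ^ 2) by pos.
  generalize (H _ Hde). apply filter_imp. intros i Hi. rewrite Rminus_0_r in Hi.
  eapply Rle_trans; [apply markov_sqr, He|]. apply div_le; [pos|].
  eapply Rle_trans; [apply Rle_abs|]. lra.
Qed.

Lemma tight_abs (X : I -> list Z -> R) (C : R) : F (fun i => EE i (fun Y => Rabs (X i Y)) <= C) -> tight X.
Proof.
  intros H d Hd. set (K := Rmax (C / d) 1). exists K.
  assert (HK : 1 <= K) by apply Rmax_r. assert (C / d <= K) by apply Rmax_l.
  apply Rle_div_l in H0; [|exact Hd].
  generalize H. apply filter_imp. intros i Hi.
  eapply Rle_trans; [apply markov_abs; lra|]. apply div_le; lra.
Qed.

Lemma tight_sqr (X : I -> list Z -> R) (C : R) : F (fun i => EE i (fun Y => X i Y ^ 2) <= C) -> tight X.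
Proof.
  intros H d Hd. set (K := Rmax (C / d) 1). exists K.
  assert (HK : 1 <= K) by apply Rmax_r. assert (C / d <= K) by apply Rmax_l.
  apply Rle_div_l in H0; [|exact Hd].
  generalize H. apply filter_imp. intros i Hi.
  eapply Rle_trans; [apply markov_sqr; lra|]. apply div_le; [pos|].
  assert (d * K <= d * K ^ 2) by (apply Rmult_le_compat_l; nra). lra.
Qed.

Lemma tight_plus (X Y : I -> list Z -> R) : tight X -> tight Y ->
  tight (fun i l => Rabs (X i l) + Rabs (Y i l)).
Proof.
  intros HX HY d Hd. destruct (HX (d / 2) ltac:(lra)) as [K1 H1].
  destruct (HY (d / 2) ltac:(lra)) as [K2 H2]. exists (K1 + K2).
  generalize (filter_and _ _ H1 H2). apply filter_imp. intros i [A1 A2].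
  apply Rle_trans with (Pr i (fun l => ~ Rabs (X i l) <= K1) + Pr i (fun l => ~ Rabs (Y i l) <= K2)); [|lra].
  apply Pr_or. intros l _ H. rewrite Rabs_pos_eq in H
    by pos.
  destruct (Rle_dec (Rabs (X i l)) K1); [right; lra|left; assumption].
Qed.

(** Smallness is to be checked only where the tight [A] is bounded by a fixed [K]; there the later
    estimates become deterministic. *)
Lemma small_of_tight (A X : I -> list Z -> R) : tight A ->
  (forall K eps, 0 < K -> 0 < eps -> whp (fun i Y => Rabs (A i Y) <= K -> Rabs (X i Y) <= eps)) ->
  small X.
Proof.
  intros HA H eps He d Hd. destruct (HA (d / 2) ltac:(lra)) as [K HK].
  assert (Hd2 : 0 < d / 2) by lra.
  assert (HK1 : 0 < Rmax K 1) by (pose proof (Rmax_r K 1); lra).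
  pose proof (H (Rmax K 1) eps HK1 He (d / 2) Hd2) as H1.
  generalize (filter_and _ _ HK H1). apply filter_imp. intros i [B1 B2].
  apply Rle_trans with (Pr i (fun Y => ~ Rabs (A i Y) <= K) +
    Pr i (fun Y => ~ (Rabs (A i Y) <= Rmax K 1 -> Rabs (X i Y) <= eps))); [|lra].
  apply Pr_or. intros Y _ HY. destruct (Rle_dec (Rabs (A i Y)) K) as [HK2|HK2]; [right|left; exact HK2].
  intros Hc. apply HY, Hc. pose proof (Rmax_l K 1). lra.
Qed.

(** Weak convergence tested on Gaussian-smoothed indicators: with [G] standard normal and
    independent, the expectation is [P(Z + sqrt eps G <= a)], and the limit is its value for a
    standard normal [Z]. Lindeberg's method delivers exactly this form. *)
Definition asymp_normal (Z : I -> list BinInt.Z -> R) : Prop :=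
  forall a eps, 0 < eps ->
    cv F (fun i => EE i (fun Y => Phi ((a - Z i Y) / sqrt eps))) (Phi (a / sqrt (1 + eps))).

Lemma clt (xi : I -> Z -> R) :
  F (fun i => (1 <= n i)%nat) ->
  cv F (fun i => INR (n i) * lind_err (M i) (p i) (xi i) (/ INR (n i))) 0 ->
  asymp_normal (fun i Y => ssum (xi i) Y).
Proof.
  intros Hn H a eps He.
  apply cv_squeeze with (fun i => heat_bd eps * (INR (n i) * lind_err (M i) (p i) (xi i) (/ INR (n i)))).
  - generalize Hn. apply filter_imp. intros i Hi.
    assert (1 <= INR (n i)) by (apply (le_INR 1); exact Hi).
    pose proof (lindeberg (M i) (p i) (p_nonneg i) (p_mass i) (xi i) (/ INR (n i)) eps
      ltac:(pos) He (n i) eps a ltac:(lra)) as L.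
    rewrite Rinv_r in L by lra. rewrite (Rplus_comm eps 1) in L.
    eapply Rle_trans; [exact L|]. right; ring.
  - replace 0 with (heat_bd eps * 0) by ring. apply cv_scal, H.
Qed.

Lemma Phi_cont (x : R) : continuous Phi x.
Proof.
  apply derive_continuous. exists (gauss_density x). apply Phi_derive.
Qed.

(** [t] is the smoothing scale, used with [eps = t^2]. As [t -> 0] the shifted and rescaled
    arguments tend to [x], and [Phi] is continuous. *)
Lemma smoothing_param (x m eta : R) : 0 < eta ->
  exists t, 0 < t /\ Rabs (Phi ((x + t + m * t) / sqrt (1 + t ^ 2)) - Phi x) < eta
    /\ Rabs (Phi ((x - t - m * t) / sqrt (1 + t ^ 2)) - Phi x) < eta.
Proof.
  intros He.
  assert (Hc : forall c, continuous (fun t => Phi ((x + c * t) / sqrt (1 + t ^ 2))) 0).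
  { intros c. apply (continuous_comp (fun t => (x + c * t) / sqrt (1 + t ^ 2)) Phi); [|apply Phi_cont].
    apply derive_continuous. auto_derive.
    replace (1 + 0 * (0 * 1)) with 1 by ring. rewrite sqrt_1. lra. }
  assert (E : forall c, Phi ((x + c * 0) / sqrt (1 + 0 ^ 2)) = Phi x).
  { intros c. replace (1 + 0 ^ 2) with 1 by ring. rewrite sqrt_1. f_equal. field. }
  pose proof (Hc (1 + m)) as H1. pose proof (Hc (- (1 + m))) as H2.
  apply filterlim_locally with (eps := mkposreal eta He) in H1.
  apply filterlim_locally with (eps := mkposreal eta He) in H2.
  destruct (filter_and _ _ H1 H2) as [d Hd]. exists (d / 2). pose proof (cond_pos d) as Hp.
  destruct (Hd (d / 2)) as [A1 A2].
  { apply Rabs_lt_between'. lra. }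
  rewrite E in A1, A2. split; [lra|].
  replace (x + d / 2 + m * (d / 2)) with (x + (1 + m) * (d / 2)) by ring.
  replace (x - d / 2 - m * (d / 2)) with (x + - (1 + m) * (d / 2)) by ring.
  split; [exact A1|exact A2].
Qed.

Lemma slutsky (V Z : I -> list BinInt.Z -> R) :
  asymp_normal Z -> small (fun i Y => V i Y - Z i Y) ->
  forall x, cv F (fun i => Pr i (fun Y => V i Y <= x)) (Phi x).
Proof.
  intros HZ HV x eta He.
  (* At [m] smoothing scales the Gaussian tail is below [eta/8]; this fixes how far the threshold is
     shifted. *)
  assert (exists m, 0 < m /\ 1 - Phi m < eta / 8) as (m & Hm & HPm).
  { destruct (Phi_lim_p (fun z => 1 - eta / 8 < z)) as [K HK].
    { exists (mkposreal (eta / 8) ltac:(lra)). intros z Hz. apply Rabs_lt_between' in Hz. simpl in Hz. lra. }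
    exists (Rmax (K + 1) 1). pose proof (Rmax_l (K + 1) 1). pose proof (Rmax_r (K + 1) 1).
    split; [lra|]. specialize (HK (Rmax (K + 1) 1) ltac:(lra)). lra. }
  assert (He8 : 0 < eta / 8) by lra.
  destruct (smoothing_param x m (eta / 8) He8) as (t & Ht & P1 & P2).
  assert (Ht2 : 0 < t ^ 2) by pos.
  pose proof (HZ (x + t + m * t) (t ^ 2) Ht2 (eta / 8) He8) as Z1.
  pose proof (HZ (x - t - m * t) (t ^ 2) Ht2 (eta / 8) He8) as Z2.
  pose proof (HV t Ht (eta / 8) He8) as Bad.
  generalize (filter_and _ _ Bad (filter_and _ _ Z1 Z2)). apply filter_imp.
  intros i (B & A1 & A2). rewrite (sqrt_pow2 t) in A1, A2 by lra.
  pose proof (Phi_opp m) as Hopp.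
  (* If [V <= x] and [V] is within [t] of [Z], the smoothed indicator at the threshold shifted by
     [t + m t] is at least [Phi m]. *)
  assert (Upper : Pr i (fun Y => V i Y <= x) <= Pr i (fun Y => ~ Rabs (V i Y - Z i Y) <= t)
    + (EE i (fun Y => Phi ((x + t + m * t - Z i Y) / t)) + (1 - Phi m))).
  { pose proof (EZn_const_le (M i) (p i) (p_nonneg i) (p_mass i) (n i) (1 - Phi m)
      ltac:(pose proof (Phi_bounds m); lra)) as Hc.
    apply Rle_trans with (Pr i (fun Y => ~ Rabs (V i Y - Z i Y) <= t)
      + (EE i (fun Y => Phi ((x + t + m * t - Z i Y) / t)) + EE i (fun _ => 1 - Phi m))); [|unfold EE at 2; unfold EE in Hc; lra].
    unfold Pr, EE. rewrite <- !EZn_plus. apply EZn_le; [apply p_nonneg|]. intros Y _.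
    pose proof (Phi_bounds ((x + t + m * t - Z i Y) / t)).
    unfold ind. repeat destruct excluded_middle_informative; try lra.
    assert (Hab : Rabs (V i Y - Z i Y) <= t) by lra.
    apply Rabs_le_between in Hab.
    assert (Phi m <= Phi ((x + t + m * t - Z i Y) / t)); [|lra].
    apply Phi_incr, le_div; lra. }
  assert (Lower : EE i (fun Y => Phi ((x - t - m * t - Z i Y) / t)) <= Pr i (fun Y => V i Y <= x)
    + (Pr i (fun Y => ~ Rabs (V i Y - Z i Y) <= t) + Phi (- m))).
  { pose proof (EZn_const_le (M i) (p i) (p_nonneg i) (p_mass i) (n i) (Phi (- m))
      ltac:(pose proof (Phi_bounds (- m)); lra)) as Hc.
    apply Rle_trans with (Pr i (fun Y => V i Y <= x)
      + (Pr i (fun Y => ~ Rabs (V i Y - Z i Y) <= t) + EE i (fun _ => Phi (- m)))); [|unfold EE in *; lra].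
    unfold Pr, EE. rewrite <- !EZn_plus. apply EZn_le; [apply p_nonneg|]. intros Y _.
    pose proof (Phi_bounds ((x - t - m * t - Z i Y) / t)).
    unfold ind. repeat destruct excluded_middle_informative; try lra.
    assert (Hab : Rabs (V i Y - Z i Y) <= t) by lra.
    apply Rabs_le_between in Hab.
    assert (Phi ((x - t - m * t - Z i Y) / t) <= Phi (- m)); [|lra].
    apply Phi_incr, div_le; lra. }
  rewrite Hopp in Lower.
  apply Rabs_lt_between in A1. apply Rabs_lt_between in A2. apply Rabs_lt_between in P1.
  apply Rabs_lt_between in P2. apply Rabs_lt_between. lra.
Qed.
End Prob.

Lemma EZ_fD (M : nat) (D th : R) (g : nat -> R) :
  EZ M (fD D th) (fun k => g (Z.abs_nat k)) = wsum M (fun k => pmf k (th * D) * g k).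
Proof. unfold EZ. rewrite <- sumL_Zbox. reflexivity. Qed.

(** Monotonicity in the box is what makes the limit inside [prob_le] exist: the truncated
    probabilities increase and stay below [1]. *)
Lemma boxsum_incr (n M : nat) (g : list Z -> R) : (forall Y, 0 <= g Y) ->
  boxsum n M g <= boxsum n (S M) g.
Proof.
  revert g. induction n; intros g H; [simpl; lra|]. cbn [boxsum]. rewrite Zbox_S. cbn [map].
  rewrite map_app. change (sumL (?a :: ?l)) with (a + sumL l). rewrite sumL_app. cbn [map].
  assert (P : forall n M g, (forall Y, 0 <= g Y) -> 0 <= boxsum n M g).
  { intros n' M' g' H'. apply Rle_trans with (boxsum n' M' (fun Y => 0 * g' Y)).
    - rewrite boxsum_scal. lra.
    - apply boxsum_le. intros Y _. rewrite Rmult_0_l. apply H'. }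
  pose proof (P n (S M) (fun l => g ((- Z.of_nat (S M))%Z :: l)) ltac:(intros; apply H)) as P1.
  pose proof (P n (S M) (fun l => g (Z.of_nat (S M) :: l)) ltac:(intros; apply H)) as P2.
  assert (sumL (map (fun k => boxsum n M (fun l => g (k :: l))) (Zbox M)) <=
    sumL (map (fun k => boxsum n (S M) (fun l => g (k :: l))) (Zbox M))).
  { apply sumL_le. intros k. apply IHn. intros; apply H. }
  change (sumL (boxsum n (S M) (fun l => g (Z.of_nat (S M) :: l)) :: nil)) with
    (boxsum n (S M) (fun l => g (Z.of_nat (S M) :: l)) + 0). lra.
Qed.

Lemma prob_le_lim (D th : R) (n : nat) (Sx : list Z -> R) (x : R) : 0 <= th * D ->
  is_lim_seq (fun M => EZn n M (fD D th) (fun Y => ind (Sx Y <= x))) (prob_le D th n Sx x).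
Proof.
  intros H.
  assert (Hp : forall k, 0 <= fD D th k) by (intros; apply pmf_nonneg, H).
  assert (Hm : forall M, EZ M (fD D th) (fun _ => 1) <= 1).
  { intros M. rewrite (EZ_fD M D th (fun _ => 1)). eapply Rle_trans; [|apply (mass_le_1 M (th * D) H)].
    right. apply wsum_ext. intros; ring. }
  destruct (ex_finite_lim_seq_incr (fun M => EZn n M (fD D th) (fun Y => ind (Sx Y <= x))) 1) as [l Hl].
  - intros M. apply boxsum_incr. intros Y. apply Rmult_le_pos; [apply prodp_nonneg, Hp|apply ind_bounds].
  - intros M. eapply Rle_trans; [|apply (EZn_const_le M _ Hp (Hm M) n 1); lra].
    apply EZn_le; [exact Hp|]. intros; apply ind_bounds.
  - replace (prob_le D th n Sx x) with l; [exact Hl|]. symmetry. apply lim_unique.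
    apply is_lim_seq_Reals. eapply is_lim_seq_ext; [|exact Hl]. intros M. unfold EZn.
    apply boxsum_ext. intros Y _. unfold prodf, prodp, ind. f_equal.
    destruct excluded_middle_informative, Rle_dec; tauto || reflexivity.
Qed.

(** For fixed [T], one box size [M] that is large enough for both limits transfers the estimate to
    the untruncated probability. *)
Lemma prob_le_cv (D : R -> R) (th : R) (V : R -> list Z -> R) (x l : R) :
  (forall T, 0 <= th * D T) ->
  cv FTM (fun i => EZn (nobs (fst i) (D (fst i))) (snd i) (fD (D (fst i)) th) (fun Y => ind (V (fst i) Y <= x))) l ->
  lim_infty (fun T => prob_le (D T) th (nobs T (D T)) (V T) x) l.
Proof.
  intros H Hc eps He. destruct (Hc (eps / 2) ltac:(lra)) as [T0 HT]. exists T0. intros T HTT.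
  specialize (HT T ltac:(lra)). cbn [fst snd] in HT.
  pose proof (prob_le_lim (D T) th (nobs T (D T)) (V T) x (H T)) as L.
  apply is_lim_seq_spec in L. specialize (L (mkposreal (eps / 2) ltac:(lra))).
  destruct (filter_and _ _ HT L) as [M HM]. destruct (HM M (Nat.le_refl _)) as [H1 H2]. simpl in H2.
  apply Rabs_lt_between in H1. apply Rabs_lt_between in H2. apply Rabs_lt_between. lra.
Qed.

(** * Debye bounds *)

(** [score k s + 1] is [I_k'/I_k], so this is the modified Bessel equation in Riccati form. *)
Lemma psi_riccati (k : nat) (s : R) : 0 < s ->
  score1 k s = 1 + INR k ^ 2 / s ^ 2 - (score k s + 1) / s - (score k s + 1) ^ 2.
Proof. intros H. unfold score1, ratio1, score. field. lra. Qed.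

Lemma psi_lower_lin (k : nat) (s : R) : 0 < s -> INR k / s < score k s + 1.
Proof. intros H. unfold score. pose proof (ratio_pos k s H). lra. Qed.

(** The comparison function [w] is a supersolution of the Riccati equation. It is written in
    [k^2/s], a quantity of order one under the law of the increments. *)
Lemma score_upper (k : nat) (s : R) : 2 <= s -> score k s <= (INR k ^ 2 / s - 1) / (2 * s) + 3 / s ^ 2.
Proof.
  intros Hs. set (w := fun s => 1 + (INR k ^ 2 / s - 1) / (2 * s) + 3 / s ^ 2).
  cut (0 <= w s - (score k s + 1)); [unfold w; lra|].
  set (dw := fun s => - (INR k ^ 2) / s ^ 3 + 1 / (2 * s ^ 2) - 6 / s ^ 3).
  apply (barrier (fun s => w s - (score k s + 1)) (fun s => dw s - score1 k s) 2); [| | |exact Hs].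
  - intros x Hx. apply derive_minus.
    + unfold w, dw. auto_derive; [repeat split; try lra; apply Rgt_not_eq; nra|field; lra].
    + evar_last.
      { apply (derive_plus (score k)); [apply score_derive; lra|apply derive_const]. }
      ring.
  (* The coefficient [3] is chosen for this start: against the crude bound [psi <= k/2 + 1], the
     inequality at [s = 2] is [(k - 2)^2 >= 0]. *)
  - unfold w. pose proof (score_bound k 2 ltac:(lra)). pose proof (pow2_ge_0 (INR k - 2)).
    replace (1 + (INR k ^ 2 / 2 - 1) / (2 * 2) + 3 / 2 ^ 2) with (1 + INR k ^ 2 / 8 + 1 / 2) by field. lra.
  - intros x Hx Hd. rewrite psi_riccati by lra. set (psi := score k x + 1) in *.
    assert (Hw : 0 < w x).
    { unfold w.
      replace (1 + (INR k ^ 2 / x - 1) / (2 * x) + 3 / x ^ 2) with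
        (((2 * x - 1) * x + INR k ^ 2 + 6) / (2 * x ^ 2)) by (field; lra).
      apply Rdiv_lt_0_compat; nra. }
    assert (H1 : w x / x + w x ^ 2 <= psi / x + psi ^ 2).
    { apply Rplus_le_compat; [|apply pow_incr; lra].
      apply Rmult_le_compat_r; [pos|lra]. }
    assert (H2 : 0 <= dw x + w x / x + w x ^ 2 - 1 - INR k ^ 2 / x ^ 2); [|lra].
    unfold dw, w. set (y := INR k ^ 2 / x).
    replace (INR k ^ 2) with (y * x) by (unfold y; field; lra).
    (* The residual of [w] is [1/x^2] times a factor that [(y - 2)^2 >= 0] and [1/x <= 1/2] keep
       positive. *)
    replace (- (y * x) / x ^ 3 + 1 / (2 * x ^ 2) - 6 / x ^ 3 + (1 + (y - 1) / (2 * x) + 3 / x ^ 2) / x +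
      (1 + (y - 1) / (2 * x) + 3 / x ^ 2) ^ 2 - 1 - y * x / x ^ 2) with
      ((((y - 2) ^ 2 - 3) / 4 + 6 + 3 * y * / x - 6 * / x + 9 * (/ x) ^ 2) * (/ x) ^ 2) by (field; lra).
    apply Rmult_le_pos; [|apply pow2_ge_0].
    assert (0 <= y) by (unfold y; pos).
    assert (0 < / x <= / 2) by (split; [pos|apply Rinv_le_contravar; lra]).
    assert (0 <= y * / x) by pos.
    pose proof (pow2_ge_0 (y - 2)). pose proof (pow2_ge_0 (/ x)). lra.
Qed.

Section Debye.
Variable k : nat.
Let rad (s : R) : R := sqrt (s ^ 2 + INR k ^ 2).

Lemma rad_props (s : R) : 0 < s -> s <= rad s /\ rad s ^ 2 = s ^ 2 + INR k ^ 2 /\ rad s <= s + INR k.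
Proof.
  intros H. unfold rad. pose proof (pow2_ge_0 (INR k)). pose proof (pow2_ge_0 s). pose proof (pos_INR k).
  split; [|split].
  - rewrite <- (sqrt_pow2 s) at 1 by lra. apply sqrt_le_1_alt. lra.
  - apply pow2_sqrt. lra.
  - rewrite <- (sqrt_pow2 (s + INR k)) by lra. apply sqrt_le_1_alt. nra.
Qed.

Lemma rad_derive (s : R) : 0 < s -> is_derive rad s (s / rad s).
Proof.
  intros H. pose proof (rad_props s H). unfold rad in *. auto_derive; [nra|]. simpl in *. field. lra.
Qed.

(* Debye's expansion of [I_k'/I_k] at order one; the last two terms make it a subsolution. *)
Lemma psi_lower (s : R) : 3 <= s ->
  rad s / s - s / (2 * rad s ^ 2) - s / (4 * rad s ^ 3) - 27 / s ^ 3 <= score k s + 1.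
Proof.
  intros Hs.
  set (w := fun s => rad s / s - s / (2 * rad s ^ 2) - s / (4 * rad s ^ 3) - 27 / s ^ 3).
  cut (0 <= (score k s + 1) - w s); [unfold w; lra|].
  set (dw := fun s => / rad s - rad s / s ^ 2 - / (2 * rad s ^ 2) + s ^ 2 / rad s ^ 4
     - / (4 * rad s ^ 3) + 3 * s ^ 2 / (4 * rad s ^ 5) + 81 / s ^ 4).
  apply (barrier (fun s => (score k s + 1) - w s) (fun s => score1 k s - dw s) 3); [| | |exact Hs].
  - intros x Hx. destruct (rad_props x ltac:(lra)) as (R1 & R2 & R3).
    apply derive_minus.
    + evar_last.
      { apply (derive_plus (score k)); [apply score_derive; lra|apply derive_const]. }
      ring.
    + pose proof (rad_derive x ltac:(lra)) as Hd.
      assert (Dr : Derive rad x = x / rad x) by (apply is_derive_unique, Hd).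
      assert (Er : ex_derive rad x) by (exists (x / rad x); exact Hd).
      unfold w, dw. auto_derive.
      * repeat split; try exact Er; try lra; apply Rgt_not_eq;
          repeat apply Rmult_lt_0_compat; lra.
      * change (Derive (fun x => rad x) x) with (Derive rad x). rewrite Dr. field. lra.
  (* The coefficient [27] makes the last term equal to [1] at [s = 3], so that there
     [w <= (3 + k)/3 - 1 = k/3 < psi]. *)
  - unfold w. destruct (rad_props 3 ltac:(lra)) as (R1 & R2 & R3).
    pose proof (psi_lower_lin k 3 ltac:(lra)).
    assert (0 < 3 / (2 * rad 3 ^ 2)) by pos.
    assert (0 < 3 / (4 * rad 3 ^ 3)) by pos.
    replace (27 / 3 ^ 3) with 1 by field. lra.
  - intros x Hx Hd. rewrite psi_riccati by lra. set (psi := score k x + 1) in *.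
    destruct (rad_props x ltac:(lra)) as (R1 & R2 & R3). set (r := rad x) in *.
    assert (Hpsi : 0 < psi) by (pose proof (psi_lower_lin k x ltac:(lra)); pose proof (div_INR_nonneg k x ltac:(lra)); unfold psi; lra).
    assert (H1 : psi / x + psi ^ 2 <= w x / x + w x ^ 2).
    { apply Rplus_le_compat; [|apply pow_incr; lra].
      apply Rmult_le_compat_r; [pos|lra]. }
    assert (H2 : dw x + w x / x + w x ^ 2 <= 1 + INR k ^ 2 / x ^ 2); [|lra].
    replace (1 + INR k ^ 2 / x ^ 2) with (r ^ 2 / x ^ 2) by (rewrite R2; field; lra).
    set (w0 := r / x - x / (2 * r ^ 2) - x / (4 * r ^ 3)).
    assert (Ew : w x = w0 - 27 / x ^ 3) by reflexivity.
    assert (E : dw x + w x / x + w x ^ 2 - r ^ 2 / x ^ 2 =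
      (- / r ^ 2 + 5 * x ^ 2 / (4 * r ^ 4) - / (2 * r ^ 2) - / (2 * r ^ 3) + x ^ 2 / r ^ 5
       + x ^ 2 / (16 * r ^ 6)) + 27 / x ^ 3 * (2 / x - w0 - w x)).
    { rewrite Ew. unfold dw, w0. fold r. field. lra. }
    assert (Hi : 0 < / r <= / x).
    { split; [pos|apply Rinv_le_contravar; lra]. }
    assert (Hx3 : / x <= / 3) by (apply Rinv_le_contravar; lra).
    assert (Hz : 0 <= x ^ 2 * (/ r) ^ 2 <= 1).
    { replace (x ^ 2 * (/ r) ^ 2) with ((x * / r) ^ 2) by ring.
      assert (0 <= x * / r <= 1); [|apply pow_le_1; assumption].
      split; [pos|]. apply (div_le x); lra. }
    set (i := / r) in *. set (z := x ^ 2 * i ^ 2) in *.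
    (* In [i = 1/r] and [z = (x/r)^2], and up to the factor [i^2]: the expansion without correction
       leaves [- 1 + 5 z / 4], of the wrong sign near [z = 1]; the term [- s/(4 r^3)] adds
       [- 1/2]. *)
    assert (P1 : - / r ^ 2 + 5 * x ^ 2 / (4 * r ^ 4) - / (2 * r ^ 2) - / (2 * r ^ 3) + x ^ 2 / r ^ 5
       + x ^ 2 / (16 * r ^ 6) <= 0).
    { replace (- / r ^ 2 + 5 * x ^ 2 / (4 * r ^ 4) - / (2 * r ^ 2) - / (2 * r ^ 3) + x ^ 2 / r ^ 5
       + x ^ 2 / (16 * r ^ 6)) with (- (i ^ 2 * (3 / 2 - 5 / 4 * z + i / 2 - z * i - z * i ^ 2 / 16)))
       by (unfold z, i; field; lra).
      assert (0 <= i ^ 2 * (3 / 2 - 5 / 4 * z + i / 2 - z * i - z * i ^ 2 / 16)); [|lra].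
      apply Rmult_le_pos; [apply pow2_ge_0|].
      assert (z * i <= 1 * i) by nra.
      assert (i ^ 2 <= i) by nra.
      assert (z * i ^ 2 <= 1 * i) by nra. lra. }
    assert (P2 : 2 / 3 <= w0).
    { unfold w0. assert (1 <= r / x) by (apply le_div; lra).
      replace (x / (2 * r ^ 2)) with (x * i * i / 2) by (unfold i; field; lra).
      replace (x / (4 * r ^ 3)) with (x * i * i * i / 4) by (unfold i; field; lra).
      assert (x * i <= 1) by (unfold i; apply (div_le x); lra).
      assert (x * i * i <= 1 * i) by nra.
      nra. }
    (* The contribution of the [27] has the right sign because [2/x <= 2/3 <= w0] and, where the
       barrier is tested, [w > psi > 0]. *)
    assert (P3 : 27 / x ^ 3 * (2 / x - w0 - w x) <= 0).
    { assert (0 < 27 / x ^ 3) by pos.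
      nra. }
    lra.
Qed.

Lemma sqrt_bounds (x q : R) : 0 <= x -> 0 < q -> q ^ 2 = 1 + x -> 1 + x / 2 - x ^ 2 / 8 <= q <= 1 + x / 2.
Proof.
  intros Hx Hq E. split; [|nra].
  apply Rnot_lt_le. intros Hlt.
  assert (Hx8 : x < 8) by nra.
  assert (q ^ 2 < (1 + x / 2 - x ^ 2 / 8) ^ 2) by nra.
  assert (0 <= x ^ 3 * (8 - x)) by pos.
  replace ((1 + x / 2 - x ^ 2 / 8) ^ 2) with (1 + x - x ^ 3 * (8 - x) / 64) in H by field. lra.
Qed.

(** With [y = k^2/s] one has [r/s = sqrt (1 + y/s)]; the second-order lower bound of the root turns
    Debye's expansion into one in [y], and the other corrections are [O(1/s^2)]. *)
Lemma score_lower (s : R) : 3 <= s ->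
  (INR k ^ 2 / s - 1) / (2 * s) - ((INR k ^ 2 / s) ^ 2 / 8 + 10) / s ^ 2 <= score k s.
Proof.
  intros Hs. pose proof (psi_lower s Hs) as H. destruct (rad_props s ltac:(lra)) as (R1 & R2 & R3).
  set (r := rad s) in *. set (y := INR k ^ 2 / s).
  assert (Hy : 0 <= y) by (apply Rmult_le_pos; [apply pow2_ge_0|left; apply Rinv_0_lt_compat; lra]).
  destruct (sqrt_bounds (y / s) (r / s)) as [B1 _].
  - pos.
  - pos.
  - unfold y. replace ((r / s) ^ 2) with (r ^ 2 / s ^ 2) by (field; lra). rewrite R2. field. lra.
  - assert (C1 : s / (2 * r ^ 2) <= / (2 * s)).
    { apply div_le; [pos|].
      replace s with (/ (2 * s) * (2 * s ^ 2)) at 1 by (field; lra).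
      apply Rmult_le_compat_l; [pos|]. nra. }
    assert (C2 : s / (4 * r ^ 3) <= / (4 * s ^ 2)).
    { apply div_le; [pos|].
      replace s with (/ (4 * s ^ 2) * (4 * s ^ 3)) at 1 by (field; lra).
      apply Rmult_le_compat_l; [pos|].
      pose proof (pow_incr s r 3 ltac:(lra)). lra. }
    assert (C3 : 27 / s ^ 3 <= 9 / s ^ 2).
    { apply div_le; [pos|]. replace (9 / s ^ 2 * s ^ 3) with (9 * s) by (field; lra). lra. }
    replace ((y - 1) / (2 * s) - (y ^ 2 / 8 + 10) / s ^ 2) with
      ((1 + y / s / 2 - (y / s) ^ 2 / 8) - / (2 * s) - / (4 * s ^ 2) - 9 / s ^ 2 - 1 - 3 / 4 / s ^ 2) by (field; lra).
    assert (0 < 3 / 4 / s ^ 2) by pos. lra.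
Qed.

(** The Riccati equation expresses the derivative through [psi], so a lower bound of [psi] gives an
    upper bound here. One side is enough to keep the denominator of the Newton step away from [0].
    The [3/4] is the maximum of [t^2 - t^4/4] for [t = s/r <= 1]. *)
Lemma score1_upper (s : R) : 3 <= s ->
  s ^ 2 * score1 k s <= 3 / 4 - INR k ^ 2 / s + 73 * (1 + (INR k ^ 2 / s) ^ 2) / s.
Proof.
  intros Hs. pose proof (psi_lower s Hs) as H. rewrite psi_riccati by lra.
  set (psi := score k s + 1) in *. destruct (rad_props s ltac:(lra)) as (R1 & R2 & R3).
  set (r := rad s) in *. set (y := INR k ^ 2 / s).
  assert (Hy : 0 <= y) by (apply Rmult_le_pos; [apply pow2_ge_0|left; apply Rinv_0_lt_compat; lra]).
  set (p := r / s - s / (2 * r ^ 2)). set (e := s / (4 * r ^ 3) + 27 / s ^ 3).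
  assert (Hp : 0 <= p <= r / s).
  { unfold p. assert (1 <= r / s) by (apply le_div; lra).
    assert (0 < r ^ 2) by pos.
    assert (0 <= s / (2 * r ^ 2) <= 1); [|lra]. split; [pos|].
    apply div_le; [lra|]. nra. }
  assert (He : 0 <= e).
  { unfold e. apply Rplus_le_le_0_compat; (apply Rmult_le_pos; [lra|left; apply Rinv_0_lt_compat]).
    - apply Rmult_lt_0_compat; [lra|apply pow_lt; lra].
    - pos. }
  assert (A1 : p - e <= psi) by (unfold p, e; lra).
  (* tangent to the parabola at [p] *)
  assert (A2 : 2 * p * psi - p ^ 2 <= psi ^ 2) by (pose proof (pow2_ge_0 (psi - p)); nra).
  assert (Hsi : 0 < / s) by pos.
  assert (A3 : 1 + INR k ^ 2 / s ^ 2 - psi / s - psi ^ 2 <=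
    r ^ 2 / s ^ 2 - p ^ 2 - p / s + e * (/ s + 2 * (r / s))).
  { replace (1 + INR k ^ 2 / s ^ 2) with (r ^ 2 / s ^ 2) by (rewrite R2; field; lra).
    assert ((p - e) * (/ s + 2 * p) <= psi * (/ s + 2 * p)) by nra.
    assert (e * (2 * p) <= e * (2 * (r / s))) by nra.
    unfold Rdiv in *. lra. }
  assert (Hs2 : 0 < s ^ 2) by pos.
  eapply Rle_trans; [apply Rmult_le_compat_l; [lra|exact A3]|].
  set (t := s / r).
  assert (Ht : 0 < t <= 1) by (unfold t; split; [pos|apply div_le; lra]).
  destruct (sqrt_bounds (y / s) (r / s)) as [_ B2].
  { pos. }
  { pos. }
  { unfold y. replace ((r / s) ^ 2) with (r ^ 2 / s ^ 2) by (field; lra). rewrite R2. field. lra. }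
  assert (Et : t * (r / s) = 1) by (unfold t; field; lra).
  assert (B3 : 1 - y / s / 2 <= t).
  {
    nra. }
  assert (Ek : INR k ^ 2 = y * s) by (unfold y; field; lra).
  replace (s ^ 2 * (r ^ 2 / s ^ 2 - p ^ 2 - p / s + e * (/ s + 2 * (r / s)))) with
    (- (r ^ 2 - s ^ 2) / r + (t ^ 2 - t ^ 4 / 4) + (t ^ 3 / 4 + 54 * (r / s) + 27 * / s) * / s).
  2:{ unfold p, e, t. field. lra. }
  rewrite R2, Ek. replace (- (s ^ 2 + y * s - s ^ 2) / r) with (- (y * t)) by (unfold t; field; lra).
  assert (T2 : 0 <= t ^ 2 <= 1) by nra.
  assert (T3 : 0 <= t ^ 3 <= 1) by nra.
  assert (Q1 : t ^ 2 - t ^ 4 / 4 <= 3 / 4) by nra.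
  assert (Q2 : - (y * t) <= - y + y ^ 2 * / s / 2) by nra.
  assert (Hs3 : / s <= / 3) by (apply Rinv_le_contravar; lra).
  assert (Q3 : t ^ 3 / 4 + 54 * (r / s) + 27 * / s <= 64 + 9 * y) by nra.
  assert (Q4 : (t ^ 3 / 4 + 54 * (r / s) + 27 * / s) * / s <= (64 + 9 * y) * / s) by nra.
  (* [73 = 64 + 9], with [y <= 1 + y^2]. *)
  assert (Q5 : (64 + 9 * y + y ^ 2 / 2) * / s <= 73 * (1 + y ^ 2) * / s).
  { apply Rmult_le_compat_r; [lra|]. nra. }
  unfold Rdiv at 5. lra.
Qed.

End Debye.

(** * The normalised one-step estimator *)

Lemma ln_fD_derive (D t : R) (k : Z) : 0 < t -> 0 < D ->
  is_derive (fun t => ln (fD D t k)) t (D * score (Z.abs_nat k) (t * D)).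
Proof.
  intros Ht HD. evar_last.
  { apply (derive_comp (fun s => ln (pmf (Z.abs_nat k) s)) (fun t => t * D)).
    - apply ln_pmf_derive, Rmult_lt_0_compat; assumption.
    - auto_derive; [auto|reflexivity]. }
  ring.
Qed.

Lemma dlogf_eq (D t : R) (k : Z) : 0 < t -> 0 < D -> dlogf D t k = D * score (Z.abs_nat k) (t * D).
Proof. intros Ht HD. apply deriv_unique, ln_fD_derive; assumption. Qed.

Lemma d2logf_eq (D t : R) (k : Z) : 0 < t -> 0 < D ->
  d2logf D t k = D ^ 2 * score1 (Z.abs_nat k) (t * D).
Proof.
  intros Ht HD. apply deriv_unique.
  (* The inner [deriv] is known only at positive arguments, so the two functions are compared in a
     neighbourhood of [t]. *)
  apply (is_derive_ext_loc (fun t => D * score (Z.abs_nat k) (t * D))).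
  - exists (mkposreal t Ht). intros z Hz. apply Rabs_lt_between' in Hz. simpl in Hz.
    symmetry. apply deriv_unique, ln_fD_derive; lra.
  - evar_last.
    { apply (is_derive_scal (fun t => score (Z.abs_nat k) (t * D))).
      apply (derive_comp (score (Z.abs_nat k)) (fun t => t * D)).
      - apply score_derive, Rmult_lt_0_compat; assumption.
      - auto_derive; [auto|reflexivity]. }
    ring.
Qed.

Lemma IZR_sqr_abs_nat (y : Z) : IZR y ^ 2 = INR (Z.abs_nat y) ^ 2.
Proof. rewrite INR_IZR_INZ, Zabs2Nat.id_abs, abs_IZR, pow2_abs. reflexivity. Qed.

Definition onabs (g : nat -> R) (k : Z) : R := g (Z.abs_nat k).

Lemma QV_onabs (T : R) (Y : list Z) : QV T Y = / T * ssum (onabs (fun k => INR k ^ 2)) Y.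
Proof. unfold QV. f_equal. apply sumL_ext. intros y. apply IZR_sqr_abs_nat. Qed.

Lemma ssum_scal c f Y : ssum (fun k => c * f k) Y = c * ssum f Y.
Proof. apply sumL_scal. Qed.
Lemma ssum_plus f g Y : ssum (fun k => f k + g k) Y = ssum f Y + ssum g Y.
Proof. apply sumL_plus. Qed.
Lemma ssum_const c Y : ssum (fun _ => c) Y = INR (length Y) * c.
Proof. apply sumL_const. Qed.
Lemma ssum_ext f g Y : (forall k, f k = g k) -> ssum f Y = ssum g Y.
Proof. apply sumL_ext. Qed.
Lemma ssum_le f g Y : (forall k, f k <= g k) -> ssum f Y <= ssum g Y.
Proof. apply sumL_le. Qed.
Lemma ssum_abs f Y : Rabs (ssum f Y) <= ssum (fun k => Rabs (f k)) Y.
Proof. apply sumL_abs. Qed.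

(* Score and its derivative in the normalised parameter [r = theta'/theta], with [l = theta Delta]. *)
Definition rscore (l r : R) (k : nat) : R := l * score k (l * r).
Definition rscore1 (l r : R) (k : nat) : R := l ^ 2 * score1 k (l * r).

Lemma rscore_derive (l r : R) (k : nat) : 0 < l -> 0 < r -> is_derive (fun r => rscore l r k) r (rscore1 l r k).
Proof.
  intros Hl Hr. unfold rscore, rscore1. evar_last.
  { apply (is_derive_scal (fun r => score k (l * r))).
    apply (derive_comp (score k) (fun r => l * r)).
    - apply score_derive, Rmult_lt_0_compat; assumption.
    - auto_derive; [auto|reflexivity]. }
  ring.
Qed.

Lemma ssum_rscore_derive (l r : R) (Y : list Z) : 0 < l -> 0 < r ->
  is_derive (fun r => ssum (onabs (rscore l r)) Y) r (ssum (onabs (rscore1 l r)) Y).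
Proof.
  intros Hl Hr. induction Y as [|y Y IH].
  - exact (derive_const 0 r).
  - apply (derive_plus (fun r => rscore l r (Z.abs_nat y)));
      [apply rscore_derive; assumption|exact IH].
Qed.

(** The derivative in [r] is [2 k / r^3 + l^3 ratio1'(l r)]: on [r >= 1/2] the first term is at most
    [16 k], and [ratio2_bound] supplies the [3]. *)
Lemma rscore1_lipschitz (l r r' : R) (k : nat) : 0 < l -> 1 / 2 <= r -> 1 / 2 <= r' ->
  Rabs (rscore1 l r k - rscore1 l r' k) <= (16 * INR k + 3 * l ^ 3) * Rabs (r - r').
Proof.
  intros Hl Hr Hr'.
  assert (H : forall x, 1 / 2 <= x -> exists d, is_derive (fun x => rscore1 l x k) x d
     /\ Rabs d <= 16 * INR k + 3 * l ^ 3).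
  { intros x Hx. assert (Hlx : 0 < l * x) by pos.
    destruct (ratio2_bound k (l * x) Hlx) as (d & Hd & Hb).
    exists (2 * INR k / x ^ 3 + l ^ 3 * d). split.
    - apply (is_derive_ext_loc (fun x => - INR k / x ^ 2 + l ^ 2 * ratio1 k (l * x))).
      { exists (mkposreal x ltac:(lra)). intros z Hz. apply Rabs_lt_between' in Hz. simpl in Hz.
        eq_in_R. unfold rscore1, score1. field. lra. }
      evar_last.
      { apply (derive_plus (fun x => - INR k / x ^ 2)).
        - instantiate (1 := 2 * INR k / x ^ 3). auto_derive; [apply Rgt_not_eq; nra|field; lra].
        - apply (is_derive_scal (fun x => ratio1 k (l * x))).
          apply (derive_comp (ratio1 k) (fun x => l * x)); [exact Hd|].
          auto_derive; [auto|reflexivity]. }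
      ring.
    - eapply Rle_trans; [apply Rabs_triang|]. apply Rplus_le_compat.
      + assert (Hx3 : 1 / 8 <= x ^ 3) by nra.
        pose proof (pos_INR k).
        rewrite Rabs_pos_eq by pos.
        apply div_le; [lra|]. nra.
      + rewrite Rabs_mult, Rabs_pos_eq by pos.
        rewrite (Rmult_comm 3). apply Rmult_le_compat_l; [pos|exact Hb]. }
  destruct (mvt (fun x => rscore1 l x k) (Derive (fun x => rscore1 l x k)) r' r) as [c [Hc E]].
  - intros x Hx. assert (1 / 2 <= x) by (unfold Rmin in Hx; destruct Rle_dec; lra).
    destruct (H x H0) as (d & Hd & _). apply Derive_correct. exists d. exact Hd.
  - assert (1 / 2 <= c) by (unfold Rmin in Hc; destruct Rle_dec; lra).
    destruct (H c H0) as (d & Hd & Hb). apply is_derive_unique in Hd. simpl in E, Hd.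
    rewrite E, Hd, Rabs_mult. apply Rmult_le_compat_r; [apply Rabs_pos|exact Hb].
Qed.

Lemma ssum_rscore1_lipschitz (l r r' : R) (Y : list Z) : 0 < l -> 1 / 2 <= r -> 1 / 2 <= r' ->
  Rabs (ssum (onabs (rscore1 l r)) Y - ssum (onabs (rscore1 l r')) Y) <=
  ssum (onabs (fun k => 16 * INR k + 3 * l ^ 3)) Y * Rabs (r - r').
Proof.
  intros Hl Hr Hr'.
  replace (ssum (onabs (rscore1 l r)) Y - ssum (onabs (rscore1 l r')) Y) with
    (ssum (fun k => onabs (rscore1 l r) k + -1 * onabs (rscore1 l r') k) Y) by (rewrite ssum_plus, ssum_scal; ring).
  eapply Rle_trans; [apply ssum_abs|].
  rewrite Rmult_comm, <- ssum_scal. apply ssum_le. intros k. unfold onabs.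
  replace (rscore1 l r (Z.abs_nat k) + -1 * rscore1 l r' (Z.abs_nat k))
    with (rscore1 l r (Z.abs_nat k) - rscore1 l r' (Z.abs_nat k)) by ring.
  rewrite Rmult_comm. apply rscore1_lipschitz; assumption.
Qed.

Lemma OS_eq (D T th r : R) (Y : list Z) : 0 < th -> 0 < D -> 0 < r -> QV T Y = th * r ->
  OS D T Y - th = th * (r - 1 - ssum (onabs (rscore (th * D) r)) Y / ssum (onabs (rscore1 (th * D) r)) Y).
Proof.
  intros Hth HD Hr HQ. unfold OS. rewrite HQ.
  assert (Hq : 0 < th * r) by pos.
  replace (map (fun y => dlogf D (th * r) y) Y) with
    (map (fun y => / th * onabs (rscore (th * D) r) y) Y).
  2:{ apply map_ext. intros y. rewrite dlogf_eq by assumption. unfold onabs, rscore.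
      replace (th * r * D) with (th * D * r) by ring. field. lra. }
  replace (map (fun y => d2logf D (th * r) y) Y) with
    (map (fun y => / th ^ 2 * onabs (rscore1 (th * D) r) y) Y).
  2:{ apply map_ext. intros y. rewrite d2logf_eq by assumption. unfold onabs, rscore1.
      replace (th * r * D) with (th * D * r) by ring. field. lra. }
  rewrite !sumL_scal. unfold ssum. set (A := sumL _). set (B := sumL _).
  (* [/ B] is kept as an opaque factor, so the identity also holds when the denominator [B] is
     zero. *)
  unfold Rdiv. rewrite Rinv_mult, Rinv_inv. generalize (/ B). intros C. field. lra.
Qed.

(** * Truncated expectations in the model *)

Section Model.
Variables (th : R) (D : R -> R).
Hypothesis th_pos : 0 < th.
Hypothesis D_pos : forall T, 0 < D T.

Definition lam (T : R) : R := th * D T.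
Definition nobsI (i : R * nat) : nat := nobs (fst i) (D (fst i)).
Definition nn (T : R) : R := INR (nobs T (D T)).
Definition pmfI (i : R * nat) : Z -> R := fD (D (fst i)) th.
Definition EX (i : R * nat) (g : nat -> R) : R := wsum (snd i) (fun k => pmf k (lam (fst i)) * g k).

Lemma lam_pos T : 0 < lam T.
Proof. apply Rmult_lt_0_compat; [exact th_pos|apply D_pos]. Qed.

Lemma pmfI_nonneg i k : 0 <= pmfI i k.
Proof. apply pmf_nonneg. left; apply lam_pos. Qed.

Lemma EZ_EX i g : EZ (snd i) (pmfI i) (onabs g) = EX i g.
Proof. apply EZ_fD. Qed.

Lemma EX_1_le i : EX i (fun _ => 1) <= 1.
Proof.
  eapply Rle_trans; [|apply (mass_le_1 (snd i) (lam (fst i))); left; apply lam_pos].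
  right. apply wsum_ext. intros; ring.
Qed.

Lemma pmfI_mass i : EZ (snd i) (pmfI i) (fun _ => 1) <= 1.
Proof. change (EZ (snd i) (pmfI i) (onabs (fun _ => 1)) <= 1). rewrite EZ_EX. apply EX_1_le. Qed.

Lemma EX_le i g h : (forall k, g k <= h k) -> EX i g <= EX i h.
Proof.
  intros H. apply wsum_le. intros k. apply Rmult_le_compat_l; [apply pmf_nonneg; left; apply lam_pos|apply H].
Qed.

Lemma EX_plus i g h : EX i (fun k => g k + h k) = EX i g + EX i h.
Proof. unfold EX. rewrite <- wsum_plus. apply wsum_ext. intros; ring. Qed.

Lemma EX_scal i c g : EX i (fun k => c * g k) = c * EX i g.
Proof. unfold EX. rewrite <- wsum_scal. apply wsum_ext. intros; ring. Qed.

Lemma EX_ext i g h : (forall k, g k = h k) -> EX i g = EX i h.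
Proof. intros H. apply wsum_ext. intros; rewrite H; ring. Qed.

Lemma EX_const i c : 0 <= c -> EX i (fun _ => c) <= c.
Proof.
  intros H. rewrite (EX_ext i _ (fun _ => c * 1)) by (intros; ring). rewrite EX_scal.
  pose proof (EX_1_le i). nra.
Qed.

Lemma EX_nonneg i g : (forall k, 0 <= g k) -> 0 <= EX i g.
Proof.
  intros H. apply wsum_nonneg. intros k. apply Rmult_le_pos; [apply pmf_nonneg; left; apply lam_pos|apply H].
Qed.

Lemma EX_mom i j : EX i (fun k => INR k ^ j) = moment j (snd i) (lam (fst i)).
Proof. apply wsum_ext. intros; ring. Qed.

Lemma EX_mom2 i : EX i (fun k => INR k ^ 2) <= lam (fst i).
Proof. rewrite EX_mom. apply moment2_le. left; apply lam_pos. Qed.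

Lemma EX_mom1 i : EX i (fun k => INR k) <= lam (fst i).
Proof.
  rewrite (EX_ext i _ (fun k => INR k ^ 1)) by (intros; ring). rewrite EX_mom.
  eapply Rle_trans; [apply (moment_le_mono 1 2); [left; apply lam_pos|lia]|]. apply moment2_le. left; apply lam_pos.
Qed.

Lemma EX_mom4 i : EX i (fun k => INR k ^ 4) <= 3 * lam (fst i) ^ 2 + lam (fst i).
Proof. rewrite EX_mom. apply moment4_le. left; apply lam_pos. Qed.

Lemma EX_mom3 i : EX i (fun k => INR k ^ 3) <= 3 * lam (fst i) ^ 2 + lam (fst i).
Proof.
  rewrite EX_mom.
  eapply Rle_trans; [apply (moment_le_mono 3 4); [left; apply lam_pos|lia]|]. apply moment4_le. left; apply lam_pos.
Qed.

Lemma EX_mom6 i : EX i (fun k => INR k ^ 6) <=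
  15 * lam (fst i) ^ 3 + 15 * lam (fst i) ^ 2 + lam (fst i).
Proof. rewrite EX_mom. apply moment6_le. left; apply lam_pos. Qed.

Lemma EX_lim_1 T : is_lim_seq (fun M => EX (T, M) (fun _ => 1)) 1.
Proof.
  eapply is_lim_seq_ext; [|apply (mass_lim (lam T)); left; apply lam_pos].
  intros M. apply wsum_ext. intros; simpl; ring.
Qed.

Lemma EX_lim_2 T : is_lim_seq (fun M => EX (T, M) (fun k => INR k ^ 2)) (lam T).
Proof.
  eapply is_lim_seq_ext; [|apply (moment2_lim (lam T)); left; apply lam_pos].
  intros M. symmetry. apply EX_mom.
Qed.

Lemma EX_lim_4 T : is_lim_seq (fun M => EX (T, M) (fun k => INR k ^ 4)) (3 * lam T ^ 2 + lam T).
Proof.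
  eapply is_lim_seq_ext; [|apply (moment4_lim (lam T)); left; apply lam_pos].
  intros M. symmetry. apply EX_mom.
Qed.

Lemma EX_lim_score T : is_lim_seq (fun M => EX (T, M) (fun k => score k (lam T))) 0.
Proof. apply (E_score_lim (lam T) (lam_pos T)). Qed.

Lemma EX_lim_score2 T : is_lim_seq (fun M => EX (T, M) (fun k => score k (lam T) ^ 2)) (fisher (lam T)).
Proof. apply (fisherM_lim (lam T) (lam_pos T)). Qed.

Lemma EX_lim_score1 T : is_lim_seq (fun M => EX (T, M) (fun k => score1 k (lam T))) (- fisher (lam T)).
Proof. apply (E_score1_lim (lam T) (lam_pos T)). Qed.

Lemma nn_bounds T : 0 <= T -> T / D T - 1 < nn T <= T / D T.
Proof.
  intros HT. unfold nn, nobs. pose proof (base_Int_part (T / D T)) as [H1 H2].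
  assert (0 <= T / D T) by (apply Rmult_le_pos; [exact HT|left; apply Rinv_0_lt_compat, D_pos]).
  assert (0 <= Int_part (T / D T))%Z.
  { assert (-1 < Int_part (T / D T))%Z; [|lia]. apply lt_IZR. lra. }
  rewrite INR_IZR_INZ, Z2Nat.id by assumption. lra.
Qed.

Lemma nn_nonneg T : 0 <= nn T.
Proof. apply pos_INR. Qed.

Lemma EE_ssum_sqr i g :
  EE nobsI snd pmfI i (fun Y => ssum (onabs g) Y ^ 2) <=
  nn (fst i) * EX i (fun k => g k ^ 2) + nn (fst i) ^ 2 * EX i g ^ 2.
Proof.
  unfold EE. eapply Rle_trans; [apply EZn_ssum_sqr; [apply pmfI_nonneg|apply pmfI_mass]|].
  change (fun k => onabs g k ^ 2) with (onabs (fun k => g k ^ 2)). rewrite !EZ_EX. right. reflexivity.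
Qed.

Lemma lind_err_EX i g h : lind_err (snd i) (pmfI i) (onabs g) h =
  (1 - EX i (fun _ => 1)) + Rabs (EX i g) + Rabs (EX i (fun k => g k ^ 2) - h)
  + EX i (fun k => Rabs (g k) ^ 3) + h ^ 2.
Proof.
  unfold lind_err. change (fun _ : Z => 1) with (onabs (fun _ => 1)).
  change (fun k => onabs g k ^ 2) with (onabs (fun k => g k ^ 2)).
  change (fun k => Rabs (onabs g k) ^ 3) with (onabs (fun k => Rabs (g k) ^ 3)).
  rewrite !EZ_EX. reflexivity.
Qed.

Lemma lim_seq_scal0 (u : nat -> R) (c : R) : is_lim_seq u 0 -> is_lim_seq (fun M => c * u M) 0.
Proof.
  intros H. replace (Finite 0) with (Rbar_mult c 0) by (simpl; f_equal; ring).
  apply is_lim_seq_scal_l, H.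
Qed.

Lemma lim_seq_sqr0 (u : nat -> R) : is_lim_seq u 0 -> is_lim_seq (fun M => u M ^ 2) 0.
Proof.
  intros H. apply is_lim_seq_ext with (fun M => u M * u M); [intros; ring|].
  replace (Finite 0) with (Finite (0 * 0)) by (f_equal; ring). apply is_lim_seq_mult'; exact H.
Qed.

(* If, for fixed [T], the first three error terms vanish as [M -> oo], only the third moment matters. *)
Lemma clt_model (g : R -> nat -> R) (v t3 : R -> R) :
  cvinf FT nn ->
  (forall T, is_lim_seq (fun M => EX (T, M) (g T)) 0) ->
  (forall T, is_lim_seq (fun M => EX (T, M) (fun k => g T k ^ 2)) (v T)) ->
  cv FT (fun T => nn T * v T) 1 ->
  FT (fun T => forall M, nn T * EX (T, M) (fun k => Rabs (g T k) ^ 3) <= t3 T) ->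
  cv FT t3 0 ->
  asymp_normal (F := FTM) nobsI snd pmfI (fun i Y => ssum (onabs (g (fst i))) Y).
Proof.
  intros Hn Hm Hv Hv1 H3 Ht3.
  apply (clt (F := FTM) nobsI snd pmfI pmfI_nonneg pmfI_mass (fun i => onabs (g (fst i)))).
  - apply (FTM_fst (fun T => (1 <= nobs T (D T))%nat)). generalize (Hn 0). apply filter_imp.
    intros T HT. apply (INR_lt 0) in HT. exact HT.
  - apply (cv_ext (fun i => (nn (fst i) * (1 - EX i (fun _ => 1)) + nn (fst i) * Rabs (EX i (g (fst i)))
      + nn (fst i) * Rabs (EX i (fun k => g (fst i) k ^ 2) - / nn (fst i)))
      + (nn (fst i) * EX i (fun k => Rabs (g (fst i) k) ^ 3) + nn (fst i) * (/ nn (fst i)) ^ 2))).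
    { apply filter_forall. intros i. rewrite lind_err_EX. unfold nn, nobsI. ring. }
    replace 0 with (0 + (0 + 0)) by ring. apply cv_plus; [|apply cv_plus].
    + apply (cv_iter _ (fun T => Rabs (nn T * v T - 1))).
      * generalize (Hn 0). apply filter_imp. intros T HT. cbn [fst snd].
        replace (Finite (Rabs (nn T * v T - 1))) with
          (Finite (0 + 0 + nn T * Rabs (v T - / nn T))).
        2:{ f_equal. rewrite !Rplus_0_l. rewrite <- (Rabs_pos_eq (nn T)) at 1 by lra.
            rewrite <- Rabs_mult. f_equal. field. lra. }
        apply is_lim_seq_plus'; [apply is_lim_seq_plus'|].
        -- apply lim_seq_scal0. replace (Finite 0) with (Finite (1 - 1)) by (f_equal; ring).
           apply is_lim_seq_minus'; [apply is_lim_seq_const|apply EX_lim_1].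
        -- apply lim_seq_scal0. apply (proj1 (is_lim_seq_abs_0 _)), Hm.
        -- apply (is_lim_seq_scal_l _ (nn T) (Rabs (v T - / nn T))).
           apply (is_lim_seq_abs _ (v T - / nn T)).
           apply is_lim_seq_minus'; [apply Hv|apply is_lim_seq_const].
      * replace 0 with (Rabs (1 - 1)) by (rewrite Rminus_diag; apply Rabs_R0).
        apply cv_abs, cv_minus; [exact Hv1|apply cv_const].
    + apply cv_squeeze with (fun i => t3 (fst i)); [|apply (cv_fst t3), Ht3].
      revert H3. unfold FTM. apply filter_imp. intros T H3. apply filter_forall. intros M.
      rewrite Rminus_0_r, Rabs_pos_eq; [apply H3|]. apply Rmult_le_pos; [apply nn_nonneg|].
      apply EX_nonneg. intros k. pos.
    + apply (cv_fst (fun T => nn T * (/ nn T) ^ 2)).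
      apply (cv_ext (fun T => / nn T)); [|apply cvinf_inv, Hn].
      generalize (Hn 0). apply filter_imp. intros T HT. field. lra.
Qed.

(** The second moment of the sum is at most [n] times a truncated second moment with limit [v],
    where [n v -> 1], plus a squared mean that vanishes as [M -> oo]. *)
Lemma tight_model (g : R -> nat -> R) (v : R -> R) :
  cvinf FT nn ->
  (forall T, is_lim_seq (fun M => EX (T, M) (g T)) 0) ->
  (forall T, is_lim_seq (fun M => EX (T, M) (fun k => g T k ^ 2)) (v T)) ->
  cv FT (fun T => nn T * v T) 1 ->
  tight (F := FTM) nobsI snd pmfI (fun i Y => ssum (onabs (g (fst i))) Y).
Proof.
  intros Hn Hm Hv Hv1. apply (tight_sqr (F := FTM) _ _ _ pmfI_nonneg) with (1 + 0 + 1).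
  assert (C : cv FTM (fun i => nn (fst i) * EX i (fun k => g (fst i) k ^ 2)
    + nn (fst i) ^ 2 * EX i (g (fst i)) ^ 2) (1 + 0)).
  { apply cv_plus.
    - apply (cv_iter _ (fun T => nn T * v T)); [|exact Hv1]. apply filter_forall. intros T.
      apply (is_lim_seq_scal_l _ (nn T) (v T)), Hv.
    - apply (cv_iter _ (fun _ => 0)); [|apply cv_const]. apply filter_forall. intros T. cbn [fst].
      apply lim_seq_scal0, lim_seq_sqr0, Hm. }
  generalize (C 1 Rlt_0_1). apply filter_imp. intros i Hi. apply Rabs_lt_between in Hi.
  eapply Rle_trans; [apply EE_ssum_sqr|lra].
Qed.

Local Notation smallM := (small (F := FTM) nobsI snd pmfI).
Local Notation tightM := (tight (F := FTM) nobsI snd pmfI).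
Local Notation normalM := (asymp_normal (F := FTM) nobsI snd pmfI).
Local Notation Ex := (EE nobsI snd pmfI).

Lemma conv_of_slutsky (I : R -> R) (Z : R * nat -> list BinInt.Z -> R) :
  normalM Z -> smallM (fun i Y => sqrt (I (fst i)) * (OS (D (fst i)) (fst i) Y - th) - Z i Y) ->
  conv_std_normal D th I.
Proof.
  intros HZ HV x. apply (prob_le_cv D th (fun T Y => sqrt (I T) * (OS (D T) T Y - th))).
  - intros T. left. apply lam_pos.
  - apply (slutsky (F := FTM) nobsI snd pmfI pmfI_nonneg pmfI_mass _ Z HZ HV).
Qed.

Definition relQV (T : R) (Y : list Z) : R := QV T Y / th.

(** The second summand is a deterministic bias: the [n = floor(T/D)] intervals cover only
    [n D <= T], while [QV] is divided by [T]. *)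
Lemma relQV_ssum (T : R) (Y : list Z) : 0 < T -> length Y = nobs T (D T) ->
  relQV T Y - 1 = / (T * th) * ssum (onabs (fun k => INR k ^ 2 - lam T)) Y + (nn T * D T / T - 1).
Proof.
  intros HT HY. unfold relQV. rewrite QV_onabs.
  rewrite (ssum_ext (onabs (fun k => INR k ^ 2 - lam T)) (fun k => onabs (fun k => INR k ^ 2) k + - lam T))
    by (intros; unfold onabs; ring).
  rewrite ssum_plus, ssum_const, HY. unfold lam. fold (nn T). field. lra.
Qed.

Lemma EX_centered i : EX i (fun k => (INR k ^ 2 - lam (fst i)) ^ 2) <= 4 * lam (fst i) ^ 2 + lam (fst i).
Proof.
  pose proof (lam_pos (fst i)) as Hl.
  apply Rle_trans with (EX i (fun k => INR k ^ 4 + lam (fst i) ^ 2)).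
  - apply EX_le. intros k. nra.
  - rewrite EX_plus. pose proof (EX_mom4 i) as H4.
    pose proof (EX_const i (lam (fst i) ^ 2) (pow2_ge_0 _)). lra.
Qed.

Lemma EX_lim_centered T : is_lim_seq (fun M => EX (T, M) (fun k => INR k ^ 2 - lam T)) 0.
Proof.
  apply is_lim_seq_ext with (fun M => EX (T, M) (fun k => INR k ^ 2)
    + - lam T * EX (T, M) (fun _ => 1)).
  - intros M. rewrite <- EX_scal, <- EX_plus. apply EX_ext. intros; ring.
  - replace (Finite 0) with (Finite (lam T + - lam T * 1)) by (f_equal; ring).
    apply is_lim_seq_plus'; [apply EX_lim_2|].
    apply (is_lim_seq_scal_l _ (- lam T) 1), EX_lim_1.
Qed.

Lemma relQV_sqr i : 0 < fst i ->
  Ex i (fun Y => (relQV (fst i) Y - 1) ^ 2) <=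
  2 / (fst i * th) ^ 2 * (nn (fst i) * (4 * lam (fst i) ^ 2 + lam (fst i))
    + nn (fst i) ^ 2 * EX i (fun k => INR k ^ 2 - lam (fst i)) ^ 2)
  + 2 * (nn (fst i) * D (fst i) / fst i - 1) ^ 2.
Proof.
  intros HT. set (T := fst i) in *. set (b := nn T * D T / T - 1).
  apply Rle_trans with (Ex i (fun Y => 2 / (T * th) ^ 2 * ssum (onabs (fun k => INR k ^ 2 - lam T)) Y ^ 2
     + 2 * b ^ 2)).
  - apply EZn_le; [apply pmfI_nonneg|]. intros Y HY. rewrite (relQV_ssum T Y HT HY). fold b.
    set (S := ssum _ Y).
    replace (2 / (T * th) ^ 2 * S ^ 2) with (2 * (/ (T * th) * S) ^ 2) by (field; split; lra).
    pose proof (pow2_ge_0 (/ (T * th) * S - b)). lra.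
  - unfold Ex, EE. rewrite EZn_plus, EZn_scal. apply Rplus_le_compat.
    + apply Rmult_le_compat_l; [pos|].
      eapply Rle_trans; [apply EE_ssum_sqr|].
      apply Rplus_le_compat_r, Rmult_le_compat_l; [apply nn_nonneg|].
      apply (EX_centered i).
    + apply EZn_const_le; [apply pmfI_nonneg|apply pmfI_mass|].
      pose proof (pow2_ge_0 b). lra.
Qed.

(** * Regimes (a) and (b) *)

Section RegimeAB.
Variables (L q0 : R) (I : R -> R).
Hypothesis L_pos : 0 < L.
Hypothesis q0_pos : 0 < q0.
(** [nu] is the expected number of jumps in the observed intervals, [q] the information about
    [theta'/theta] per expected jump, and [J] the total; the information about [theta] is then
    [J / theta^2]. *)
Let nu (T : R) : R := nn T * lam T.
Let q (T : R) : R := lam T * fisher (lam T).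
Let J (T : R) : R := nu T * q T.
Hypothesis lam_le : FT (fun T => lam T <= L).
Hypothesis q_lim : cv FT q q0.
Hypothesis I_lim : cv FT (fun T => I T * th ^ 2 / J T) 1.

Lemma FT_ge (A : R) : FT (fun T => A < T).
Proof. exists (A + 1). intros; lra. Qed.

Lemma nu_inf : cvinf FT nu.
Proof.
  intros A. generalize (filter_and _ _ lam_le (FT_ge (Rmax 0 ((A + L) / th)))). apply filter_imp.
  intros T [H1 H2]. pose proof (Rmax_l 0 ((A + L) / th)). pose proof (Rmax_r 0 ((A + L) / th)).
  assert (H3 : (A + L) / th < T) by lra. apply Rlt_div_l in H3; [|lra].
  destruct (nn_bounds T ltac:(lra)) as [Hn _].
  assert (HTD : (T / D T - 1) * lam T = T * th - lam T).
  { unfold lam. field. pose proof (D_pos T). lra. }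
  assert ((T / D T - 1) * lam T < nu T); [|lra].
  apply Rmult_lt_compat_r; [apply lam_pos|exact Hn].
Qed.

Lemma nn_inf : cvinf FT nn.
Proof.
  apply (cvinf_le (fun T => / L * nu T)).
  - generalize lam_le. apply filter_imp. intros T H. unfold nu.
    pose proof (nn_nonneg T) as Hn.
    rewrite Rmult_comm. apply div_le; [exact L_pos|]. apply Rmult_le_compat_l; assumption.
  - apply cvinf_scal; [pos|apply nu_inf].
Qed.

Lemma q_bounds : FT (fun T => q0 / 2 < q T < 2 * q0).
Proof.
  generalize (q_lim (q0 / 2) ltac:(lra)). apply filter_imp. intros T H. apply Rabs_lt_between in H. lra.
Qed.

Lemma J_inf : cvinf FT J.
Proof.
  apply (cvinf_le (fun T => q0 / 2 * nu T)); [|apply cvinf_scal; [lra|apply nu_inf]].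
  generalize (filter_and _ _ q_bounds (nu_inf 0)). apply filter_imp. intros T [H1 H2].
  unfold J. nra.
Qed.

Lemma invq_lim : cv FT (fun T => / q T) (/ q0).
Proof. apply cv_inv; [lra|exact q_lim]. Qed.

Lemma J_eq T : J T = nn T * (lam T ^ 2 * fisher (lam T)).
Proof. unfold J, nu, q. ring. Qed.

Let g (T : R) (k : nat) : R := / sqrt (J T) * (lam T * score k (lam T)).

Lemma score_cube k s : 0 < s -> (s * Rabs (score k s)) ^ 3 <= 4 * (INR k ^ 3 + s ^ 3).
Proof.
  intros H. pose proof (score_abs k s H) as A.
  apply Rle_trans with ((INR k + s) ^ 3).
  - apply pow_incr. split; [pos|].
    replace (INR k + s) with (s * (INR k / s + 1)) by (field; lra). apply Rmult_le_compat_l; lra.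
  -
    (* [4 (k^3 + s^3) - (k + s)^3 = 3 (k + s) (k - s)^2]. *)
    assert (0 <= (INR k + s) * (INR k - s) ^ 2) by pos. nra.
Qed.

Let v (T : R) : R := / sqrt (J T) * / sqrt (J T) * (lam T ^ 2 * fisher (lam T)).

Lemma g_lim T : is_lim_seq (fun M => EX (T, M) (g T)) 0.
Proof.
  apply is_lim_seq_ext with (fun M => / sqrt (J T) * lam T * EX (T, M) (fun k => score k (lam T))).
  - intros M. rewrite <- EX_scal. apply EX_ext. intros k. unfold g. ring.
  - apply lim_seq_scal0, EX_lim_score.
Qed.

Lemma g2_lim T : is_lim_seq (fun M => EX (T, M) (fun k => g T k ^ 2)) (v T).
Proof.
  apply is_lim_seq_ext with
    (fun M => / sqrt (J T) * / sqrt (J T) * lam T ^ 2 * EX (T, M) (fun k => score k (lam T) ^ 2)).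
  - intros M. rewrite <- EX_scal. apply EX_ext. intros k. unfold g. ring.
  - unfold v. rewrite <- Rmult_assoc.
    apply (is_lim_seq_scal_l _ (/ sqrt (J T) * / sqrt (J T) * lam T ^ 2) (fisher (lam T))).
    apply EX_lim_score2.
Qed.

Lemma v_lim : cv FT (fun T => nn T * v T) 1.
Proof.
  apply (cv_ext (fun _ => 1)); [|apply cv_const]. generalize (J_inf 0). apply filter_imp.
  intros T H. destruct (sqrt_sqr (J T) H) as [Hs Hq]. unfold v.
  rewrite (Rmult_comm _ (lam T ^ 2 * _)), <- Rmult_assoc, <- J_eq, <- Rinv_mult, Hq. field. lra.
Qed.

(** For integers [E|k|^3 <= E k^4 = O(l)], so the third-moment term is [O(1 / (q sqrt J))] even when
    [l -> 0]. *)
Lemma Z_normal : normalM (fun i Y => ssum (onabs (g (fst i))) Y).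
Proof.
  apply (clt_model g v (fun T => 4 * (3 * L + 1 + L ^ 2) * (/ q T * / sqrt (J T)))
    nn_inf g_lim g2_lim v_lim).
  - generalize (filter_and _ _ (J_inf 0) (filter_and _ _ lam_le (filter_and _ _ q_bounds (nu_inf 0)))).
    apply filter_imp. intros T (HJ & HL & Hq & Hnu) M.
    destruct (sqrt_sqr (J T) HJ) as [Hs Hs2]. pose proof (lam_pos T) as Hl.
    apply Rle_trans with (nn T * (/ (J T * sqrt (J T)) * (4 * (3 * lam T ^ 2 + lam T + lam T ^ 3)))).
    + apply Rmult_le_compat_l; [apply nn_nonneg|].
      apply Rle_trans with (EX (T, M) (fun k => / (J T * sqrt (J T)) * (4 * INR k ^ 3 + 4 * lam T ^ 3))).
      * apply EX_le. intros k.
        replace (Rabs (g T k) ^ 3) with (/ (J T * sqrt (J T)) * (lam T * Rabs (score k (lam T))) ^ 3).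
        -- apply Rmult_le_compat_l; [pos|].
           pose proof (score_cube k (lam T) Hl). lra.
        -- unfold g. rewrite !Rabs_mult, (Rabs_pos_eq (/ sqrt (J T))), (Rabs_pos_eq (lam T))
             by (lra || (pos)).
           rewrite <- Hs2 at 1. field. lra.
      * rewrite EX_scal. apply Rmult_le_compat_l; [pos|].
        rewrite EX_plus, EX_scal. pose proof (EX_mom3 (T, M)) as H3.
        pose proof (EX_const (T, M) (4 * lam T ^ 3)
          ltac:(pos)).
        cbn [fst] in H3. lra.
    + replace (nn T * (/ (J T * sqrt (J T)) * (4 * (3 * lam T ^ 2 + lam T + lam T ^ 3)))) with
        (4 * (3 * lam T + 1 + lam T ^ 2) * (/ q T * / sqrt (J T))).
      * apply Rmult_le_compat_r.
        -- pos.
        -- assert (lam T ^ 2 <= L ^ 2) by nra. lra.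
      * replace (/ (J T * sqrt (J T))) with (/ (nn T * lam T * q T * sqrt (J T))) by reflexivity.
        assert (0 < nn T) by (pose proof (nn_nonneg T) as Hn; fold nn in Hn; unfold nu in Hnu; nra).
        field. repeat split; lra.
  - replace 0 with (4 * (3 * L + 1 + L ^ 2) * (/ q0 * 0)) by ring. apply cv_scal, cv_mult; [apply invq_lim|].
    apply cvinf_inv, cvinf_sqrt, J_inf.
Qed.

Lemma Z_tight : tightM (fun i Y => ssum (onabs (g (fst i))) Y).
Proof. apply (tight_model g v nn_inf g_lim g2_lim v_lim). Qed.

Lemma A2_tight : tightM (fun i Y => sqrt (nu (fst i)) * (relQV (fst i) Y - 1)).
Proof.
  (* In the constant, [2 (4 L + 1)] stems from the variance, the single [2] covers the truncated
     mean, and [2 L] the rounding of [T / Delta]. *)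
  apply (tight_sqr (F := FTM) _ _ _ pmfI_nonneg) with (2 * (4 * L + 1) + 2 + 2 * L).
  assert (C0 : cv FTM (fun i => nu (fst i) * (2 / (fst i * th) ^ 2) * (nn (fst i) ^ 2 *
     EX i (fun k => INR k ^ 2 - lam (fst i)) ^ 2)) 0).
  { apply (cv_iter _ (fun _ => 0)); [|apply cv_const]. apply filter_forall. intros T. cbn [fst].
    apply lim_seq_scal0, lim_seq_scal0, lim_seq_sqr0. apply EX_lim_centered. }
  generalize (filter_and _ _ (FTM_fst _ (filter_and _ _ lam_le (filter_and _ _ (nu_inf 0)
    (FT_ge (Rmax 0 (L / th)))))) (C0 1 ltac:(lra))). apply filter_imp.
  intros i [(HL & Hnu & HT) HC]. rewrite Rminus_0_r in HC. apply Rabs_lt_between in HC.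
  set (T := fst i) in *.
  pose proof (Rmax_l 0 (L / th)). pose proof (Rmax_r 0 (L / th)).
  assert (HT0 : 0 < T) by lra. assert (HT1 : L / th < T) by lra. apply Rlt_div_l in HT1; [|lra].
  pose proof (lam_pos T) as Hl. pose proof (D_pos T) as HD.
  assert (ED : lam T = th * D T) by reflexivity.
  destruct (nn_bounds T ltac:(lra)) as [Hn1 Hn2].
  pose proof (nn_nonneg T) as Hn.
  assert (Hb1 : nn T * D T <= T) by (apply Rle_div_r; assumption).
  assert (Hb2 : T - D T <= nn T * D T).
  { replace (T - D T) with ((T / D T - 1) * D T) by (field; lra). apply Rmult_le_compat_r; lra. }
  assert (HnuT : nu T <= T * th) by (unfold nu; rewrite ED; nra).
  apply Rle_trans with (nu T * Ex i (fun Y => (relQV T Y - 1) ^ 2)).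
  { right. unfold EE. rewrite <- EZn_scal. apply EZn_ext. intros Y _.
    rewrite Rpow_mult_distr, pow2_sqrt by lra. reflexivity. }
  pose proof (relQV_sqr i HT0) as HR. fold T in HR.
  eapply Rle_trans; [apply Rmult_le_compat_l; [lra|exact HR]|].
  assert (Hp : 0 < (T * th) ^ 2) by pos.
  assert (P1 : nu T * (2 / (T * th) ^ 2) * (nn T * (4 * lam T ^ 2 + lam T)) <= 2 * (4 * L + 1)).
  { replace (nu T * (2 / (T * th) ^ 2) * (nn T * (4 * lam T ^ 2 + lam T))) with
      (2 * nu T ^ 2 * (4 * lam T + 1) / (T * th) ^ 2) by (unfold nu; field; split; lra).
    apply div_le; [exact Hp|].
    assert (nu T ^ 2 <= (T * th) ^ 2) by nra.
    nra. }
  assert (P2 : nu T * (2 * (nn T * D T / T - 1) ^ 2) <= 2 * L).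
  { replace (nu T * (2 * (nn T * D T / T - 1) ^ 2)) with (2 * nu T * (T - nn T * D T) ^ 2 / T ^ 2) by (field; lra).
    assert (HT2 : 0 < T ^ 2) by pos. apply div_le; [exact HT2|].
    assert ((T - nn T * D T) ^ 2 <= D T ^ 2) by nra.
    apply Rle_trans with (2 * (T * th) * D T ^ 2).
    - apply Rmult_le_compat; [lra|apply pow2_ge_0|lra|assumption].
    - replace (2 * (T * th) * D T ^ 2) with (2 * lam T * (T * D T)) by (rewrite ED; ring).
      assert (T * D T <= T ^ 2) by nra.
      apply Rmult_le_compat; try lra. pos. }
  rewrite Rmult_plus_distr_l, <- Rmult_assoc, Rmult_plus_distr_l. lra.
Qed.

(** The summands are the Lipschitz constants of [rscore1]; their sum is of the order of the expected
    number of jumps, as [E|k|] and [l^3] are both [O(l)] for [l <= L]. *)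
Lemma A3_tight : tightM
  (fun i Y => ssum (onabs (fun k => 16 * INR k + 3 * lam (fst i) ^ 3)) Y / nu (fst i)).
Proof.
  apply (tight_abs (F := FTM) _ _ _ pmfI_nonneg) with (16 + 3 * L ^ 2).
  generalize (FTM_fst _ (filter_and _ _ lam_le (nu_inf 0))). apply filter_imp. intros i [HL Hnu].
  set (T := fst i) in *. pose proof (lam_pos T) as Hl. pose proof (nn_nonneg T) as Hn.
  assert (Hpos : forall k, 0 <= 16 * INR k + 3 * lam T ^ 3).
  { intros k. pose proof (pos_INR k). pose proof (pow_le (lam T) 3 ltac:(lra)). lra. }
  destruct (EZn_ssum_le (snd i) (pmfI i) (pmfI_nonneg i) (pmfI_mass i)
    (nobsI i) (onabs (fun k => 16 * INR k + 3 * lam T ^ 3)) ltac:(intros; apply Hpos)) as [_ HB].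
  rewrite EZ_EX in HB.
  apply Rle_trans with (/ nu T * Ex i (fun Y => ssum (onabs (fun k => 16 * INR k + 3 * lam T ^ 3)) Y)).
  - right. unfold EE. rewrite <- EZn_scal. apply EZn_ext. intros Y _.
    rewrite Rabs_pos_eq; [unfold Rdiv; ring|]. apply Rmult_le_pos; [|pos].
    rewrite <- (Rmult_0_r (INR (length Y))), <- ssum_const. apply ssum_le. intros k. apply Hpos.
  - rewrite Rmult_comm. apply div_le; [exact Hnu|]. eapply Rle_trans; [exact HB|].
    change (INR (nobsI i)) with (nn T).
    rewrite EX_plus, EX_scal. pose proof (EX_mom1 i) as H1. change (EX i INR <= lam T) in H1.
    pose proof (EX_const i (3 * lam T ^ 3)
      ltac:(pos)) as H0.
    apply Rle_trans with (nn T * (16 * lam T + 3 * lam T ^ 3)); [apply Rmult_le_compat_l; lra|].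
    unfold nu. replace (nn T * (16 * lam T + 3 * lam T ^ 3)) with ((16 + 3 * lam T ^ 2) * (nn T * lam T)) by ring.
    apply Rmult_le_compat_r; [unfold nu in Hnu; lra|].
    assert (lam T ^ 2 <= L ^ 2) by nra. lra.
Qed.

(** Weak law for the observed information: [l^2 score1] is [- k] up to an error of at most [l^2], so
    the variance of the sum is [O(nu)], against the normalisation [J^2]. *)
Lemma B0_small : smallM
  (fun i Y => / J (fst i) * ssum (onabs (fun k => lam (fst i) ^ 2 * (score1 k (lam (fst i)) + fisher (lam (fst i))))) Y).
Proof.
  apply (small_sqr (F := FTM) _ _ _ pmfI_nonneg).
  set (f := fun T k => lam T ^ 2 * (score1 k (lam T) + fisher (lam T))).
  apply cv_squeeze with (fun i =>
    (4 * (1 + L ^ 3) + 8 * L * q0 ^ 2) * (/ q (fst i) * / J (fst i))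
    + (/ J (fst i)) ^ 2 * (nn (fst i) ^ 2 * EX i (f (fst i)) ^ 2)).
  - generalize (FTM_fst _ (filter_and _ _ lam_le (filter_and _ _ (nu_inf 0) (filter_and _ _ q_bounds (J_inf 0))))).
    apply filter_imp. intros i (HL & Hnu & Hq & HJ).
    set (T := fst i) in *. pose proof (lam_pos T) as Hl. pose proof (nn_nonneg T) as Hn.
    fold (f T).
    rewrite Rminus_0_r, Rabs_pos_eq.
    2:{ apply EZn_nonneg; [apply pmfI_nonneg|apply pmfI_mass|]. intros; apply pow2_ge_0. }
    apply Rle_trans with ((/ J T) ^ 2 * Ex i (fun Y => ssum (onabs (f T)) Y ^ 2)).
    { right. unfold EE. rewrite <- EZn_scal. apply EZn_ext. intros; ring. }
    pose proof (EE_ssum_sqr i (f T)) as HE.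
    eapply Rle_trans; [apply Rmult_le_compat_l; [apply pow2_ge_0|exact HE]|].
    rewrite Rmult_plus_distr_l. apply Rplus_le_compat_r.
    assert (HX : EX i (fun k => f T k ^ 2) <= 4 * (lam T + lam T ^ 4) + 2 * lam T ^ 2 * q T ^ 2).
    { apply Rle_trans with (EX i (fun k => 4 * INR k ^ 2 + (4 * lam T ^ 4 + 2 * lam T ^ 2 * q T ^ 2))).
      - apply EX_le. intros k. unfold f, q.
        pose proof (score1_bound k (lam T) Hl) as Hb.
        set (d := score1 k (lam T) + INR k / lam T ^ 2) in *.
        replace (score1 k (lam T)) with (d - INR k / lam T ^ 2) by (unfold d; ring).
        replace (lam T ^ 2 * (d - INR k / lam T ^ 2 + fisher (lam T))) with
          (((lam T ^ 2 * d) - INR k) + lam T ^ 2 * fisher (lam T)) by (field; lra).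
        assert (Hd2 : (lam T ^ 2 * d) ^ 2 <= lam T ^ 4).
        { replace ((lam T ^ 2 * d) ^ 2) with (lam T ^ 4 * d ^ 2) by ring.
          rewrite <- (Rmult_1_r (lam T ^ 4)) at 2. apply Rmult_le_compat_l; [pos|]. nra. }
        set (a := lam T ^ 2 * d) in *. set (b := lam T ^ 2 * fisher (lam T)).
        replace (2 * lam T ^ 2 * (lam T * fisher (lam T)) ^ 2) with (2 * b ^ 2) by (unfold b; ring).
        (* Two uses of [(u + v)^2 <= 2 u^2 + 2 v^2], on [(a - k) + b] and on [a - k]. *)
        pose proof (pow2_ge_0 (a + INR k)). pose proof (pow2_ge_0 (a - INR k - b)). lra.
      - rewrite EX_plus, EX_scal. pose proof (EX_mom2 i) as H2. fold T in H2.
        pose proof (EX_const i (4 * lam T ^ 4 + 2 * lam T ^ 2 * q T ^ 2)) as H0.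
        assert (0 <= lam T ^ 4) by pos.
        assert (0 <= lam T ^ 2 * q T ^ 2) by pos. lra. }
    apply Rle_trans with ((/ J T) ^ 2 * (nn T * (4 * (lam T + lam T ^ 4) + 2 * lam T ^ 2 * q T ^ 2))).
    { apply Rmult_le_compat_l; [apply pow2_ge_0|]. apply Rmult_le_compat_l; assumption. }
    replace ((/ J T) ^ 2 * (nn T * (4 * (lam T + lam T ^ 4) + 2 * lam T ^ 2 * q T ^ 2))) with
      ((4 * (1 + lam T ^ 3) + 2 * lam T * q T ^ 2) * (/ q T * / J T)).
    2:{ unfold J at 1 2. assert (0 < nn T) by (unfold nu in Hnu; nra).
        unfold J, nu. field. repeat split; lra. }
    apply Rmult_le_compat_r; [pos|].
    assert (lam T ^ 3 <= L ^ 3) by (apply pow_incr; lra).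
    assert (q T ^ 2 <= (2 * q0) ^ 2) by nra.
    assert (lam T * q T ^ 2 <= L * (2 * q0) ^ 2) by nra. lra.
  - replace 0 with ((4 * (1 + L ^ 3) + 8 * L * q0 ^ 2) * (/ q0 * 0) + 0) by ring. apply cv_plus.
    + apply cv_scal, cv_mult; [apply (cv_fst (fun T => / q T)), invq_lim|].
      apply (cv_fst (fun T => / J T)), cvinf_inv, J_inf.
    + apply (cv_iter _ (fun _ => 0)); [|apply cv_const]. apply filter_forall. intros T. cbn [fst].
      apply lim_seq_scal0, lim_seq_scal0, lim_seq_sqr0.
      apply is_lim_seq_ext with (fun M => lam T ^ 2 * (EX (T, M) (fun k => score1 k (lam T))
        + fisher (lam T) * EX (T, M) (fun _ => 1))).
      * intros M. rewrite <- (EX_scal _ (fisher (lam T))), <- EX_plus, <- EX_scal.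
        apply EX_ext. intros k. unfold f. ring.
      * apply lim_seq_scal0. replace (Finite 0) with (Finite (- fisher (lam T) + fisher (lam T) * 1)) by (f_equal; ring).
        apply is_lim_seq_plus'; [apply EX_lim_score1|].
        apply (is_lim_seq_scal_l _ (fisher (lam T)) 1), EX_lim_1.
Qed.

(* [V] is the normalised estimation error and [Z] the normalised score: V = kappa (Z - Rm) / B. *)
Lemma perturb (V Z Rm B kappa K eta : R) : 0 <= K -> 0 < eta <= 1 / 2 ->
  V = kappa * (Z - Rm) / B -> Rabs Z <= K -> Rabs Rm <= eta ->
  Rabs (B - 1) <= eta -> Rabs (kappa - 1) <= eta -> Rabs (V - Z) <= 4 * eta * (K + 1).
Proof.
  intros HK He -> HZ HR HB Hk.
  assert (B1 : 1 / 2 <= B) by (apply Rabs_le_between in HB; lra).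
  replace (kappa * (Z - Rm) / B - Z) with (((kappa - 1) * Z - (B - 1) * Z - kappa * Rm) / B) by (field; lra).
  unfold Rdiv. rewrite Rabs_mult, (Rabs_pos_eq (/ B)) by pos.
  apply (div_le (Rabs ((kappa - 1) * Z - (B - 1) * Z - kappa * Rm))); [lra|].
  assert (E1 : Rabs ((kappa - 1) * Z) <= eta * K).
  { rewrite Rabs_mult. apply Rmult_le_compat; try pos. }
  assert (E2 : Rabs ((B - 1) * Z) <= eta * K).
  { rewrite Rabs_mult. apply Rmult_le_compat; try pos. }
  assert (E3 : Rabs (kappa * Rm) <= 2 * eta).
  { rewrite Rabs_mult. apply Rmult_le_compat; try apply Rabs_pos; [|assumption].
    apply Rabs_le_between in Hk. apply Rabs_le. lra. }
  apply Rle_trans with (2 * eta * (K + 1)).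
  - apply Rabs_le_between in E1. apply Rabs_le_between in E2. apply Rabs_le_between in E3.
    apply Rabs_le. lra.
  - assert (0 <= eta * (K + 1)) by pos. nra.
Qed.

(** With [S(r)] the score sum, the mean value theorem gives [S(r) = S(1) + S'(c) (r - 1)], so the
    relative error after the Newton step is [- (S(1) - (S'(r) - S'(c)) (r - 1)) / S'(r)]. Here
    [S(1)] is the normal part; consistency of [QV] and the Lipschitz bound control the rest. *)
Lemma V_small : smallM
    (fun i Y => sqrt (I (fst i)) * (OS (D (fst i)) (fst i) Y - th) - ssum (onabs (g (fst i))) Y).
Proof.
  pose proof (tight_plus (F := FTM) _ _ _ pmfI_nonneg _ _ Z_tight
    (tight_plus (F := FTM) _ _ _ pmfI_nonneg _ _ A2_tight A3_tight)) as HT.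
  apply (small_of_tight (F := FTM) _ _ _ pmfI_nonneg _ _ HT).
  intros K eps HK He.
  set (eta := Rmin (1 / 2) (eps / (4 * (K + 1)))).
  assert (Heta : 0 < eta <= 1 / 2).
  { split; [apply Rmin_pos; [lra|pos]|apply Rmin_l]. }
  assert (Heta2 : 4 * eta * (K + 1) <= eps).
  { assert (E : eta <= eps / (4 * (K + 1))) by apply Rmin_r.
    apply Rle_div_r in E; [lra|lra]. }
  (* [C1] keeps [r] above [1/2], [C2] replaces the observed information at [r] by that at [1], [C3]
     bounds the Newton remainder, and [C4] compares [I] with [J / theta^2]. *)
  assert (C1 : cv FT (fun T => K * / sqrt (nu T)) 0).
  { replace 0 with (K * 0) by ring. apply cv_scal, cvinf_inv, cvinf_sqrt, nu_inf. }
  assert (C2 : cv FT (fun T => K ^ 2 * (/ sqrt (nu T) * / q T)) 0).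
  { replace 0 with (K ^ 2 * (0 * / q0)) by ring. apply cv_scal, cv_mult; [|apply invq_lim].
    apply cvinf_inv, cvinf_sqrt, nu_inf. }
  assert (C3 : cv FT (fun T => K ^ 3 * / sqrt (J T)) 0).
  { replace 0 with (K ^ 3 * 0) by ring. apply cv_scal, cvinf_inv, cvinf_sqrt, J_inf. }
  assert (C4 : cv FT (fun T => sqrt (I T * th ^ 2 / J T)) 1).
  { pose proof (cv_comp (F := FT) sqrt (fun T => I T * th ^ 2 / J T) 1) as HC. rewrite sqrt_1 in HC.
    apply HC; [|exact I_lim]. apply continuity_pt_filterlim, continuity_pt_sqrt. lra. }
  assert (Hhalf : 0 < 1 / 2) by lra. assert (He1 : 0 < eta) by lra. assert (He2 : 0 < eta / 2) by lra.
  pose proof (filter_and _ _ (C1 (1 / 2) Hhalf) (filter_and _ _ (C2 (eta / 2) He2)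
    (filter_and _ _ (C3 eta He1) (filter_and _ _ (C4 eta He1)
    (filter_and _ _ (nu_inf 0) (filter_and _ _ (J_inf 0) (filter_and _ _ q_bounds (FT_ge 0)))))))) as HF.
  apply FTM_fst in HF.
  apply (whp_mono (F := FTM) _ _ _ pmfI_nonneg) with (2 := B0_small (eta / 2) He2).
  revert HF. apply filter_imp. intros i (H1 & H2 & H3 & H4 & Hnu & HJ & Hq & HT0) Y HY HB0 HA.
  set (T := fst i) in *. pose proof (lam_pos T) as Hl. pose proof (D_pos T) as HD.
  rewrite Rminus_0_r in H1, H2, H3.
  destruct (sqrt_sqr (nu T) Hnu) as [Hs Hs2]. destruct (sqrt_sqr (J T) HJ) as [Hj Hj2].
  set (Z := ssum (onabs (g T)) Y) in *. set (r := relQV T Y) in *.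
  set (S3 := ssum (onabs (fun k => 16 * INR k + 3 * lam T ^ 3)) Y) in *.
  assert (HS3 : 0 <= S3).
  { unfold S3. rewrite <- (Rmult_0_r (INR (length Y))), <- ssum_const. apply ssum_le. intros k. unfold onabs.
    pose proof (pos_INR (Z.abs_nat k)). pose proof (pow_le (lam T) 3 ltac:(lra)). lra. }
  set (A2 := sqrt (nu T) * (r - 1)) in *. set (A3 := S3 / nu T) in *.
  assert (P3 : 0 <= A3) by (apply Rmult_le_pos; [exact HS3|left; apply Rinv_0_lt_compat, Hnu]).
  rewrite (Rabs_pos_eq (Rabs Z + _)) in HA
    by pos.
  rewrite (Rabs_pos_eq (Rabs A2 + _)) in HA
    by pos.
  rewrite (Rabs_pos_eq A3) in HA by exact P3.
  pose proof (Rabs_pos Z) as PZ. pose proof (Rabs_pos A2) as P2.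
  assert (KZ : Rabs Z <= K) by lra. assert (K2 : Rabs A2 <= K) by lra.
  assert (Er : r - 1 = A2 * / sqrt (nu T)) by (unfold A2; field; lra).
  assert (Ar : Rabs (r - 1) <= K * / sqrt (nu T)).
  { rewrite Er, Rabs_mult, (Rabs_pos_eq (/ sqrt (nu T))) by pos.
    apply Rmult_le_compat_r; [pos|exact K2]. }
  assert (Hr : 1 / 2 < r).
  { apply Rabs_lt_between in H1. apply Rabs_le_between in Ar. lra. }
  destruct (mvt (fun r => ssum (onabs (rscore (lam T) r)) Y) (fun r => ssum (onabs (rscore1 (lam T) r)) Y) 1 r) as [c [Hc E]].
  { intros x Hx. apply ssum_rscore_derive; [exact Hl|]. unfold Rmin in Hx; destruct Rle_dec; lra. }
  assert (Hc2 : 1 / 2 <= c /\ Rabs (r - c) <= Rabs (r - 1)).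
  { unfold Rmin, Rmax in Hc. destruct Rle_dec; split; try lra; unfold Rabs; repeat destruct Rcase_abs; lra. }
  destruct Hc2 as [Hc2 Hc3].
  set (S1 := ssum (onabs (rscore (lam T) 1)) Y) in *. set (Sr := ssum (onabs (rscore (lam T) r)) Y) in *.
  set (Dr := ssum (onabs (rscore1 (lam T) r)) Y) in *. set (Dc := ssum (onabs (rscore1 (lam T) c)) Y) in *.
  set (D1 := ssum (onabs (rscore1 (lam T) 1)) Y).
  pose proof (ssum_rscore1_lipschitz (lam T) r c Y Hl ltac:(lra) Hc2) as Lc. fold Dr Dc S3 in Lc.
  pose proof (ssum_rscore1_lipschitz (lam T) r 1 Y Hl ltac:(lra) ltac:(lra)) as L1. fold Dr D1 S3 in L1.
  assert (EZ : S1 = sqrt (J T) * Z).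
  { unfold Z, S1. rewrite <- ssum_scal. apply ssum_ext. intros k. unfold onabs, g, rscore. rewrite Rmult_1_r. field. lra. }
  assert (EB : / J T * ssum (onabs (fun k => lam T ^ 2 * (score1 k (lam T) + fisher (lam T)))) Y = D1 / J T + 1).
  { rewrite (ssum_ext _ (fun k => onabs (rscore1 (lam T) 1) k + lam T ^ 2 * fisher (lam T))).
    - rewrite ssum_plus, ssum_const, HY. change (INR (nobsI i)) with (nn T).
      rewrite <- J_eq. fold D1. field. lra.
    - intros k. unfold onabs, rscore1. rewrite Rmult_1_r. ring. }
  rewrite EB in HB0.
  set (B := - Dr / J T). set (Rm := (r - 1) * (Dr - Dc) / sqrt (J T)).
  assert (ES3 : S3 = A3 * nu T) by (unfold A3; field; lra).
  assert (HB : Rabs (B - 1) <= eta).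
  { unfold B. replace (- Dr / J T - 1) with (- (D1 / J T + 1) - (Dr - D1) / J T) by (field; lra).
    assert (Rabs ((Dr - D1) / J T) <= eta / 2).
    { unfold Rdiv at 1. rewrite Rabs_mult, (Rabs_pos_eq (/ J T)) by pos.
      apply (div_le (Rabs (Dr - D1))); [exact HJ|].
      apply Rle_trans with ((K * nu T) * (K * / sqrt (nu T))).
      - eapply Rle_trans; [exact L1|]. apply Rmult_le_compat; [exact HS3|apply Rabs_pos| |exact Ar].
        rewrite ES3. apply Rmult_le_compat_r; lra.
      - apply Rabs_lt_between in H2. unfold J.
        replace (K * nu T * (K * / sqrt (nu T))) with (K ^ 2 * (/ sqrt (nu T) * / q T) * (nu T * q T))
          by (field; split; lra).
        apply Rmult_le_compat_r; [fold (J T); lra|lra]. }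
    apply Rabs_le_between in H. apply Rabs_le_between in HB0. apply Rabs_le. lra. }
  assert (HRm : Rabs Rm <= eta).
  { unfold Rm, Rdiv. rewrite !Rabs_mult, (Rabs_pos_eq (/ sqrt (J T))) by pos.
    apply (div_le (Rabs (r - 1) * Rabs (Dr - Dc))); [exact Hj|].
    apply Rle_trans with ((K * / sqrt (nu T)) * ((K * nu T) * (K * / sqrt (nu T)))).
    - apply Rmult_le_compat; [apply Rabs_pos|apply Rabs_pos|exact Ar|].
      eapply Rle_trans; [exact Lc|]. apply Rmult_le_compat; [exact HS3|apply Rabs_pos| |lra].
      rewrite ES3. apply Rmult_le_compat_r; lra.
    - replace (K * / sqrt (nu T) * (K * nu T * (K * / sqrt (nu T)))) with (K ^ 3 * / sqrt (J T) * sqrt (J T)).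
      + apply Rmult_le_compat_r; [lra|]. apply Rabs_lt_between in H3. lra.
      + rewrite <- Hs2 at 2. field. split; lra. }
  assert (HQ : QV T Y = th * r) by (unfold r, relQV; field; lra).
  rewrite (OS_eq (D T) T th r Y th_pos HD ltac:(lra) HQ).
  change (th * D T) with (lam T). fold Sr Dr.
  eapply Rle_trans; [|exact Heta2].
  apply (perturb _ Z Rm B (sqrt (I T * th ^ 2 / J T)) K eta); try assumption; [lra| |left; exact H4].
  assert (ESr : Sr = S1 + Dc * (r - 1)) by lra. rewrite ESr, EZ.
  rewrite sqrt_div_alt by exact HJ.
  rewrite (Rmult_comm (I T)), sqrt_mult_alt, sqrt_pow2 by (try pos).
  (* A zero denominator would give [B = 0], at distance [1] from [1]. *)
  assert (HDr : Dr <> 0).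
  { intros H0. unfold B in HB. rewrite H0 in HB. replace (- 0 / J T - 1) with (- 1) in HB by (field; lra).
    apply Rabs_le_between in HB. lra. }
  unfold B, Rm. replace (- Dr / J T) with (- Dr / (sqrt (J T) * sqrt (J T))) by (rewrite Hj2; reflexivity).
  field. split; lra.
Qed.

Theorem regime_ab : conv_std_normal D th I.
Proof. apply (conv_of_slutsky I _ Z_normal V_small). Qed.
End RegimeAB.

(** * Regime (c) *)

Section RegimeC.
Let N (T : R) : R := T / D T.
Hypothesis lam_inf : cvinf FT lam.
Hypothesis N_inf : cvinf FT N.
Hypothesis sqrtN_lam : cv FT (fun T => sqrt (N T) * / lam T) 0.

Lemma nN : FT (fun T => 0 < T /\ N T - 1 < nn T <= N T).
Proof.
  generalize (FT_ge 0). apply filter_imp. intros T HT. split; [exact HT|].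
  apply (nn_bounds T); lra.
Qed.

Lemma nn_inf_c : cvinf FT nn.
Proof.
  intros A. generalize (filter_and _ _ nN (N_inf (A + 1))). apply filter_imp. intros T [[_ H] H1]. lra.
Qed.

Lemma ratio_lim : cv FT (fun T => nn T / N T) 1.
Proof.
  apply cv_squeeze with (fun T => / N T); [|apply cvinf_inv, N_inf].
  generalize (filter_and _ _ nN (N_inf 0)). apply filter_imp. intros T [[_ H] H1].
  replace (nn T / N T - 1) with ((nn T - N T) * / N T) by (field; lra).
  assert (0 < / N T) by pos.
  rewrite Rabs_mult, (Rabs_pos_eq (/ N T)) by lra.
  rewrite <- (Rmult_1_l (/ N T)) at 2. apply Rmult_le_compat_r; [lra|]. apply Rabs_le. lra.
Qed.

Lemma NT T : N T * lam T = T * th.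
Proof. unfold N, lam. field. pose proof (D_pos T). lra. Qed.

(** Since [E k^4 - l^2 = 2 l^2 + l], the leading variance of [k^2] is [2 l^2]; up to the rounding
    bias, the sum of [g] is the normalised error of [QV]. *)
Let g (T : R) (k : nat) : R := / (lam T * sqrt (2 * nn T)) * (INR k ^ 2 - lam T).

Lemma gc_lim T : is_lim_seq (fun M => EX (T, M) (g T)) 0.
Proof.
  apply is_lim_seq_ext with
    (fun M => / (lam T * sqrt (2 * nn T)) * EX (T, M) (fun k => INR k ^ 2 - lam T)).
  - intros M. rewrite <- EX_scal. reflexivity.
  - apply lim_seq_scal0, EX_lim_centered.
Qed.

Let v (T : R) : R := (/ (lam T * sqrt (2 * nn T))) ^ 2 * (2 * lam T ^ 2 + lam T).

Lemma gc2_lim T : is_lim_seq (fun M => EX (T, M) (fun k => g T k ^ 2)) (v T).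
Proof.
  apply is_lim_seq_ext with (fun M => (/ (lam T * sqrt (2 * nn T))) ^ 2 *
    (EX (T, M) (fun k => INR k ^ 4) + - (2 * lam T) * EX (T, M) (fun k => INR k ^ 2)
      + lam T ^ 2 * EX (T, M) (fun _ => 1))).
  + intros M. rewrite <- !EX_scal, <- !EX_plus, <- EX_scal. apply EX_ext. intros k. unfold g. ring.
  + apply (is_lim_seq_scal_l _ ((/ (lam T * sqrt (2 * nn T))) ^ 2) (2 * lam T ^ 2 + lam T)).
    replace (2 * lam T ^ 2 + lam T) with ((3 * lam T ^ 2 + lam T) + - (2 * lam T) * lam T + lam T ^ 2 * 1) by ring.
    apply is_lim_seq_plus'; [apply is_lim_seq_plus'|].
    * apply EX_lim_4.
    * apply (is_lim_seq_scal_l _ (- (2 * lam T)) (lam T)), EX_lim_2.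
    * apply (is_lim_seq_scal_l _ (lam T ^ 2) 1), EX_lim_1.
Qed.

Lemma vc_lim : cv FT (fun T => nn T * v T) 1.
Proof.
  apply (cv_ext (fun T => 1 + / 2 * / lam T)).
  + generalize (nn_inf_c 0). apply filter_imp. intros T Hn. pose proof (lam_pos T) as Hl.
    destruct (sqrt_sqr (2 * nn T) ltac:(lra)) as [Hs Hq].
    unfold v. replace ((/ (lam T * sqrt (2 * nn T))) ^ 2) with (/ (lam T ^ 2 * (sqrt (2 * nn T) * sqrt (2 * nn T))))
      by (field; lra).
    rewrite Hq. field. lra.
  + replace 1 with (1 + / 2 * 0) at 1 by ring. apply cv_plus; [apply cv_const|].
    apply cv_scal, cvinf_inv, lam_inf.
Qed.

Lemma Zc_normal : normalM (fun i Y => ssum (onabs (g (fst i))) Y).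
Proof.
  apply (clt_model g v (fun T => 16 * / sqrt (nn T)) nn_inf_c gc_lim gc2_lim vc_lim).
  - generalize (filter_and _ _ (nn_inf_c 0) (lam_inf 1)). apply filter_imp. intros T [Hn Hl] M.
    destruct (sqrt_sqr (2 * nn T) ltac:(lra)) as [Hs Hq]. destruct (sqrt_sqr (nn T) Hn) as [Hs1 Hq1].
    set (c := / (lam T * sqrt (2 * nn T))).
    assert (Hc : 0 < c) by (apply Rinv_0_lt_compat, Rmult_lt_0_compat; lra).
    (* For [l >= 1] the sixth moment plus [l^3] is at most [(15 + 15 + 1 + 1) l^3]. *)
    apply Rle_trans with (nn T * (c ^ 3 * (32 * lam T ^ 3))).
    + apply Rmult_le_compat_l; [lra|].
      apply Rle_trans with (EX (T, M) (fun k => c ^ 3 * (INR k ^ 6 + lam T ^ 3))).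
      * apply EX_le. intros k. unfold g. fold c.
        rewrite Rabs_mult, (Rabs_pos_eq c), Rpow_mult_distr by lra.
        apply Rmult_le_compat_l; [pos|].
        replace (INR k ^ 6) with ((INR k ^ 2) ^ 3) by ring.
        pose proof (pow2_ge_0 (INR k)) as Hk. set (a := INR k ^ 2) in *.
        pose proof (pow_le a 3 Hk). pose proof (pow_le (lam T) 3 ltac:(lra)).
        destruct (Rle_dec a (lam T)).
        -- assert (Rabs (a - lam T) ^ 3 <= lam T ^ 3); [|lra].
           apply pow_incr. split; [apply Rabs_pos|apply Rabs_le; lra].
        -- assert (Rabs (a - lam T) ^ 3 <= a ^ 3); [|lra].
           apply pow_incr. split; [apply Rabs_pos|apply Rabs_le; lra].
      * rewrite EX_scal. apply Rmult_le_compat_l; [pos|]. rewrite EX_plus.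
        pose proof (EX_mom6 (T, M)) as H6. cbn [fst] in H6.
        pose proof (EX_const (T, M) (lam T ^ 3) ltac:(pos)).
        assert (lam T ^ 2 <= lam T ^ 3) by nra.
        assert (lam T ^ 1 <= lam T ^ 3) by nra. lra.
    + assert (Hc2 : c ^ 2 * (lam T ^ 2 * (2 * nn T)) = 1).
      { unfold c. rewrite <- Hq at 2. field. lra. }
      replace (nn T * (c ^ 3 * (32 * lam T ^ 3))) with (16 * (c * lam T) * (c ^ 2 * (lam T ^ 2 * (2 * nn T)))) by ring.
      rewrite Hc2, Rmult_1_r. apply Rmult_le_compat_l; [lra|].
      replace (c * lam T) with (/ sqrt (2 * nn T)) by (unfold c; field; lra).
      apply Rinv_le_contravar; [exact Hs1|]. apply sqrt_le_1_alt. lra.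
  - replace 0 with (16 * 0) by ring. apply cv_scal, cvinf_inv, cvinf_sqrt, nn_inf_c.
Qed.

Lemma Zc_tight : tightM (fun i Y => ssum (onabs (g (fst i))) Y).
Proof. apply (tight_model g v nn_inf_c gc_lim gc2_lim vc_lim). Qed.

Lemma K4_tight : tightM
  (fun i Y => / (nn (fst i) * lam (fst i) ^ 2) * ssum (onabs (fun k => INR k ^ 4)) Y).
Proof.
  apply (tight_abs (F := FTM) _ _ _ pmfI_nonneg) with 4.
  generalize (FTM_fst _ (filter_and _ _ (nn_inf_c 0) (lam_inf 1))). apply filter_imp. intros i [Hn Hl].
  set (T := fst i) in *.
  assert (Hpos : forall k, 0 <= onabs (fun k => INR k ^ 4) k) by (intros; apply pow_le, pos_INR).
  destruct (EZn_ssum_le (snd i) (pmfI i) (pmfI_nonneg i) (pmfI_mass i)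
    (nobsI i) (onabs (fun k => INR k ^ 4)) Hpos) as [_ HB].
  rewrite EZ_EX in HB.
  assert (Hd : 0 < nn T * lam T ^ 2) by pos.
  apply Rle_trans with (/ (nn T * lam T ^ 2) * Ex i (fun Y => ssum (onabs (fun k => INR k ^ 4)) Y)).
  - right. unfold EE. rewrite <- EZn_scal. apply EZn_ext. intros Y _.
    apply Rabs_pos_eq. apply Rmult_le_pos; [pos|].
    rewrite <- (Rmult_0_r (INR (length Y))), <- ssum_const. apply ssum_le. exact Hpos.
  - rewrite Rmult_comm. apply div_le; [exact Hd|]. eapply Rle_trans; [exact HB|].
    change (INR (nobsI i)) with (nn T). pose proof (EX_mom4 i) as H4.
    fold T in H4.
    apply Rle_trans with (nn T * (3 * lam T ^ 2 + lam T)); [apply Rmult_le_compat_l; lra|].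
    replace (4 * (nn T * lam T ^ 2)) with (nn T * (4 * lam T ^ 2)) by ring.
    apply Rmult_le_compat_l; [lra|]. nra.
Qed.

Lemma relQV_small : smallM (fun i Y => relQV (fst i) Y - 1).
Proof.
  apply (small_sqr (F := FTM) _ _ _ pmfI_nonneg).
  apply cv_squeeze with (fun i => 10 * / N (fst i) + 2 / (fst i * th) ^ 2 * (nn (fst i) ^ 2 *
     EX i (fun k => INR k ^ 2 - lam (fst i)) ^ 2) + 2 * (nn (fst i) / N (fst i) - 1) ^ 2).
  - generalize (FTM_fst _ (filter_and _ _ nN (filter_and _ _ (N_inf 0) (lam_inf 1)))). apply filter_imp.
    intros i ((HT & Hn) & HN & Hl).
    rewrite Rminus_0_r, Rabs_pos_eq.
    2:{ apply EZn_nonneg; [apply pmfI_nonneg|apply pmfI_mass|]. intros; apply pow2_ge_0. }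
    eapply Rle_trans; [apply (relQV_sqr i HT)|]. set (T := fst i) in *.
    pose proof (D_pos T) as HD.
    replace (nn T * D T / T) with (nn T / N T) by (unfold N; field; lra).
    apply Rplus_le_compat_r. rewrite Rmult_plus_distr_l. apply Rplus_le_compat_r.
    rewrite <- NT. replace (2 / (N T * lam T) ^ 2 * (nn T * (4 * lam T ^ 2 + lam T))) with
      (2 * nn T * (4 * lam T ^ 2 + lam T) / (N T * lam T) ^ 2) by (field; lra).
    apply div_le; [pos|].
    replace (10 * / N T * (N T * lam T) ^ 2) with (2 * N T * (5 * lam T ^ 2)) by (field; lra).
    pose proof (nn_nonneg T).
    apply Rmult_le_compat; nra.
  - replace 0 with (10 * 0 + 0 + 2 * ((1 - 1) * (1 - 1))) by ring. apply cv_plus; [apply cv_plus|].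
    + apply cv_scal, (cv_fst (fun T => / N T)), cvinf_inv, N_inf.
    + apply (cv_iter _ (fun _ => 0)); [|apply cv_const]. apply filter_forall. intros T. cbn [fst].
      apply lim_seq_scal0, lim_seq_scal0, lim_seq_sqr0, EX_lim_centered.
    + apply cv_scal. apply (cv_fst (fun T => (nn T / N T - 1) ^ 2)).
      apply (cv_ext (fun T => (nn T / N T - 1) * (nn T / N T - 1))).
      * apply filter_forall. intros; ring.
      * apply cv_mult; (apply cv_minus; [apply ratio_lim|apply cv_const]).
Qed.

(* The choice [s = QV * Delta] makes the average of [k_i^2/s] equal to [N/n], so the leading terms of
   [sum score] cancel and those of [s^2 sum score1] add up to at most [-n/4]. *)
Lemma one_step_negligible (T s K : R) (Y : list Z) :
  let n := INR (length Y) in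
  0 < n -> n <= N T < n + 1 -> 3 <= s -> 0 <= K -> 584 * (1 + K) <= s ->
  ssum (onabs (fun k => INR k ^ 2)) Y = N T * s ->
  ssum (onabs (fun k => INR k ^ 4)) Y <= K * n * s ^ 2 ->
  Rabs (ssum (onabs (fun k => score k s)) Y / ssum (onabs (fun k => score1 k s)) Y) <= 4 * s / n + 80 * (1 + K).
Proof.
  intros n Hn HN Hs HK HsK E2 E4.
  set (SG := ssum (onabs (fun k => score k s)) Y). set (SG1 := ssum (onabs (fun k => score1 k s)) Y).
  assert (Hsi : 0 < / s) by pos.
  assert (Ey : ssum (onabs (fun k => INR k ^ 2 / s)) Y = N T).
  { rewrite (ssum_ext _ (fun k => / s * onabs (fun k => INR k ^ 2) k)) by (intros; unfold onabs, Rdiv; ring).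
    rewrite ssum_scal, E2. field. lra. }
  assert (Ey2 : ssum (onabs (fun k => (INR k ^ 2 / s) ^ 2)) Y <= K * n).
  { rewrite (ssum_ext _ (fun k => / s ^ 2 * onabs (fun k => INR k ^ 4) k)) by (intros; unfold onabs; field; lra).
    rewrite ssum_scal, Rmult_comm. apply (div_le (ssum (onabs (fun k => INR k ^ 4)) Y)); [pos|lra]. }
  set (S2 := ssum (onabs (fun k => (INR k ^ 2 / s) ^ 2)) Y) in *.
  assert (Hs2 : 0 < s ^ 2) by pos.
  assert (HS2 : 0 <= S2).
  { unfold S2. rewrite <- (Rmult_0_r (INR (length Y))), <- ssum_const. apply ssum_le. intros; apply pow2_ge_0. }
  (* After the cancellation only [N - n < 1] is left of the leading terms; it costs [1/(2 s)]. *)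
  assert (HU : SG <= / (2 * s) + 10 * (n + K * n) / s ^ 2).
  { apply Rle_trans with ((/ (2 * s)) * (N T - n) + 3 / s ^ 2 * n).
    - apply Rle_trans with (ssum (fun k => / (2 * s) * onabs (fun k => INR k ^ 2 / s) k + (- / (2 * s) + 3 / s ^ 2)) Y).
      + apply ssum_le. intros k. unfold onabs. eapply Rle_trans; [apply score_upper; lra|]. right. field. lra.
      + rewrite ssum_plus, ssum_scal, ssum_const, Ey. fold n. right. ring.
    - apply Rplus_le_compat.
      + rewrite <- Rmult_1_r. apply Rmult_le_compat_l; [pos|lra].
      + unfold Rdiv. replace (3 * / s ^ 2 * n) with (3 * n * / s ^ 2) by ring.
        apply Rmult_le_compat_r; [pos|]. nra. }
  assert (HL : - (10 * (n + K * n) / s ^ 2) <= SG).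
  { apply Rle_trans with ((/ (2 * s)) * (N T - n) - / s ^ 2 * (/ 8 * S2 + 10 * n)).
    - assert (0 <= / (2 * s) * (N T - n)) by pos.
      assert (/ s ^ 2 * (/ 8 * S2 + 10 * n) <= 10 * (n + K * n) / s ^ 2); [|lra].
      unfold Rdiv. rewrite (Rmult_comm (/ s ^ 2)).
      apply Rmult_le_compat_r; [pos|]. nra.
    - apply Rle_trans with (ssum (fun k => / (2 * s) * onabs (fun k => INR k ^ 2 / s) k
        + (- (/ s ^ 2 * / 8) * onabs (fun k => (INR k ^ 2 / s) ^ 2) k + (- / (2 * s) - 10 / s ^ 2))) Y).
      + rewrite !ssum_plus, !ssum_scal, ssum_const, Ey. fold n S2. right. unfold Rdiv. ring.
      + apply ssum_le. intros k. unfold onabs. eapply Rle_trans; [|apply score_lower; lra]. right. field. lra. }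
  (* Here [3 n/4 - N <= - n/4], and since [584 = 8 * 73] the error terms take back at most [n/8]. *)
  assert (H1 : s ^ 2 * SG1 <= - (n / 8)).
  { apply Rle_trans with (3 / 4 * n - N T + 73 * / s * (n + S2)).
    - unfold SG1. rewrite <- ssum_scal.
      apply Rle_trans with (ssum (fun k => -1 * onabs (fun k => INR k ^ 2 / s) k
        + (73 * / s * onabs (fun k => (INR k ^ 2 / s) ^ 2) k + (3 / 4 + 73 * / s))) Y).
      + apply ssum_le. intros k. unfold onabs. eapply Rle_trans; [apply score1_upper; lra|]. right. field. lra.
      + rewrite !ssum_plus, !ssum_scal, !ssum_const, Ey. fold n S2. right. field. lra.
    - assert (73 * / s * (n + S2) <= n / 8); [|lra].
      apply Rle_trans with (73 * / s * (n * (1 + K))).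
      + apply Rmult_le_compat_l; lra.
      + replace (73 * / s * (n * (1 + K))) with (n / 8 * (584 * (1 + K) / s)) by (field; lra).
        rewrite <- (Rmult_1_r (n / 8)) at 2. apply Rmult_le_compat_l; [lra|]. apply div_le; lra. }
  assert (HSG : Rabs SG <= / (2 * s) + 10 * (n + K * n) / s ^ 2).
  { assert (0 < / (2 * s)) by pos. apply Rabs_le. lra. }
  assert (HSG1 : n / 8 / s ^ 2 <= Rabs SG1).
  { apply div_le; [exact Hs2|]. rewrite Rabs_left1 by nra. lra. }
  assert (0 < n / 8 / s ^ 2) by pos.
  unfold Rdiv at 1. rewrite Rabs_mult, Rabs_inv.
  apply (div_le (Rabs SG)); [lra|]. eapply Rle_trans; [exact HSG|].
  (* The constants are those of the quotient: [8 s^2 / n] times [1/(2 s) + 10 n (1 + K) / s^2]. *)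
  apply Rle_trans with ((4 * s / n + 80 * (1 + K)) * (n / 8 / s ^ 2)).
  - right. field. lra.
  - apply Rmult_le_compat_l; [|exact HSG1].
    assert (0 <= 4 * s / n) by pos. lra.
Qed.

Lemma sqrtN_nn : cv FT (fun T => sqrt (N T) * / nn T) 0.
Proof.
  apply cv_squeeze with (fun T => 2 * / sqrt (N T)).
  - generalize (filter_and _ _ nN (N_inf 2)). apply filter_imp. intros T [[_ H] H1].
    destruct (sqrt_sqr (N T) ltac:(lra)) as [Hs Hq].
    rewrite Rminus_0_r, Rabs_pos_eq by pos.
    apply (div_le (sqrt (N T))); [lra|].
    apply Rle_trans with (2 * / sqrt (N T) * (N T / 2)).
    + right. rewrite <- Hq at 3. field. lra.
    + apply Rmult_le_compat_l; [pos|lra].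
  - replace 0 with (2 * 0) by ring. apply cv_scal, cvinf_inv, cvinf_sqrt, N_inf.
Qed.

(** Three errors separate the estimator from the normalised sum: [n] against [N] in the
    normalisation, the rounding bias, of order [N^(-1/2)] once normalised, and the Newton step, of
    order [sqrt N (1/n + 1/l)]. *)
Lemma Vc_small : smallM
    (fun i Y => sqrt (N (fst i) / (2 * th ^ 2)) * (OS (D (fst i)) (fst i) Y - th) - ssum (onabs (g (fst i))) Y).
Proof.
  pose proof (tight_plus (F := FTM) _ _ _ pmfI_nonneg _ _ Zc_tight K4_tight) as HT.
  apply (small_of_tight (F := FTM) _ _ _ pmfI_nonneg _ _ HT).
  intros K eps HK He.
  assert (C1 : cv FT (fun T => (Rabs (sqrt (nn T / N T) - 1) * K + / sqrt (N T))
    + (8 * (sqrt (N T) * / nn T) + 80 * (1 + 4 * K) * (sqrt (N T) * / lam T))) 0).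
  { replace 0 with ((Rabs (1 - 1) * K + 0) + (8 * 0 + 80 * (1 + 4 * K) * 0))
      by (rewrite Rminus_diag, Rabs_R0; ring).
    apply cv_plus; apply cv_plus.
    - apply cv_mult; [|apply cv_const]. apply cv_abs, cv_minus; [|apply cv_const].
      pose proof (cv_comp (F := FT) sqrt (fun T => nn T / N T) 1) as HC. rewrite sqrt_1 in HC.
      apply HC; [|apply ratio_lim]. apply continuity_pt_filterlim, continuity_pt_sqrt. lra.
    - apply cvinf_inv, cvinf_sqrt, N_inf.
    - apply cv_scal, sqrtN_nn.
    - apply cv_scal, sqrtN_lam. }
  (* The thresholds account for [s = l r >= l/2]: [6] gives [s >= 3], [1168] is [2 * 584], and a
     fourth-power sum of at most [K n l^2] is at most [4 K n s^2]. *)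
  pose proof (filter_and _ _ (C1 eps He) (filter_and _ _ nN (filter_and _ _ (N_inf 2)
    (filter_and _ _ (lam_inf 6) (lam_inf (1168 * (1 + 4 * K))))))) as HF.
  apply FTM_fst in HF.
  assert (Hhalf : 0 < 1 / 2) by lra.
  apply (whp_mono (F := FTM) _ _ _ pmfI_nonneg) with (2 := relQV_small (1 / 2) Hhalf).
  revert HF. apply filter_imp. intros i (H1 & (HT0 & Hn) & HN & Hl1 & Hl2) Y HY Hr HA.
  set (T := fst i) in *. pose proof (D_pos T) as HD.
  rewrite Rminus_0_r in H1. apply Rabs_lt_between in H1.
  assert (HYn : INR (length Y) = nn T) by (rewrite HY; reflexivity).
  destruct (sqrt_sqr (N T) ltac:(lra)) as [HsN HqN]. destruct (sqrt_sqr (2 * nn T) ltac:(lra)) as [Hsn Hqn].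
  set (Z := ssum (onabs (g T)) Y) in *. set (r := relQV T Y) in *.
  set (S4 := ssum (onabs (fun k => INR k ^ 4)) Y) in *.
  assert (Hd : 0 < nn T * lam T ^ 2) by pos.
  rewrite (Rabs_pos_eq (Rabs Z + _)) in HA
    by pos.
  pose proof (Rabs_pos Z) as PZ. pose proof (Rabs_pos (/ (nn T * lam T ^ 2) * S4)) as P4.
  assert (KZ : Rabs Z <= K) by lra.
  assert (K4 : S4 <= K * (nn T * lam T ^ 2)).
  { apply Rle_div_l; [exact Hd|]. unfold Rdiv. rewrite Rmult_comm.
    eapply Rle_trans; [apply Rle_abs|]. lra. }
  apply Rabs_le_between in Hr.
  set (s := lam T * r).
  assert (Hs1 : lam T / 2 <= s <= 2 * lam T) by (unfold s; split; nra).
  assert (HQ : QV T Y = th * r) by (unfold r, relQV; field; lra).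
  assert (E2 : ssum (onabs (fun k => INR k ^ 2)) Y = N T * s).
  { unfold s. rewrite <- Rmult_assoc, NT, Rmult_assoc, <- HQ, QV_onabs. field. lra. }
  pose proof (one_step_negligible T s (4 * K) Y) as HO. rewrite HYn in HO.
  specialize (HO ltac:(lra) ltac:(lra) ltac:(lra) ltac:(lra) ltac:(lra) E2).
  assert (HO4 : S4 <= 4 * K * nn T * s ^ 2).
  { eapply Rle_trans; [exact K4|]. assert ((lam T / 2) ^ 2 <= s ^ 2) by (apply pow_incr; lra).
    replace (K * (nn T * lam T ^ 2)) with (4 * K * nn T * (lam T / 2) ^ 2) by field.
    apply Rmult_le_compat_l; [|assumption]. pos. }
  specialize (HO HO4).
  rewrite (OS_eq (D T) T th r Y th_pos HD ltac:(lra) HQ). change (th * D T) with (lam T).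
  set (rho := ssum (onabs (fun k => score k s)) Y / ssum (onabs (fun k => score1 k s)) Y) in *.
  replace (ssum (onabs (rscore (lam T) r)) Y / ssum (onabs (rscore1 (lam T) r)) Y) with (rho / lam T).
  2:{ rewrite (ssum_ext (onabs (rscore (lam T) r)) (fun k => lam T * onabs (fun k => score k s) k)) by reflexivity.
      rewrite (ssum_ext (onabs (rscore1 (lam T) r)) (fun k => lam T ^ 2 * onabs (fun k => score1 k s) k)) by reflexivity.
      rewrite !ssum_scal. unfold rho, Rdiv. rewrite Rinv_mult.
      generalize (/ ssum (onabs (fun k => score1 k s)) Y). intros C. field. lra. }
  assert (Esq : sqrt (N T / (2 * th ^ 2)) * th = sqrt (N T) / sqrt 2).
  { rewrite sqrt_div_alt by nra. rewrite (sqrt_mult_alt 2) by lra. rewrite sqrt_pow2 by lra.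
    pose proof (sqrt_lt_R0 2 ltac:(lra)). field. lra. }
  rewrite <- Rmult_assoc, Esq.
  assert (S2p : 1 <= sqrt 2) by (rewrite <- sqrt_1; apply sqrt_le_1_alt; lra).
  assert (Er : r - 1 = sqrt (2 * nn T) / N T * Z + (nn T / N T - 1)).
  { unfold r. rewrite (relQV_ssum T Y HT0 HY).
    replace (nn T * D T / T) with (nn T / N T) by (unfold N; field; lra). f_equal.
    rewrite <- NT. unfold Z. rewrite (ssum_ext (onabs (g T)) (fun k => / (lam T * sqrt (2 * nn T)) *
      onabs (fun k => INR k ^ 2 - lam T) k)) by reflexivity.
    rewrite ssum_scal. field. lra. }
  assert (Ehalf : sqrt (N T) / sqrt 2 * (sqrt (2 * nn T) / N T) = sqrt (nn T / N T)).
  { rewrite (sqrt_mult_alt 2) by lra. rewrite sqrt_div_alt by lra. rewrite <- HqN at 2. field. lra. }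
  replace (sqrt (N T) / sqrt 2 * (r - 1 - rho / lam T) - Z) with
    (((sqrt (nn T / N T) - 1) * Z + sqrt (N T) / sqrt 2 * (nn T / N T - 1))
      - sqrt (N T) / sqrt 2 * (rho / lam T)).
  2:{ rewrite <- Ehalf, Er. ring. }
  assert (Hsq2 : 0 <= sqrt (N T) / sqrt 2 <= sqrt (N T)).
  { split; [pos|]. apply div_le; [lra|]. nra. }
  assert (F1 : Rabs ((sqrt (nn T / N T) - 1) * Z) <= Rabs (sqrt (nn T / N T) - 1) * K).
  { rewrite Rabs_mult. apply Rmult_le_compat_l; [apply Rabs_pos|exact KZ]. }
  assert (F2 : Rabs (sqrt (N T) / sqrt 2 * (nn T / N T - 1)) <= / sqrt (N T)).
  { rewrite Rabs_mult, (Rabs_pos_eq (sqrt (N T) / sqrt 2)) by lra.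
    apply Rle_trans with (sqrt (N T) * / N T).
    - apply Rmult_le_compat; [lra|apply Rabs_pos|lra|].
      replace (nn T / N T - 1) with ((nn T - N T) * / N T) by (field; lra).
      assert (0 < / N T) by pos.
      rewrite Rabs_mult, (Rabs_pos_eq (/ N T)) by lra.
      rewrite <- (Rmult_1_l (/ N T)) at 2. apply Rmult_le_compat_r; [lra|]. apply Rabs_le. lra.
    - right. rewrite <- HqN at 2. field. lra. }
  assert (F3 : Rabs (sqrt (N T) / sqrt 2 * (rho / lam T)) <=
    8 * (sqrt (N T) * / nn T) + 80 * (1 + 4 * K) * (sqrt (N T) * / lam T)).
  { rewrite Rabs_mult, (Rabs_pos_eq (sqrt (N T) / sqrt 2)) by lra.
    apply Rle_trans with (sqrt (N T) * (8 * / nn T + 80 * (1 + 4 * K) * / lam T)); [|right; ring].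
    apply Rmult_le_compat; [lra|apply Rabs_pos|lra|].
    unfold Rdiv. rewrite Rabs_mult, (Rabs_pos_eq (/ lam T)) by pos.
    apply (div_le (Rabs rho)); [lra|]. eapply Rle_trans; [exact HO|].
    replace ((8 * / nn T + 80 * (1 + 4 * K) * / lam T) * lam T) with
      (4 * (2 * lam T) / nn T + 80 * (1 + 4 * K)) by (field; lra).
    apply Rplus_le_compat_r. apply Rmult_le_compat_r; [pos|lra]. }
  apply Rabs_le_between in F1. apply Rabs_le_between in F2. apply Rabs_le_between in F3.
  apply Rabs_le. lra.
Qed.

Theorem regime_c : conv_std_normal D th (fun T => T / D T / (2 * th ^ 2)).
Proof. apply (conv_of_slutsky _ _ Zc_normal Vc_small). Qed.
End RegimeC.

End Model.

(** * Assembly of the three regimes *)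

Section Bounded.
Variables (th Dmax q0 : R) (D : R -> R).
Hypothesis th_pos : 0 < th.
Hypothesis D_pos : forall T, 0 < D T.
Hypothesis Dmax_pos : 0 < Dmax.
Hypothesis q0_pos : 0 < q0.
Hypothesis D_le : FT (fun T => D T <= Dmax).
Hypothesis q_lim : cv FT (fun T => lam th D T * fisher (lam th D T)) q0.

(** Common form of (a) and (b): the information [n l q / theta^2] becomes [T q0 / theta] because
    [n Delta / T -> 1]. Here [q0] is [1] in (a) and [theta Delta_oo phi] in (b). *)
Lemma regime_bounded : conv_std_normal D th (fun T => T * q0 / th).
Proof.
  assert (Hlim : cv FT (fun T => nn D T * D T / T) 1).
  { apply cv_squeeze with (fun T => Dmax * / T).
    - generalize (filter_and _ _ D_le (FT_ge 0)). apply filter_imp. intros T [H1 H2].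
      destruct (nn_bounds D D_pos T ltac:(lra)) as [B1 B2]. pose proof (D_pos T) as HD.
      replace (nn D T * D T / T - 1) with ((nn D T - T / D T) * (D T * / T)) by (field; lra).
      assert (0 < / T) by pos.
      assert (0 <= D T * / T <= Dmax * / T) by (split; [pos|apply Rmult_le_compat_r; lra]).
      rewrite Rabs_mult, (Rabs_pos_eq (D T * / T)) by lra.
      apply Rle_trans with (1 * (D T * / T)); [|lra].
      apply Rmult_le_compat_r; [lra|]. apply Rabs_le. lra.
    - replace 0 with (Dmax * 0) by ring. apply cv_scal, cvinf_inv. exact FT_ge. }
  apply (regime_ab th D th_pos D_pos (th * Dmax) q0 _); try assumption.
  - pos.
  - generalize D_le. apply filter_imp. intros T H. unfold lam. apply Rmult_le_compat_l; lra.
  - apply (cv_ext (fun T => / (nn D T * D T / T) * (q0 * / (lam th D T * fisher (lam th D T))))).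
    + generalize (filter_and _ _ (FT_ge 0) (Hlim (1 / 2) ltac:(lra))). apply filter_imp. intros T [HT Hb].
      apply Rabs_lt_between in Hb. pose proof (D_pos T) as HD.
      pose proof (lam_pos th D th_pos D_pos T) as Hl. pose proof (fisher_pos _ Hl) as Hphi.
      assert (Hn : nn D T <> 0).
      { intros H0. rewrite H0 in Hb. unfold Rdiv in Hb. lra. }
      set (ph := fisher (lam th D T)) in *. unfold lam. field. repeat split; lra.
    + replace 1 with (/ 1 * (q0 * / q0)) by (field; lra).
      apply cv_mult; [apply cv_inv; [lra|exact Hlim]|]. apply cv_scal, cv_inv; [lra|exact q_lim].
Qed.
End Bounded.

Theorem theorem6 (Th : R -> Prop) (Th_open : open_set Th)
  (Th_pos : forall t, Th t -> 0 < t) (D : R -> R) (D_pos : forall T, 0 < D T) :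
  (* regime (a) *)
  (lim_infty D 0 ->
     forall th, Th th -> conv_std_normal D th (fun T => T / th)) /\
  (* regime (b) *)
  (forall Dinf, 0 < Dinf -> lim_infty D Dinf ->
     forall th, Th th -> conv_std_normal D th (fun T => T * Dinf * phiD th Dinf)) /\
  (* regime (c) *)
  (to_infty D -> to_infty (fun T => T / D T) ->
   lim_infty (fun T => T / Rpower (D T) (5/4) * Rpower (ln (T / D T)) (1/4)) 0 ->
     forall th, Th th -> conv_std_normal D th (fun T => T / D T / (2 * th ^ 2))).
Proof.
  split; [|split].
  - intros HD th Hth. apply Th_pos in Hth. apply lim_infty_cv in HD.
    assert (Hl : cv FT (lam th D) 0).
    { replace 0 with (th * 0) by ring. apply cv_scal, HD. }
    replace (fun T => T / th) with (fun T => T * 1 / th)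
      by (apply functional_extensionality; intros; f_equal; ring).
    apply (regime_bounded th 1 1 D Hth D_pos); try lra.
    + generalize (HD 1 ltac:(lra)). apply filter_imp. intros T H. apply Rabs_lt_between in H. lra.
    + apply cv_squeeze with (fun T => 3 * lam th D T).
      * apply filter_forall. intros T. apply fisher_small, lam_pos; assumption.
      * replace 0 with (3 * 0) by ring. apply cv_scal, Hl.
  - intros Dinf Hinf HD th Hth. apply Th_pos in Hth. apply lim_infty_cv in HD.
    assert (Hl : cv FT (lam th D) (th * Dinf)) by (apply cv_scal, HD).
    assert (Hp : 0 < th * Dinf) by pos.
    replace (fun T => T * Dinf * phiD th Dinf) with (fun T => T * (th * Dinf * fisher (th * Dinf)) / th)
      by (apply functional_extensionality; intros; rewrite phiD_fisher; field; lra).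
    apply (regime_bounded th (2 * Dinf) (th * Dinf * fisher (th * Dinf)) D Hth D_pos); try lra.
    + apply Rmult_lt_0_compat; [exact Hp|apply fisher_pos, Hp].
    + generalize (HD Dinf Hinf). apply filter_imp. intros T H. apply Rabs_lt_between in H. lra.
    + apply cv_mult; [exact Hl|]. apply (cv_comp fisher); [apply fisher_continuous, Hp|exact Hl].
  - intros HD HN Hrate th Hth. apply Th_pos in Hth. apply lim_infty_cv in Hrate.
    assert (HD' : cvinf FT D).
    { intros A. destruct (HD A) as [T0 H0]. exists T0. intros T HT. apply H0. lra. }
    assert (HN' : cvinf FT (fun T => T / D T)).
    { intros A. destruct (HN A) as [T0 H0]. exists T0. intros T HT. apply H0. lra. }
    apply (regime_c th D Hth D_pos); [apply cvinf_scal; assumption|exact HN'|].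
    apply cv_squeeze with (fun T => / th * / sqrt (D T)).
    + generalize (filter_and _ _ (Hrate 1 Rlt_0_1) (filter_and _ _ (HN' 3) (filter_and _ _ (HD' 1) (FT_ge 0)))).
      apply filter_imp. intros T (H1 & H2 & H3 & H4). pose proof (D_pos T) as HDp.
      destruct (sqrt_sqr (D T) HDp) as [Hs Hq].
      (* As soon as [T / D T > 3 >= e] the logarithmic factor is at least [1], so bounding the
         product by [1] also bounds its first factor. *)
      assert (Hln : 1 <= Rpower (ln (T / D T)) (1 / 4)).
      { unfold Rpower. apply Rle_trans with (exp 0); [rewrite exp_0; lra|].
        assert (Hl1 : 1 <= ln (T / D T)).
        { rewrite <- (ln_exp 1). left. apply ln_increasing; [apply exp_pos|]. pose proof exp_le_3. lra. }
        assert (0 <= 1 / 4 * ln (ln (T / D T))).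
        { apply Rmult_le_pos; [lra|]. rewrite <- ln_1. destruct Hl1 as [Hl1|Hl1].
          - left. apply ln_increasing; lra.
          - rewrite <- Hl1. lra. }
        destruct H as [H|H]; [left; apply exp_increasing, H|rewrite <- H; lra]. }
      (* This leads to [T <= Delta^(5/4) <= Delta^2], that is [T / Delta <= Delta]; the root divided
         by [l = theta Delta] is then at most [1 / (theta sqrt Delta)]. *)
      assert (Hpow : Rpower (D T) (5 / 4) <= D T ^ 2).
      { rewrite <- Rpower_pow by exact HDp. apply Rle_Rpower; [lra|simpl; lra]. }
      assert (Hpos : 0 < Rpower (D T) (5 / 4)) by apply exp_pos.
      rewrite Rminus_0_r in H1. apply Rabs_lt_between in H1.
      assert (Hx : T / Rpower (D T) (5 / 4) <= 1).
      {
        nra. }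
      apply Rle_div_l in Hx; [|exact Hpos]. rewrite Rmult_1_l in Hx.
      assert (HND : T / D T <= D T) by (apply div_le; [exact HDp|simpl in Hpow; lra]).
      rewrite Rminus_0_r, Rabs_pos_eq.
      2:{ apply Rmult_le_pos; [apply sqrt_pos|left; apply Rinv_0_lt_compat, lam_pos; assumption]. }
      apply Rle_trans with (sqrt (D T) * / lam th D T).
      * apply Rmult_le_compat_r; [left; apply Rinv_0_lt_compat, lam_pos; assumption|].
        apply sqrt_le_1_alt, HND.
      * right. unfold lam. rewrite <- Hq at 2. field. lra.
    + replace 0 with (/ th * 0) by ring. apply cv_scal, cvinf_inv, cvinf_sqrt, HD'.
Qed.
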